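(* For even $n$, let $G$ be chosen uniformly at random among all $4$-colourful graphs on $[1..n]$ such that $|X(G)|$ is a $3$-manifold, and let $V_n$ be the number of vertices of the complex $X(G)$. Then for every $c>0$ there exists $K>0$ such that for all even $n\geq 2$, $$\mathbf{Pr}\left(V_n\leq \frac{Kn}{\log n}\right)\geq 1-e^{-cn}.$$ In particular $V_n=O(n/\log n)$ with high probability.
   Context: For $n$ even, a $4$-colourful graph of order $n$ is a bipartite $4$-regular multigraph on $[1..n]$ whose edges are coloured with colours in $[1..4]$ so that each vertex is incident to exactly one edge of each colour. Given such $G$, the cell complex $X(G)$ is built by associating to each vertex of $G$ a tetrahedron with vertices coloured $1,2,3,4$, and, for each edge $\{u,v\}$ of colour $i$, gluing the facets of the tetrahedra of $u$ and $v$ whose vertices are coloured $[1..4]\setminus\{i\}$ by the unique colour-preserving isometry; $|X(G)|$ is the resulting topological space. A manifold means a compact topological manifold without boundary. The vertices of $X(G)$ of colour $i$ are in bijection with the connected components of the subgraph of $G$ consisting of the edges with colours in $[1..4]\setminus\{i\}$. *)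

(* Defs.v *)
From HB Require Import structures.
From mathcomp Require Import all_boot all_order all_algebra perm.
From mathcomp Require Import all_classical all_reals all_analysis.
From Stdlib Require Import Relation_Operators.
Unset Printing Implicit Defensive.
Import Order.TTheory GRing.Theory Num.Theory.
Import numFieldNormedType.Exports.
Local Open Scope classical_set_scope.
Local Open Scope ring_scope.

(* A 4-colourful graph of order n on the vertex set 'I_n (= [1..n]):
   for each colour c : 'I_4 the edges of colour c form a perfect matching,
   encoded as the permutation sigma c sending a vertex to its c-neighbour.
   Since each vertex has exactly one edge of each colour, the (labelled)
   coloured multigraph is exactly the 4-tuple of these matchings. *)
Definition colgraph (n : nat) := {ffun 'I_4 -> {perm 'I_n}}.

Definition colourful (n : nat) (G : colgraph n) : bool :=
  [forall c, forall u, (G c (G c u) == u) && (G c u != u)] &&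
  [exists side : {ffun 'I_n -> bool}, forall c, forall u, side (G c u) != side u].

(* standard tetrahedron in barycentric coordinates; coordinate j is the
   weight of the vertex coloured j *)
Definition tetra (R : realType) : set 'rV[R]_4 :=
  [set x | (forall j, 0 <= x 0 j) /\ \sum_(j < 4) x 0 j = 1].

Definition tetras (R : realType) (n : nat) : set {u : 'I_n & 'rV[R]_4} :=
  [set p | tetra R (projT2 p)].

Notation tetspace R n := (set_type (tetras R n)).

(* elementary gluing: for an edge {u,v} of colour c, the facet of the
   tetrahedron of u opposite to the vertex of colour c is glued to the
   corresponding facet of v by the colour-preserving isometry, which in
   barycentric coordinates indexed by colours is the identity. *)
Definition glue (R : realType) (n : nat) (G : colgraph n)
  (p q : tetspace R n) : Prop :=
  exists c : 'I_4,
    projT1 (sval p) != projT1 (sval q) /\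
    G c (projT1 (sval p)) = projT1 (sval q) /\
    (projT2 (sval p)) 0 c = 0 /\ projT2 (sval p) = projT2 (sval q).

Definition glue_equiv (R : realType) (n : nat) (G : colgraph n) :=
  Relation_Operators.clos_refl_sym_trans _ (glue R n G).

Definition is_realisation (R : realType) (n : nat) (G : colgraph n)
  (M : topologicalType) (q : tetspace R n -> M) : Prop :=
  (forall m : M, exists p, q p = m) /\
  (forall U : set M, open U <-> open (q @^-1` U)) /\
  (forall p p', q p = q p' <-> glue_equiv R n G p p').

(* topological 3-manifold without boundary (compactness is automatic for a
   quotient of finitely many tetrahedra): Hausdorff and locally homeomorphic
   to R^3 *)
Definition locally_R3 (R : realType) (M : topologicalType) : Prop :=
  forall m : M, exists (U : set M) (V : set 'rV[R]_3)
    (f : M -> 'rV[R]_3) (g : 'rV[R]_3 -> M),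
    [/\ [/\ open U, U m & open V],
        ({within U, continuous f}), ({within V, continuous g}),
        (forall x, U x -> V (f x) /\ g (f x) = x) &
        (forall y, V y -> U (g y) /\ f (g y) = y)].

Definition is_3manifold (R : realType) (M : topologicalType) : Prop :=
  hausdorff_space M /\ locally_R3 R M.

Definition X_is_3manifold (R : realType) (n : nat) (G : colgraph n) : Prop :=
  exists (M : topologicalType) (q : tetspace R n -> M),
    is_realisation R n G M q /\ is_3manifold R M.

Definition manifold_graphs (R : realType) (n : nat) : {set colgraph n} :=
  [set G | colourful n G && `[< X_is_3manifold R n G >] ].

(* number of vertices of X(G): the vertices of colour c correspond to the
   connected components of the subgraph with colours other than c *)
Definition adj_without (n : nat) (G : colgraph n) (c : 'I_4) : rel 'I_n :=
  fun u v => [exists d : 'I_4, (d != c) && (G d u == v)].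

Definition nverts (n : nat) (G : colgraph n) : nat :=
  \sum_(c < 4) n_comp (adj_without n G c) 'I_n.

Definition prob_few_vertices (R : realType) (n : nat) (K : R) : R :=
  #|[set G in manifold_graphs R n |
      (nverts n G)%:R <= K * n%:R / ln (n%:R : R)]|%:R
  / #|manifold_graphs R n|%:R.

(* Main.v *)
(* Let c_ij be the number of components of the edges of colours i, j, and V_l
   the number of components of the edges of colours other than l, so that
   V = V_1 + ... + V_4. If |X(G)| is a manifold, every link is a sphere; this
   enters only as H^1(link; Z/2) = 0, proved by comparing a small copy of the
   link with a shell in R^3. Hence, once the colours i and j are known, the
   colours k and l are planar gluings of the ij-cycles. A planar gluing is a
   spanning forest of merges followed by a noncrossing matching, so there are
   at most C^n n^d of them when d components are merged, and G can be encoded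
   in C^n n^(n + c_ij - V_k - V_l) ways. Euler's inequality for the four links,
   averaged over the six pairs, gives a pair with
   6 (n + c_ij - V_k - V_l) <= 7 n - 2 V. Conversely, two rings of dipoles,
   joined through a middle layer by an arbitrary permutation of n/6 positions,
   give at least n! (n/6)! / n^4 labelled manifolds: inserting a dipole
   subdivides one cone of a chart, so all vertex stars are copies of R^3.
   The ratio of the two counts is C^n n^(-V/3). *)
Require Import Defs.
From HB Require Import structures.
From mathcomp Require Import all_boot perm zify.
Set Implicit Arguments.
Unset Strict Implicit.
Unset Printing Implicit Defensive.

(** * Counting planar gluings *)

(** The threshold n / log n is where n^(-V/3) becomes exponential: for V = K n / log n it equals
    e^(-K n / 3), which beats any C^n once K is large. Both counts may therefore lose factors C^n
    freely, but both must have the exact power n^(7n/6); this dictates the three-layer family, since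
    n! (n/6)! has that order. Without planarity the edges left after the merges could form arbitrary
    chord diagrams, at the cost of a further power of n; with planarity a bracket word, one of C^n,
    records them. A chart of a manifold is only a homeomorphism, so the copy of a link in R^3 may be
    wild, and it is never compared with a round sphere. The vanishing of H^1 survives this: a mod 2
    cocycle on the punctured star restricts to a cubical shell, is trivial there because the shell
    is built from boxes with connected intersections, and so is trivial on the small link inside the
    shell. In the other direction, the stars of the constructed complexes are recognised by explicit
    piecewise linear homeomorphisms onto R^3. *)

Section Counting_components.
Variable T : finType.

Lemma card_image_le_n_comp (rT : finType) (e : rel T) (f : T -> rT) :
  connect_sym e -> (forall u v, e u v -> f u = f v) ->
  #|[set f u | u in T]| <= n_comp e T.
Proof.
move=> es ef.
have cf u v : connect e u v -> f u = f v.
  case/connectP=> p; elim: p u => [|w p IH] u /= => [_ ->//|/andP[/ef-> pw]].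
  exact: IH.
have -> : [set f u | u in T] = [set f u | u in roots e].
  apply/setP=> y; apply/imsetP/imsetP=> -[u _ ->]; last by exists u.
  by exists (root e u); [rewrite inE roots_root|apply: cf; exact: connect_root].
apply: leq_trans (leq_imset_card _ _) _.
by apply: subset_leq_card; apply/subsetP=> u ur; rewrite inE /= andbT.
Qed.

Lemma n_comp_le_porbits (e : rel T) (s : {perm T}) :
  connect_sym e -> (forall u, connect e u (s u)) -> n_comp e T <= #|porbits s|.
Proof.
move=> es cs.
have cp u v : v \in porbit s u -> connect e u v.
  case/porbitP=> k ->; elim: k => [|k IH]; first by rewrite expg0 perm1.
  by rewrite expgSr permM; apply: connect_trans IH (cs _).
rewrite /n_comp_mem -(card_in_imset (f := fun u => porbit s u)).
  by apply: subset_leq_card; apply/subsetP=> y /imsetP[u _ ->]; apply: imset_f.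
move=> u v; rewrite !inE => /andP[/eqP ru _] /andP[/eqP rv _] eq_uv.
have : v \in porbit s u by rewrite eq_uv porbit_id.
by move=> /cp /(rootP es); rewrite ru rv.
Qed.

Lemma card_image_le_porbits (rT : finType) (s : {perm T}) (f : T -> rT) :
  (forall u, f (s u) = f u) -> #|[set f u | u in T]| <= #|porbits s|.
Proof.
move=> fs.
have fp u v : v \in porbit s u -> f v = f u.
  case/porbitP=> k ->; elim: k => [|k IH]; first by rewrite expg0 perm1.
  by rewrite expgSr permM fs.
pose g (P : {set T}) := [set f u | u in P].
rewrite -(card_imset _ (@set1_inj rT)).
apply: leq_trans (leq_imset_card g _).
apply: subset_leq_card; apply/subsetP=> y /imsetP[_ /imsetP[u _ ->] ->].
apply/imsetP; exists (porbit s u); first exact: imset_f.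
apply/setP=> z; rewrite inE; apply/eqP/imsetP=> [->|[v /fp -> ->]//].
by exists u; rewrite ?porbit_id.
Qed.

End Counting_components.

(** * Merging cycles along a spanning forest of gluings *)

Section Partial_gluings.
Variables (T : finType) (rho : {perm T}) (al : T -> T).
Hypotheses (alK : involutive al) (al_neq : forall u, al u != u).
Implicit Types (A B : {set T}) (u v x y : T).

(** Testing both ends makes this an involution for every set [A], so that it can be packed as a
    permutation. *)
Definition restrict_fun A u := if (u \in A) && (al u \in A) then al u else u.

Lemma restrict_fun_inj A : injective (restrict_fun A).
Proof.
have K : involutive (restrict_fun A).
  move=> u; rewrite /restrict_fun; case E: ((u \in A) && (al u \in A)).
    by case/andP: E => uA aA; rewrite alK aA uA.
  by rewrite E.
exact: inv_inj.
Qed.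

Definition restrict_perm A : {perm T} := perm (@restrict_fun_inj A).

Definition al_stable A := [forall u, (al u \in A) == (u \in A)].

Lemma al_stableP A : reflect (forall u, (al u \in A) = (u \in A)) (al_stable A).
Proof. by apply: (iffP forallP) => h u; apply/eqP; rewrite ?h. Qed.

Lemma restrict_permE A u :
  al_stable A -> restrict_perm A u = if u \in A then al u else u.
Proof. by move/al_stableP=> sA; rewrite permE /restrict_fun sA andbb. Qed.

(** If [rho] runs around polygons, [glued A] runs around the boundaries left after the sides in [A]
    have been glued; glued sides are still visited on the way, so the permutation acts on all of
    [T]. *)
Definition glued A := (restrict_perm A * rho)%g.

Lemma gluedE A u : al_stable A -> glued A u = rho (if u \in A then al u else u).
Proof. by move=> sA; rewrite permM restrict_permE. Qed.

Lemma al_stableU A x : al_stable A -> al_stable (x |: (al x |: A)).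
Proof.
move/al_stableP=> sA; apply/al_stableP=> u.
rewrite !inE sA (inj_eq (inv_inj alK)) orbCA; congr (_ || (_ || _)).
by rewrite (can2_eq alK alK).
Qed.

Lemma restrict_permU A x : al_stable A -> x \notin A ->
  restrict_perm (x |: (al x |: A)) = (tperm x (al x) * restrict_perm A)%g.
Proof.
move=> sA xA; apply/permP=> u.
rewrite restrict_permE ?al_stableU // permM restrict_permE // !inE.
have /al_stableP sA' := sA.
case: tpermP => [->|->|/eqP/negbTE ux /eqP/negbTE ua].
- by rewrite eqxx sA' (negbTE xA).
- by rewrite eqxx orbT (negbTE xA) alK.
- by rewrite ux ua.
Qed.

Lemma card_glue_edge A x : al_stable A -> x \notin A ->
  #|x |: (al x |: A)| = #|A|.+2.
Proof.
move=> /al_stableP sA xA; rewrite !cardsU1 !inE sA (negbTE xA) eq_sym.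
by rewrite (negbTE (al_neq x)).
Qed.

Definition ncyc A := #|porbits (glued A)|.

(** Composing with a transposition merges two cycles or splits one; the doubled term is present
    exactly when it merges. *)
Lemma ncyc_glue_edge A x : al_stable A -> x \notin A ->
  ncyc (x |: (al x |: A)) + (x \notin porbit (glued A) (al x)).*2 = (ncyc A).+1.
Proof.
move=> sA xA; rewrite /ncyc {1}/glued restrict_permU // -mulgA.
by rewrite porbits_mul_tperm eq_sym al_neq addn1.
Qed.

Lemma ncyc0 : ncyc set0 = #|porbits rho|.
Proof.
congr #|porbits _|; apply/permP=> u.
rewrite gluedE ?inE //; by apply/al_stableP=> v; rewrite !inE.
Qed.

Lemma al_stableD A x : al_stable A -> al_stable (A :\: [set x; al x]).
Proof.
move/al_stableP=> sA; apply/al_stableP=> u.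
by rewrite !inE sA (can2_eq alK alK) (inj_eq (inv_inj alK)) orbC.
Qed.

Lemma glue_edgeD A x : al_stable A -> x \in A ->
  x |: (al x |: (A :\: [set x; al x])) = A.
Proof.
move/al_stableP=> sA xA; apply/setP=> u; rewrite !inE.
have [->|_] := eqVneq u x; first by rewrite xA.
by have [->|_] := eqVneq u (al x); rewrite //= sA xA.
Qed.

(** Gluing the edges of [B :\: A] one at a time changes the number of cycles by one each time, and
    an edge has two ends. *)
Lemma ncyc_lipschitz A B : al_stable A -> al_stable B -> A \subset B ->
  (ncyc B).*2 <= (ncyc A).*2 + #|B :\: A| /\
  (ncyc A).*2 <= (ncyc B).*2 + #|B :\: A|.
Proof.
move=> sA; move: {2}#|B| (leqnn #|B|) => k; elim: k B => [|k IH] B.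
  rewrite leqn0 cards_eq0 => /eqP-> _; rewrite subset0 => /eqP->; lia.
move=> cB sB AB; have [/eqP|[x]] := set_0Vmem (B :\: A).
  rewrite setD_eq0 => BA; have -> : A = B by apply/eqP; rewrite eqEsubset AB.
  by rewrite setDv cards0 !addn0.
rewrite inE => /andP[xA xB].
set C := B :\: [set x; al x].
have xC : x \notin C by rewrite !inE eqxx.
have sC : al_stable C by exact: al_stableD.
have BE : x |: (al x |: C) = B by exact: glue_edgeD.
have cC := card_glue_edge sC xC; rewrite BE in cC.
have AC : A \subset C.
  apply/subsetP=> u uA; rewrite !inE (subsetP AB) // andbT negb_or.
  apply/andP; split; apply: contraNneq xA => E; first by rewrite -E.
  by move/al_stableP: sA => /(_ x) <-; rewrite -E.
have [] := IH C _ sC AC; first by lia.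
have := ncyc_glue_edge sC xC; rewrite BE.
have := cardsDS AB; have := cardsDS AC; have := subset_leq_card AC.
have := subset_leq_card AB; lia.
Qed.

(** Take a largest partial gluing all of whose edges merge two cycles: a spanning forest of the
    graph whose nodes are the cycles of [rho]. Maximality puts the ends of any other edge on one
    cycle. *)
Lemma exists_spanning_gluing : exists A,
  [/\ al_stable A, (ncyc A).*2 + #|A| = #|porbits rho|.*2 &
      forall u, al u \in porbit (glued A) u].
Proof.
have s0 : al_stable set0 by apply/al_stableP=> v; rewrite !inE.
pose P A := al_stable A && ((ncyc A).*2 + #|A| == #|porbits rho|.*2).
have P0 : P set0 by rewrite /P s0 ncyc0 cards0 addn0 eqxx.
case: (arg_maxnP (fun A => #|A|) P0) => A /andP[sA /eqP cA] maxA.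
exists A; split=> // u; have [uA|uA] := boolP (u \in A).
  set C := A :\: [set u; al u].
  have uC : u \notin C by rewrite !inE eqxx.
  have sC : al_stable C by exact: al_stableD.
  have AE : u |: (al u |: C) = A by exact: glue_edgeD.
  have cC := card_glue_edge sC uC; rewrite AE in cC.
  have EA := ncyc_glue_edge sC uC; rewrite AE in EA.
  (* With this edge removed, at least [#|porbits rho| - #|C| / 2] cycles remain, so restoring the
     edge must merge two of them. *)
  have [h1 h2] := ncyc_lipschitz s0 sC (sub0set _).
  rewrite ncyc0 setD0 in h1 h2.
  have nin : u \notin porbit (glued C) (al u) by lia.
  have /= := porbits_mul_tperm (glued A) u (al u).
  have -> : (tperm u (al u) * glued A)%g = glued C.
    by rewrite /glued -{1}AE restrict_permU // !mulgA tperm2 mul1g.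
  rewrite eq_sym al_neq -/(ncyc A) -/(ncyc C) porbit_sym.
  by case: (al u \in _) => //=; rewrite nin /= in EA; lia.
rewrite porbit_sym; apply: contraT => nin.
have := ncyc_glue_edge sA uA; rewrite nin /= => E.
have cA' := card_glue_edge sA uA.
have : P (u |: (al u |: A)) by rewrite /P al_stableU // cA'; apply/eqP; move: E cA; rewrite -!addnn; lia.
by move/maxA; lia.
Qed.

(* [#|T|./2] counts the cycles of [al]. *)
Lemma gluing_euler (k : nat) :
  (forall s : {perm T}, (forall u, rho u \in porbit s u) ->
     (forall u, al u \in porbit s u) -> #|porbits s| <= k) ->
  forall s : {perm T}, (forall u, s u = rho (al u)) ->
  (#|porbits rho| + #|porbits s|).*2 + #|T| <= #|T|.*2 + k.*2.*2.
Proof.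
move=> kmin s sE.
have [A [sA cA orbA]] := exists_spanning_gluing.
have sT : al_stable setT by apply/al_stableP=> v; rewrite !inE.
have sgT : s = glued setT by apply/permP=> u; rewrite gluedE // inE sE.
have [h _] := ncyc_lipschitz sA sT (subsetT _).
(* The cycles after the forest are closed under [rho] and [al], so there are at most [k]; each
   remaining edge then splits off at most one more. *)
have hk : ncyc A <= k.
  apply: kmin => // u; have := mem_porbit (glued A) 1 (al u).
  have := mem_porbit (glued A) 1 u.
  rewrite expg1 !gluedE //; move/al_stableP: sA => ->.
  case: ifP => // _ _; rewrite alK.
  by move: (orbA u); rewrite -eq_porbit_mem => /eqP->.
have es : #|porbits s| = ncyc setT by rewrite {1}sgT.
have cT : #|A| <= #|T| by rewrite -cardsT subset_leq_card ?subsetT.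
have := cardsDS (subsetT A); rewrite cardsT.
lia.
Qed.

End Partial_gluings.

(** * A linear order along the cycles of a permutation *)

Section Cyclic_position.
Variables (T : finType) (s : {perm T}).
Implicit Types (u v x y z : T).

Let si : injective s := @perm_inj T s.

Definition cyc_index u := findex s (froot s u) u.
(** Lists the cycles one after the other, each cut open at its root. A chord of a cycle then spans
    an interval, and a matching without crossings reads as a bracket word. *)
Definition cyc_pos u := enum_rank (froot s u) * #|T| + cyc_index u.

Lemma porbit_froot u v : v \in porbit s u -> froot s v = froot s u.
Proof.
case/porbitP=> k ->; apply/esym/(rootP (fconnect_sym si)).
by rewrite permX fconnect_iter.
Qed.

Lemma iter_cyc_index u : iter (cyc_index u) s (froot s u) = u.
Proof. by apply: iter_findex; rewrite (fconnect_sym si) connect_root. Qed.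

Lemma cyc_index_order u : cyc_index u < order s (froot s u).
Proof. by apply: findex_max; rewrite (fconnect_sym si) connect_root. Qed.

Lemma cyc_index_inj u v :
  froot s u = froot s v -> cyc_index u = cyc_index v -> u = v.
Proof. by move=> er ei; rewrite -(iter_cyc_index u) er ei iter_cyc_index. Qed.

Lemma froot_step u : froot s (s u) = froot s u.
Proof. by apply: porbit_froot; apply: (mem_porbit s 1). Qed.

Lemma cyc_index_step u : cyc_index (s u) =
  if (cyc_index u).+1 == order s (froot s u) then 0 else (cyc_index u).+1.
Proof.
rewrite {1}/cyc_index froot_step -{2}(iter_cyc_index u) -iterS.
case: eqP => [->|/eqP ne]; first by rewrite iter_order // findex0.
by rewrite findex_iter // ltn_neqAle ne cyc_index_order.
Qed.

Lemma cyc_pos_inj : injective cyc_pos.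
Proof.
have lt u : cyc_index u < #|T|.
  by apply: leq_trans (cyc_index_order u) _; apply: max_card.
move=> u v; rewrite /cyc_pos => E.
have T0 : 0 < #|T| by apply: leq_ltn_trans (lt u).
have := congr1 (fun k => k %/ #|T|) E; have := congr1 (fun k => k %% #|T|) E.
rewrite !modnMDl !divnMDl // !modn_small // !divn_small // !addn0.
by move=> ei /val_inj/enum_rank_inj er; apply: cyc_index_inj.
Qed.

Lemma cyc_pos_between x y z : froot s y = froot s x ->
  cyc_pos x < cyc_pos z < cyc_pos y -> froot s z = froot s x.
Proof.
move=> er; rewrite /cyc_pos er => /andP[xz zy]; apply/enum_rank_inj/val_inj.
have lt u : cyc_index u < #|T|.
  by apply: leq_trans (cyc_index_order u) _; apply: max_card.
move: xz zy (lt y) (lt z) => /=.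
move: (val (enum_rank _)) (val (enum_rank _)) => a b.
have [ab|ba|//] := ltngtP a b.
  by have := leq_mul ab (leqnn #|T|); rewrite mulSn; move: #|T| => N; nia.
by have := leq_mul ba (leqnn #|T|); rewrite mulSn; move: #|T| => N; nia.
Qed.

Lemma cyc_pos_lt u v : froot s u = froot s v ->
  (cyc_pos u < cyc_pos v) = (cyc_index u < cyc_index v).
Proof. by rewrite /cyc_pos => ->; rewrite ltn_add2l. Qed.

(** [S] is the arc that [x] and [y] cut out of their cycle: it changes only on leaving [x] and on
    leaving [y]. *)
Lemma exists_arc x y : froot s y = froot s x ->
  exists S : T -> bool, forall u, S (s u) = S u (+) ((u == x) (+) (u == y)).
Proof.
move=> er; exists (fun u => (froot s u == froot s x) &&
  ((cyc_index x < cyc_index u) (+) (cyc_index y < cyc_index u))) => u.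
rewrite froot_step; have [eu|nu] := eqVneq (froot s u) (froot s x) => /=; last first.
  have -> : (u == x) = false by apply: contraNF nu => /eqP->.
  by have -> : (u == y) = false by apply: contraNF nu => /eqP->; rewrite er.
have eqi v : froot s v = froot s x -> (u == v) = (cyc_index u == cyc_index v).
  move=> ev; apply/eqP/eqP => [->//|]; apply: cyc_index_inj; by rewrite eu ev.
rewrite cyc_index_step eu !eqi //.
have := cyc_index_order x; have := cyc_index_order y; rewrite er.
move: (cyc_index _) (cyc_index _) (cyc_index u) (order _ _) => a b c o.
by case: eqP => ?; do ![case: eqP => ?|case: ltnP => ?] => //=; lia.
Qed.

(** The counterpart of [exists_arc]: a function that flips exactly on entering [x] and on entering
    [y] takes one value on each of the two arcs. *)
Lemma arc_values x y (K : T -> bool) : froot s y = froot s x -> x != y ->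
  (forall u, K (s u) = K u (+) ((s u == x) || (s u == y))) ->
  exists K0, forall z, froot s z = froot s x ->
    K z = K0 (+) ((cyc_index x <= cyc_index z) (+) (cyc_index y <= cyc_index z)).
Proof.
move=> er xy Ks; set r := froot s x.
exists (K r (+) ((cyc_index x <= 0) (+) (cyc_index y <= 0))).
have rr : froot s r = r by rewrite /r (root_root (fconnect_sym si)).
have key i : i < order s r -> let z := iter i s r in
  [/\ froot s z = r, cyc_index z = i & K z = K r (+) ((cyc_index x <= 0) (+)
    (cyc_index y <= 0)) (+) ((cyc_index x <= i) (+) (cyc_index y <= i))].
  elim: i => [|i IH] iO /=.
    by split; rewrite ?rr // ?/cyc_index ?rr ?findex0 //; case: (K r);
      case: (_ <= 0); case: (_ <= 0).
  have [er' ei EK] := IH (ltnW iO); set z := iter i s r in er' ei EK *.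
  have ez : cyc_index (s z) = i.+1.
    by rewrite cyc_index_step er' ei ltn_eqF.
  split; rewrite ?froot_step // Ks EK.
  have eqi v : froot s v = r -> (s z == v) = (cyc_index v == i.+1).
    move=> ev; rewrite -ez eq_sym; apply/eqP/eqP => [->//|].
    by apply: cyc_index_inj; rewrite froot_step er' ev.
  rewrite !eqi // .
  have nxy : cyc_index x != cyc_index y.
    by apply: contra_neq xy; apply: cyc_index_inj.
  rewrite -!addbA; congr (_ (+) (_ (+) (_ (+) _))).
  move: (cyc_index x) (cyc_index y) nxy => a b.
  by do ![case: eqP => ?|case: leqP => ?] => //=; lia.
move=> z ez; have zO : cyc_index z < order s r by rewrite -ez cyc_index_order.
have Ez : iter (cyc_index z) s r = z by rewrite -ez iter_cyc_index.
by have [_ _] := key _ zO; rewrite Ez addbA.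
Qed.

End Cyclic_position.

(** * Noncrossing matchings as bracket words *)

Section Noncrossing_matchings.
Variables (T : finType) (pos : T -> nat) (B : {set T}).
Hypothesis pos_inj : injective pos.

Definition noncrossing (a : T -> T) := forall x z, x \in B -> z \in B ->
  pos x < pos z < pos (a x) -> pos x < pos (a z) < pos (a x).

(** A bracket word determines its matching. If [a x] closes before [b x], then [b (a x)] opens
    strictly between [x] and [a x], and the chord of [a] starting there is nested and shorter; by
    induction both matchings agree on it, which gives [a x] two partners. *)
Lemma noncrossing_unique (a b : T -> T) :
  involutive a -> involutive b -> (forall u, a u != u) -> (forall u, b u != u) ->
  (forall u, (a u \in B) = (u \in B)) -> (forall u, (b u \in B) = (u \in B)) ->
  noncrossing a -> noncrossing b ->
  {in B, forall u, (pos u < pos (a u)) = (pos u < pos (b u))} ->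
  {in B, a =1 b}.
Proof.
have pne (c : T -> T) u : c u != u -> pos (c u) <> pos u.
  by move=> h /pos_inj E; rewrite E eqxx in h.
move=> aK bK an bn aB bB nca ncb w.
(* Induction on the length of the shorter of the two chords that open at [x]. *)
have open k : forall x, x \in B -> pos x < pos (a x) ->
    minn (pos (a x)) (pos (b x)) - pos x <= k -> a x = b x.
  move: a b aK bK an bn aB bB nca ncb w.
  elim: k => [|k IH] a' b' aK' bK' an' bn' aB' bB' nca' ncb' w' x xB xa.
    by have := w' x xB; rewrite xa => /esym; lia.
  have xb : pos x < pos (b' x) by rewrite -w'.
  wlog lt : a' b' aK' bK' an' bn' aB' bB' nca' ncb' w' xa xb
      / pos (a' x) < pos (b' x) => [hw|] hk.
    have [lt|gt|/pos_inj//] := ltngtP (pos (a' x)) (pos (b' x)).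
      exact: hw hk.
    apply/esym; apply: hw; rewrite // 1?minnC //.
    by move=> u uB; rewrite w'.
  set y := a' x in lt hk xa; have yB : y \in B by rewrite aB'.
  have /andP[xz zx] := ncb' x y xB yB (introT andP (conj xa lt)).
  set z := b' y in xz zx; have zB : z \in B by rewrite bB'.
  have zy : pos z < pos y.
    have ay : a' y = x by rewrite /y aK'.
    have := w' y yB; have := pne b' y (bn' y); rewrite ay -/z; lia.
  have /andP[xaz azy] := nca' x z xB zB (introT andP (conj xz zy)).
  have bz : b' z = y by rewrite /z bK'.
  have oz : pos z < pos (a' z) by rewrite w' // bz.
  have : a' z = b' z.
    apply: (IH a' b') => //; rewrite bz; rewrite -/y in azy; move: hk; lia.
  rewrite bz => E; rewrite E -/y in azy; lia.
move=> x xB; have [xa|ax] := ltnP (pos x) (pos (a x)); first exact: (open _ x).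
have ax' : pos (a x) < pos x by have := pne a x (an x); lia.
have : a (a x) = b (a x) by apply: (open _ (a x)); rewrite ?aB ?aK.
by rewrite aK => E; rewrite {2}E bK.
Qed.

End Noncrossing_matchings.

(* The cells of a surface are polygons whose sides are permuted cyclically by
   [rho] and glued by [al]. A mod 2 cycle [E] of the dual graph must be a
   boundary, with [F] as the set of vertices on one side: this says H_1 = 0. *)
Definition planar_gluing (T : finType) (rho al : T -> T) : Prop :=
  forall E : T -> bool, (forall u, E (al u) = E u) ->
    (exists S : T -> bool, forall u, S (rho u) = S u (+) E u) ->
  exists F : T -> bool, forall u,
    F (rho u) = F u (+) E (rho u) /\ F (al u) = F u (+) E u.

(** * Codes of planar gluings *)

Section Codes.
Variables (T : finType) (rho : {perm T}).
Implicit Types (al : T -> T).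

(** A closed dual curve leaves the merged polygon through the side [x] and returns through [al x].
    By planarity it has two sides; gluing [z] to [al z] does not cross it, so both lie on the same
    arc. *)
Lemma planar_noncrossing al A :
  involutive al -> (forall u, al u != u) -> planar_gluing rho al ->
  al_stable al A -> forall s : {perm T},
  (forall u, s u = rho (if u \in A then al u else u)) ->
  (forall u, al u \in porbit s u) ->
  noncrossing (cyc_pos s) (~: A) al.
Proof.
move=> alK aln pl /al_stableP sA s sE orb x z; rewrite !inE => xA zA bt.
have froot_al u : froot s (al u) = froot s u by apply: porbit_froot.
have xy : x != al x by rewrite eq_sym.
have frz := cyc_pos_between (froot_al x) bt.
have [S SE] := exists_arc (froot_al x).
(* Outside [A] the curve crosses only the edge of [x]. On forest edges the crossing is forced by the
   arc [S], so that [S] jumps by [E] along [rho]. *)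
pose E u := if u \in A then S u (+) S (al u) else (u == x) (+) (u == al x).
have Ea u : E (al u) = E u.
  rewrite /E sA alK; case: ifP => _; first by rewrite addbC.
  by rewrite (inj_eq (inv_inj alK)) (can2_eq alK alK) addbC.
have SrE : forall u, S (rho u) = S u (+) E u.
  move=> u; have [uA|uA] := boolP (u \in A).
    have := SE (al u); rewrite sE sA uA alK => ->.
    have -> : (al u == x) = false.
      by apply: contraNF xA => /eqP<-; rewrite sA.
    have -> : (al u == al x) = false.
      by rewrite (inj_eq (inv_inj alK)); apply: contraNF xA => /eqP<-.
    by rewrite /E uA /= addbF addKb.
  by have := SE u; rewrite sE /E (negbTE uA).
have [F FE] := pl E Ea (ex_intro _ S SrE).
(* [F] is corrected on the glued sides so that along [s] it flips only on entering [x] and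
   [al x]. *)
pose K u := F u (+) ((u \in A) && E u).
have Ks u : K (s u) = K u (+) ((s u == x) || (s u == al x)).
  have -> : K (s u) = K u (+) ((s u \notin A) && E (s u)).
    rewrite /K {1}sE (FE _).1 -sE.
    have -> : F (if u \in A then al u else u) = F u (+) ((u \in A) && E u).
      by case: ifP => _; rewrite ?(FE _).2 ?addbF.
    by case: (s u \in A) => /=; rewrite ?addbF // -?addbA ?addbb ?addbF.
  congr (_ (+) _); rewrite /E; case: ifP => [uA|_] /=.
    have -> : (s u == x) = false by apply: contraNF xA => /eqP<-.
    by have -> : (s u == al x) = false by apply: contraNF xA => /eqP E1; rewrite -sA -E1.
  by case: eqP => [->|] //=; rewrite (negbTE xy).
have [K0 KE] := arc_values (froot_al x) xy Ks.
have zal : al z != x /\ al z != al x.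
  split; last by rewrite (inj_eq (inv_inj alK)); apply: contraTneq bt => ->; rewrite ltnn.
  by apply: contraTneq bt => <-; rewrite alK ltnn andbF.
have zx : z != x by apply: contraTneq bt => ->; rewrite ltnn.
have zax : z != al x by apply: contraTneq bt => ->; rewrite ltnn andbF.
have Kz : K (al z) = K z.
  rewrite /K sA (negbTE zA) /= !addbF (FE z).2 /E (negbTE zA).
  by rewrite (negbTE zx) (negbTE zax) !addbF.
move: Kz bt; rewrite !KE ?froot_al // !cyc_pos_lt ?froot_al //.
have ne u v : froot s u = froot s v -> u != v -> cyc_index s u != cyc_index s v.
  by move=> er; apply: contra_neq; apply: cyc_index_inj.
have := ne (al z) x _ zal.1; have := ne (al z) (al x) _ zal.2.
rewrite !froot_al => /(_ frz) n1 /(_ frz) n2 {KE}.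
move: (cyc_index s x) (cyc_index s (al x)) (cyc_index s z) (cyc_index s (al z)) n1 n2.
move=> a b c d n1 n2 /addbI; do ![case: (leqP a) => ?|case: (leqP b) => ?] => //=; lia.
Qed.

(* Letters 0 and 1 mark the first and second ends of the chords of a
   noncrossing matching of the cycles of [s]; 2 and 3 mark the two ends of the
   edges that merge cycles of [rho]. *)
Definition encodes (w : {ffun T -> 'I_4}) (l : seq T) al :=
  exists (A : {set T}) (s : {perm T}),
  [/\ al_stable al A, forall u, s u = rho (if u \in A then al u else u),
      noncrossing (cyc_pos s) (~: A) al,
      forall u, w u = inord (if u \in A
        then (if enum_rank u < enum_rank (al u) then 2 else 3)
        else (if cyc_pos s u < cyc_pos s (al u) then 0 else 1)) &
      l = [seq al u | u <- enum T & w u == inord 2]].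

(** The list has one entry for each edge of the spanning forest. Every such edge lowers the number
    of cycles by one, and the resulting permutation is among the [s] of the hypothesis, so at least
    [k] cycles survive. *)
Lemma encodes_exists al : involutive al -> (forall u, al u != u) ->
  planar_gluing rho al -> forall k,
  (forall s : {perm T}, (forall u, s u = rho u \/ s u = rho (al u)) ->
     k <= #|porbits s|) ->
  exists w l, [/\ encodes w l al, size l + k <= #|porbits rho| &
    size l = #|[set u | w u == inord 2]| ].
Proof.
move=> alK aln pl k kle.
have [A [sA cA orb]] := exists_spanning_gluing rho alK aln.
set s := glued rho alK A in orb.
have sE u : s u = rho (if u \in A then al u else u) by apply: gluedE.
have nc := planar_noncrossing alK aln pl sA sE orb.
pose w : {ffun T -> 'I_4} := [ffun u => inord (if u \in A
        then (if enum_rank u < enum_rank (al u) then 2 else 3)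
        else (if cyc_pos s u < cyc_pos s (al u) then 0 else 1))].
exists w, [seq al u | u <- enum T & w u == inord 2]; split.
- by exists A, s; split=> // u; rewrite ffunE.
- have hk : k <= ncyc rho alK A.
    by apply: kle => u; rewrite sE; case: ifP => _; [right|left].
  suff : (size [seq al u | u <- enum T & w u == inord 2]).*2 <= #|A|.
    by move: cA hk; lia.
  rewrite size_map -(card_uniqP (filter_uniq _ (enum_uniq T))).
  (* One end of each edge of [A]; the image under [al] consists of the other ends. *)
  set L := [set u in A | enum_rank u < enum_rank (al u)].
  have -> : #|[seq u <- enum T | w u == inord 2]| = #|L|.
    apply: eq_card => u; rewrite mem_filter mem_enum inE andbT ffunE.
    rewrite -val_eqE /= !inordK //; last by do 2!case: ifP.
    by rewrite [u \in L]inE; case: (u \in A); case: ifP.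
  have dis : [disjoint L & al @: L].
    rewrite -setI_eq0; apply/eqP/setP=> u; rewrite !inE; apply/negP.
    case/andP=> /andP[_ h] /imsetP[v]; rewrite inE => /andP[_ h'] E.
    by move: h h'; rewrite E alK; lia.
  rewrite -addnn -{2}(card_imset _ (inv_inj alK)) -cardsUI.
  move: dis; rewrite -setI_eq0 => /eqP->; rewrite cards0 addn0.
  apply: subset_leq_card; apply/subsetP=> u; rewrite !inE.
  case/orP=> [/andP[]//|/imsetP[v]]; rewrite inE => /andP[vA _ ->].
  by move/al_stableP: sA => ->.
- rewrite size_map -(card_uniqP (filter_uniq _ (enum_uniq T))).
  by apply: eq_card => u; rewrite mem_filter mem_enum inE andbT.
Qed.

(** The order of decoding: the letters 2 and 3 show [A]; the list gives [al] on the ends marked 2,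
    hence on those marked 3; this determines [s] and the positions; the bracket word of letters 0
    and 1 gives the rest. *)
Lemma encodes_inj w l al al' : involutive al -> involutive al' ->
  (forall u, al u != u) -> (forall u, al' u != u) ->
  encodes w l al -> encodes w l al' -> al =1 al'.
Proof.
move=> aK aK' an an' [A [s [sA sE nc wE lE]]] [A' [s' [sA' sE' nc' wE' lE']]].
have AE (B : {set T}) t b : (forall u, w u = inord (if u \in B
        then (if enum_rank u < enum_rank (b u) then 2 else 3)
        else (if cyc_pos t u < cyc_pos t (b u) then 0 else 1))) ->
   forall u, (u \in B) = (2 <= w u).
  by move=> h u; rewrite h; case: (u \in B); case: ifP => _; rewrite inordK.
have eA : A = A' by apply/setP=> u; rewrite (AE _ _ _ wE) (AE _ _ _ wE').
subst A'; have /al_stableP stA := sA; have /al_stableP stA' := sA'.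
have e2 u : w u == inord 2 -> al u = al' u.
  move=> wu; have : u \in [seq u <- enum T | w u == inord 2].
    by rewrite mem_filter wu mem_enum.
  have : [seq al u | u <- enum T & w u == inord 2] =
         [seq al' u | u <- enum T & w u == inord 2] by rewrite -lE lE'.
  by move/eq_in_map; apply.
have w2 (t : {perm T}) b u : (forall u, w u = inord (if u \in A
        then (if enum_rank u < enum_rank (b u) then 2 else 3)
        else (if cyc_pos t u < cyc_pos t (b u) then 0 else 1))) ->
    u \in A -> (w u == inord 2) = (enum_rank u < enum_rank (b u)).
  move=> h uA; rewrite h uA -val_eqE /= !inordK //; last by case: ifP.
  by case: ifP.
have eqA u : u \in A -> al u = al' u.
  move=> uA; have [wu|wu] := boolP (w u == inord 2); first exact: e2.
  have : w (al u) == inord 2.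
    rewrite (w2 _ _ _ wE) ?stA // aK.
    move: wu; rewrite (w2 _ _ _ wE) // -leqNgt leq_eqVlt => /orP[/eqP/val_inj/enum_rank_inj E|//].
    by have := an u; rewrite E eqxx.
  by move/e2; rewrite aK => E; rewrite {2}E aK'.
have es : s = s' by apply/permP=> u; rewrite sE sE'; case: ifP => // /eqA->.
subst s' => u; have [/eqA//|uA] := boolP (u \in A).
apply: (noncrossing_unique (@cyc_pos_inj _ s) aK aK' an an' _ _ nc nc'); rewrite ?inE //.
- by move=> v; rewrite !inE stA.
- by move=> v; rewrite !inE stA'.
move=> v; rewrite inE => /negbTE vA; have := wE' v; rewrite wE vA.
move/(congr1 val); rewrite /= !inordK; try by case: ifP.
by case: ifP; case: ifP.
Qed.

End Codes.

(** * Colourful graphs *)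

Arguments adj_without {n} G c.
Arguments nverts {n} G.

Section Colourful_graphs.
Variables (n : nat) (G : colgraph n) (side : 'I_n -> bool).
Hypotheses (GK : forall c, involutive (G c)) (Gside : forall c u, side (G c u) = ~~ side u).
Implicit Types (c d i j k l : 'I_4) (u v : 'I_n).

Lemma colour_neq c u : G c u != u.
Proof. by apply/negP=> /eqP E; have := Gside c u; rewrite E; case: side. Qed.

(** Walks along an alternating cycle: by colour [i] from one side of the bipartition and by [j] from
    the other. *)
Definition rotation_fun i j u := if side u then G i u else G j u.

Lemma rotation_funK i j : cancel (rotation_fun i j) (rotation_fun j i).
Proof.
by move=> u; rewrite /rotation_fun; case s: (side u); rewrite Gside s /= GK.
Qed.

Definition rotation i j : {perm 'I_n} := perm (can_inj (rotation_funK i j)).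

Lemma rotationE i j u : rotation i j u = if side u then G i u else G j u.
Proof. by rewrite permE. Qed.

(* The cycles of [rotation i j] are the components of the edges of colours
   [i] and [j]. *)
Definition bicomps i j := #|porbits (rotation i j)|.

Lemma bicompsC i j : bicomps i j = bicomps j i.
Proof.
rewrite /bicomps -porbitsV; congr #|porbits _|; apply/permP=> u.
apply: (@perm_inj _ (rotation i j)); rewrite permKV !permE.
by rewrite -{1}[u](rotation_funK j i).
Qed.

Lemma porbit_step (s : {perm 'I_n}) u : porbit s (s u) = porbit s u.
Proof.
by apply/eqP; rewrite eq_porbit_mem; apply: (mem_porbit s 1).
Qed.

Lemma porbit_rotation i j u :
  porbit (rotation i j) (G i u) = porbit (rotation i j) u /\
  porbit (rotation i j) (G j u) = porbit (rotation i j) u.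
Proof.
have st := porbit_step (rotation i j).
split; case s: (side u).
- by rewrite -[RHS]st rotationE s.
- by rewrite -[LHS]st rotationE Gside s /= GK.
- by rewrite -[LHS]st rotationE Gside s /= GK.
- by rewrite -[RHS]st rotationE s.
Qed.

Lemma adj_without_sym l : connect_sym (adj_without G l).
Proof.
apply: sym_connect_sym => u v; apply/existsP/existsP=> -[d /andP[dl /eqP<-]];
  by exists d; rewrite dl GK eqxx.
Qed.

Lemma connect_colour d l u : d != l -> connect (adj_without G l) u (G d u).
Proof. by move=> dl; apply: connect1; apply/existsP; exists d; rewrite dl eqxx. Qed.

Definition comps_without l := n_comp (adj_without G l) 'I_n.

Definition all_colours i j k l := [forall d, d \in [:: i; j; k; l]].

Lemma colour_cases i j k l d : all_colours i j k l -> d != l ->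
  [\/ d = i, d = j | d = k].
Proof.
move/forallP=> /(_ d); rewrite !inE => /or4P[] /eqP-> dl; [exact: Or31|exact: Or32|exact: Or33|].
by rewrite eqxx in dl.
Qed.

Lemma card_side c : #|[set u | side u]|.*2 = n.
Proof.
set A := [set u | side u].
rewrite -addnn -[RHS](card_ord n) -(cardsC A); congr (_ + _).
rewrite -(card_imset _ (inv_inj (GK c))); congr #|pred_of_set _|; apply/setP=> u.
apply/imsetP/idP => [[v]|]; rewrite !inE => h.
  by move=> ->; rewrite Gside h.
by exists (G c u); rewrite ?inE ?GK // Gside h.
Qed.

(** Euler's inequality for the links of the corners of colour [l], which together have [n] triangles
    and [3n/2] edges, and whose vertices are the bicoloured cycles. In [gluing_euler] the polygons
    are the cycles of colours [i] and [j], glued along the edges of colour [k]. *)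
Lemma euler_colours i j k l : all_colours i j k l ->
  (bicomps i j + bicomps i k + bicomps j k).*2 <= n + (comps_without l).*2.*2.
Proof.
move=> allc.
have kmin (s : {perm 'I_n}) : (forall u, rotation i j u \in porbit s u) ->
    (forall u, G k u \in porbit s u) -> #|porbits s| <= comps_without l.
  move=> sr sk; apply: card_image_le_n_comp (adj_without_sym l) _ => u v.
  have eqp w w' : w' \in porbit s w -> porbit s w' = porbit s w.
    by rewrite -eq_porbit_mem => /eqP.
  have hr w : porbit s (rotation i j w) = porbit s w by apply: eqp.
  case/existsP=> d /andP[/(colour_cases allc) dE /eqP<-]; apply/esym.
  case: dE => ->; last exact: eqp.
    case h: (side u); first by rewrite -(hr u) rotationE h.
    by rewrite -(hr (G i u)) rotationE Gside h /= GK.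
  case h: (side u); last by rewrite -(hr u) rotationE h.
  by rewrite -(hr (G j u)) rotationE Gside h /= GK.
pose s : {perm 'I_n} := (G k * rotation i j)%g.
have sE u : s u = rotation i j (G k u) by rewrite permM.
have := gluing_euler (GK k) (colour_neq k) kmin sE.
rewrite card_ord -/(bicomps i j).
(* A cycle of [s] stays on one side of the bipartition: it follows colours [k] and [j] on the true
   side, [i] and [k] on the false side. The sum type keeps the two kinds apart. *)
pose f u : {set 'I_n} + {set 'I_n} :=
  if side u then inl (porbit (rotation k j) u) else inr (porbit (rotation i k) u).
have fs u : f (s u) = f u.
  have [ _ kj] := porbit_rotation k j (G k u).
  have [ki _] := porbit_rotation i k (G k u).
  rewrite /f sE rotationE !Gside; case h: (side u); rewrite /= ?Gside h /=.
    by rewrite kj; have [-> _] := porbit_rotation k j u.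
  by rewrite ki; have [_ ->] := porbit_rotation i k u.
suff : bicomps k j + bicomps i k <= #|porbits s|.
  rewrite (bicompsC k j) => h1 h2; move: h1 h2; rewrite -!addnn; lia.
apply: leq_trans (card_image_le_porbits fs).
pose L : {set {set 'I_n} + {set 'I_n}} := inl @: porbits (rotation k j).
pose M : {set {set 'I_n} + {set 'I_n}} := inr @: porbits (rotation i k).
have -> : bicomps k j = #|L| by rewrite card_imset // => x y [].
have -> : bicomps i k = #|M| by rewrite card_imset // => x y [].
rewrite -cardsUI (_ : L :&: M = set0) ?cards0 ?addn0; last first.
  apply/setP=> x; rewrite !inE; apply/negP=> /andP[/imsetP[y _ ->] /imsetP[]//].
apply: subset_leq_card; apply/subsetP=> x; rewrite inE => /orP[] /imsetP[_ /imsetP[u _ ->] ->].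
  apply/imsetP; exists (if side u then u else rotation k j u) => //.
  by rewrite /f; case h: (side u); rewrite ?h // rotationE h Gside h /= (porbit_rotation k j u).2.
apply/imsetP; exists (if side u then rotation i k u else u) => //.
by rewrite /f; case h: (side u); rewrite ?h // rotationE h Gside h /= (porbit_rotation i k u).1.
Qed.

(** Each pair lies in two of the four triples, so the four inequalities bound the sum of the six
    [bicomps] by [n + nverts G]. Each [comps_without k] is subtracted for the three pairs avoiding
    [k], which leaves [n - 2 * nverts G] to share among six pairs. *)
Lemma exists_sparse_pair : exists i j k l, all_colours i j k l /\
  6 * bicomps i j + 2 * nverts G <= n + 6 * (comps_without k + comps_without l).
Proof.
pose o0 : 'I_4 := ord0; pose o1 : 'I_4 := @Ordinal 4 1 isT.
pose o2 : 'I_4 := @Ordinal 4 2 isT; pose o3 : 'I_4 := @Ordinal 4 3 isT.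
have sum4 (f : 'I_4 -> nat) : \sum_(c < 4) f c = f o0 + f o1 + f o2 + f o3.
  rewrite !big_ord_recr big_ord0 /= add0n.
  by congr (f _ + f _ + f _ + f _); apply: val_inj.
have VE : nverts G =
  comps_without o0 + comps_without o1 + comps_without o2 + comps_without o3.
  exact: sum4.
have ac i j k l : (forall m, m < 4 -> m \in [:: val i; val j; val k; val l]) ->
    all_colours i j k l.
  move=> h; apply/forallP=> d; have := h d (ltn_ord d).
  by rewrite !inE !val_eqE.
have e0 := euler_colours (ac o1 o2 o3 o0 ltac:(by do 5?case)).
have e1 := euler_colours (ac o0 o2 o3 o1 ltac:(by do 5?case)).
have e2 := euler_colours (ac o0 o1 o3 o2 ltac:(by do 5?case)).
have e3 := euler_colours (ac o0 o1 o2 o3 ltac:(by do 5?case)).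
pose P i j k l := 6 * bicomps i j + 2 * nverts G <= n + 6 * (comps_without k + comps_without l).
have : [|| P o0 o1 o2 o3, P o0 o2 o1 o3, P o0 o3 o1 o2, P o1 o2 o0 o3,
         P o1 o3 o0 o2 | P o2 o3 o0 o1] by rewrite /P VE; lia.
case/or4P=> [h|h|h|/or3P[h|h|h]].
- by exists o0, o1, o2, o3; split; rewrite // ac //; do 5?case.
- by exists o0, o2, o1, o3; split; rewrite // ac //; do 5?case.
- by exists o0, o3, o1, o2; split; rewrite // ac //; do 5?case.
- by exists o1, o2, o0, o3; split; rewrite // ac //; do 5?case.
- by exists o1, o3, o0, o2; split; rewrite // ac //; do 5?case.
- by exists o2, o3, o0, o1; split; rewrite // ac //; do 5?case.
Qed.

(** The first two colours pass through the same coding as the others: one glues monogons in pairs,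
    the next glues the resulting digons into cycles. Both gluings are planar in every colourful
    graph. *)
Lemma planar_gluing_matching i : planar_gluing (1%g : {perm 'I_n}) (G i).
Proof.
move=> E _ [S SE]; exists (fun=> false) => u.
have E0 v : E v = false by have := SE v; rewrite perm1; case: (S v); case: (E v).
by rewrite !E0.
Qed.

Lemma planar_gluing_bicoloured i j : planar_gluing (G i) (G j).
Proof.
move=> E Ej [S SE]; exists (fun u => side u && E u) => u.
have Ei : E (G i u) = E u.
  have := SE (G i u); rewrite GK SE; case: (S u); case: (E u); case: (E (G i u)) => //.
by rewrite Ej Ei !Gside; case: (side u); case: (E u).
Qed.

Definition planar_links := forall i j k, i != j -> i != k -> j != k ->
  planar_gluing (rotation_fun i j) (G k).

Lemma encodes_matching i : exists w (x : seq _),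
  [/\ encodes (1%g : {perm 'I_n}) w x (G i), (size x).*2 <= n &
      size x = #|[set u | w u == inord 2]| ].
Proof.
have := encodes_exists (GK i) (colour_neq i) (@planar_gluing_matching i).
case/(_ #|[set u | side u]|) => [s sE|w [l [lc ls lw]]].
  pose f u := if side u then u else G i u.
  have fs u : f (s u) = f u.
    by case: (sE u) => ->; rewrite perm1 // /f Gside; case: side; rewrite /= ?GK.
  apply: leq_trans (card_image_le_porbits fs).
  apply: subset_leq_card; apply/subsetP=> u; rewrite inE => su.
  by apply/imsetP; exists u; rewrite // /f su.
exists w, l; split=> //; have := card_side i; have : #|porbits (1%g : {perm 'I_n})| <= n.
  by rewrite -[X in _ <= X]card_ord; apply: leq_imset_card.
by move: ls; rewrite -!addnn; lia.
Qed.

Lemma encodes_bicoloured i j : exists w (x : seq _),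
  [/\ encodes (G i) w x (G j), (size x + bicomps i j).*2 <= n &
      size x = #|[set u | w u == inord 2]| ].
Proof.
have := encodes_exists (GK j) (colour_neq j) (@planar_gluing_bicoloured i j).
case/(_ (bicomps i j)) => [s sE|w [l [lc ls lw]]].
  apply: card_image_le_porbits => u.
  by case: (sE u) => ->; rewrite ?(porbit_rotation i j _).1 ?(porbit_rotation i j _).2.
exists w, l; split=> //; rewrite -[X in _ <= X](card_side i) leq_double.
apply: leq_trans ls _; apply: leq_trans (leq_imset_card (porbit (G i)) _).
apply: subset_leq_card; apply/subsetP=> _ /imsetP[u _ ->]; apply/imsetP.
by case s: (side u); [exists u|exists (G i u)]; rewrite ?inE ?Gside ?s ?porbit_step.
Qed.

(** All cycles that occur stay inside components of the graph without colour [l], so merging stops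
    at [comps_without l]. This is how the vertices of the complex are saved from the exponent. *)
Lemma encodes_third i j k l : planar_gluing (rotation_fun i j) (G k) ->
  i != l -> j != l -> k != l -> exists w x,
  [/\ encodes (rotation i j) w x (G k), size x + comps_without l <= bicomps i j &
      size x = #|[set u | w u == inord 2]| ].
Proof.
move=> pl il jl kl.
have pl' : planar_gluing (rotation i j) (G k).
  move=> E Ek [S SE]; have [|F FE] := pl E Ek.
    by exists S => u; rewrite -SE permE.
  by exists F => u; rewrite permE.
have := encodes_exists (GK k) (colour_neq k) pl'.
case/(_ (comps_without l)) => [s sE|w [x [xc xs xw]]]; last by exists w, x.
apply: n_comp_le_porbits (adj_without_sym l) _ => u.
have cr v : connect (adj_without G l) v (rotation i j v).
  by rewrite rotationE; case: side; apply: connect_colour.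
case: (sE u) => -> //.
by apply: connect_trans (cr _); apply: connect_colour.
Qed.

End Colourful_graphs.

(** * Counting graphs with planar links by their codes *)

Lemma leq_card_rel (X Y : finType) (A : {set X}) (R : X -> Y -> Prop) :
  {in A, forall x, exists y, R x y} ->
  {in A &, forall x x', forall y, R x y -> R x' y -> x = x'} -> #|A| <= #|Y|.
Proof.
move=> ex inj; have [->|[x0 x0A]] := set_0Vmem A; first by rewrite cards0.
have [y0 _] := ex x0 x0A.
have [|f fR] := @fin_all_exists X (fun=> Y) (fun x y => x \in A -> R x y).
  by move=> x; case: (boolP (x \in A)) => [/ex[y]|_]; [exists y|exists y0].
rewrite -(card_in_imset (f := f)); first exact: max_card.
move=> x x' xA x'A E; apply: (inj x x' xA x'A (f x)); first exact: fR.
by rewrite E; apply: fR.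
Qed.

Definition planar_colourful n (G : colgraph n) :=
  exists side : {ffun 'I_n -> bool},
  [/\ forall c, involutive (G c), forall c u, side (G c u) = ~~ side u &
      planar_links G side].

(** The exponential factors pay for the order of the colours ([256 = 4 ^ 4]), the bipartition and
    four words on four letters. Each list entry costs a factor [n]; the lists have at most [n/2],
    [n/2 - c_ij], [c_ij - V_l] and [c_ij - V_k] entries. *)
Lemma card_planar_colourful n v (A : {set colgraph n}) : 0 < n ->
  {in A, forall G, planar_colourful G /\ v <= nverts G} ->
  #|A| <= 256 * 2 ^ n * (4 ^ n) ^ 4 * n ^ ((7 * n - 2 * v) %/ 6).
Proof.
case: n A => // n' A _; set n := n'.+1 => hA.
pose m := (7 * n - 2 * v) %/ 6.
pose Y := ('I_4 * 'I_4 * 'I_4 * 'I_4 * {ffun 'I_n -> bool} *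
  ({ffun 'I_n -> 'I_4} * {ffun 'I_n -> 'I_4} * {ffun 'I_n -> 'I_4} *
   {ffun 'I_n -> 'I_4}) * m.-tuple 'I_n)%type.
have -> : 256 * 2 ^ n * (4 ^ n) ^ 4 * n ^ m = #|{: Y}|.
  rewrite !card_prod !card_ffun card_tuple !card_ord card_bool; congr (_ * _).
  by rewrite !expnS expn0; nia.
(* The number of letters 2 in a word is the length of its list, so the concatenated lists can be cut
   apart again. *)
pose good (w : {ffun 'I_n -> 'I_4}) (l : seq 'I_n) := size l = #|[set u | w u == inord 2]|.
pose R (G : colgraph n) (y : Y) := let '(i, j, k, l, side, (wi, wj, wk, wl), t) := y in
  exists (r : {perm 'I_n}) li lj lk ll pad,
  [/\ all_colours i j k l, (forall u, r u = if side u then G i u else G j u),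
     [/\ encodes (1%g : {perm 'I_n}) wi li (G i), encodes (G i) wj lj (G j),
        encodes r wk lk (G k) & encodes r wl ll (G l)],
     [/\ good wi li, good wj lj, good wk lk & good wl ll] &
     val t = li ++ lj ++ lk ++ ll ++ pad].
apply: (@leq_card_rel _ Y A R) => [G|G G'] /hA[[side [GK Gside plG]] vG].
  have [i [j [k [l [allc hV]]]]] := exists_sparse_pair GK Gside.
  have uq : uniq [:: i; j; k; l].
    have : 4 <= size (undup [:: i; j; k; l]).
      rewrite -(card_uniqP (undup_uniq _)) -{1}(card_ord 4).
      apply: subset_leq_card; apply/subsetP=> d _; rewrite mem_undup.
      by move/forallP: allc.
    by move=> h; apply/negPn; rewrite -ltn_size_undup -leqNgt.
  move: uq => /=; rewrite !inE !negb_or => /and4P[/and3P[ij ik il] /andP[jk jl] kl _].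
  have [wi [li [ei si gi]]] := encodes_matching GK Gside i.
  have [wj [lj [ej sj gj]]] := encodes_bicoloured GK Gside i j.
  have [wk [lk [ek sk gk]]] := encodes_third GK Gside (plG i j k ij ik jk) il jl kl.
  have lk' : l != k by rewrite eq_sym.
  have [wl [ll [el sl gl]]] := encodes_third GK Gside (plG i j l ij il jl) ik jk lk'.
  pose s := li ++ lj ++ lk ++ ll.
  have ss : size s <= m.
    rewrite /m leq_divRL // /s !size_cat.
    by move: si sj; rewrite -!addnn; lia.
  (* Padding with an arbitrary vertex gives all codes the same length. *)
  pose t := s ++ nseq (m - size s) ord0.
  have tm : size t == m by rewrite size_cat size_nseq subnKC.
  exists (i, j, k, l, side, (wi, wj, wk, wl), Tuple tm).
  exists (rotation GK Gside i j), li, lj, lk, ll, (nseq (m - size s) ord0).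
  split=> //; first by move=> u; rewrite permE.
  by rewrite /= /t /s !catA.
move=> /hA[[side' [GK' Gside' _]] _] {plG vG}.
move=> [[[[[[i j] k] l] sd] [[[wi wj] wk] wl]] t] /=.
move=> [r [li [lj [lk [ll [pad [allc rE [ei ej ek el] [gi gj gk gl] tE]]]]]]].
move=> [r' [li' [lj' [lk' [ll' [pad' [_ rE' [ei' ej' ek' el'] [gi' gj' gk' gl'] tE']]]]]]].
move: tE'; rewrite tE => /eqP; rewrite eqseq_cat ?gi ?gi' // => /andP[/eqP E1].
rewrite eqseq_cat ?gj ?gj' // => /andP[/eqP E2].
rewrite eqseq_cat ?gk ?gk' // => /andP[/eqP E3].
rewrite eqseq_cat ?gl ?gl' // => /andP[/eqP E4 _]; subst li' lj' lk' ll'.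
have cn := colour_neq Gside; have cn' := colour_neq Gside'.
have Ei : G i = G' i.
  by apply/permP; exact: (encodes_inj (GK i) (GK' i) (cn i) (cn' i) ei ei').
have Ej : G j = G' j.
  rewrite -Ei in ej'.
  by apply/permP; exact: (encodes_inj (GK j) (GK' j) (cn j) (cn' j) ej ej').
have Er : r = r' by apply/permP=> u; rewrite rE rE' Ei Ej.
rewrite -Er in ek' el'.
have Ek : G k = G' k.
  by apply/permP; exact: (encodes_inj (GK k) (GK' k) (cn k) (cn' k) ek ek').
have El : G l = G' l.
  by apply/permP; exact: (encodes_inj (GK l) (GK' l) (cn l) (cn' l) el el').
apply/ffunP=> d; move/forallP: allc => /(_ d).
by rewrite !inE => /or4P[] /eqP->.
Qed.

From mathcomp Require Import all_order all_algebra ring lra generic_quotient.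
From mathcomp Require Import all_classical all_reals all_analysis.
From Stdlib Require Import Relation_Operators.
Import Order.TTheory GRing.Theory Num.Theory.
Import numFieldNormedType.Exports.
Local Open Scope classical_set_scope.
Local Open Scope ring_scope.

(** * Mod 2 cocycles on a shell *)

Definition loc_const (X : topologicalType) (A : set X) (f : X -> bool) :=
  forall x, A x -> \forall y \near x, A y -> f y = f x.

Definition const_conn (X : topologicalType) (A : set X) :=
  forall f, loc_const A f -> forall x y, A x -> A y -> f x = f y.

Section Cocycles.
Variables (X : topologicalType) (J : Type) (O : J -> set X) (e : J -> X -> bool).
Hypothesis O_open : forall j, open (O j).
Hypothesis e_cocycle : forall j k,
  loc_const (O j `&` O k) (fun x => e j x (+) e k x).

(** Only the differences of the [e j] on overlaps are locally constant; they form a Cech cocycle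
    with values in Z/2. The functions [lam x (+) e j x] are locally constant and have the same
    differences, so the class vanishes on [A]. *)
Definition trivialised (A : set X) :=
  exists lam, forall j, loc_const (A `&` O j) (fun x => lam x (+) e j x).

Lemma loc_constS (A B : set X) f : A `<=` B -> loc_const B f -> loc_const A f.
Proof.
by move=> AB fB x Ax; apply: filterS (fB x (AB _ Ax)) => y h /AB/h.
Qed.

Lemma const_connU (A B : set X) : const_conn A -> const_conn B ->
  A `&` B !=set0 -> const_conn (A `|` B).
Proof.
move=> cA cB [z [Az Bz]] f fAB x y.
have zE w : (A `|` B) w -> f w = f z.
  case=> ?; [apply: cA|apply: cB] => //.
    exact: loc_constS (@subsetUl _ _ _) fAB.
  exact: loc_constS (@subsetUr _ _ _) fAB.
by move=> /zE-> /zE->.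
Qed.

Lemma closed_near (A : set X) (x : X) : closed A -> \forall y \near x, A y -> A x.
Proof.
move=> cA; have [Ax|nAx] := pselect (A x); first by apply: nearW.
have : nbhs x (~` A) by apply: open_nbhs_nbhs; split=> //; exact: closed_openC.
by apply: filterS => y.
Qed.

(** Mayer-Vietoris in the lowest degree: on the connected intersection the two trivialisations
    differ by a constant, which is added to one of them. Closedness makes a point outside one set
    have a neighbourhood that misses it. *)
Lemma trivialisedU (A B : set X) : closed A -> closed B ->
  (forall x, A x -> exists j, O j x) -> const_conn (A `&` B) ->
  trivialised A -> trivialised B -> trivialised (A `|` B).
Proof.
move=> cA cB cov cAB [lam lamP] [mu muP].
have lc : loc_const (A `&` B) (fun x => lam x (+) mu x).
  move=> x [Ax Bx]; have [j Ojx] := cov x Ax.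
  have nO : \forall y \near x, O j y by apply: open_nbhs_nbhs.
  near=> y => -[Ay By].
  have Ojy : O j y by near: y.
  have h1 : lam y (+) e j y = lam x (+) e j x.
    by move: Ay; near: y; apply: filterS2 (lamP j x (conj Ax Ojx)) nO => y h Oy Ay; apply: h.
  have h2 : mu y (+) e j y = mu x (+) e j x.
    by move: By; near: y; apply: filterS2 (muP j x (conj Bx Ojx)) nO => y h Oy Ay; apply: h.
  have E (a b c : bool) : a (+) b = (a (+) c) (+) (b (+) c).
    by case: a; case: b; case: c.
  by rewrite (E _ _ (e j y)) h1 h2 -E.
have [b bE] : exists b, forall x, A x -> B x -> lam x = mu x (+) b.
  have [[x [Ax Bx]]|h] := pselect (exists x, A x /\ B x).
    exists (lam x (+) mu x) => y Ay By.
    by rewrite -(cAB _ lc y x) //; case: (lam y); case: (mu y).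
  by exists false => x Ax Bx; exfalso; apply: h; exists x.
pose nu x := if `[< A x >] then lam x else mu x (+) b.
have nuA x : A x -> nu x = lam x by move=> Ax; rewrite /nu asboolT.
have nuB x : B x -> nu x = mu x (+) b.
  by rewrite /nu; case: asboolP => // Ax Bx; rewrite bE.
exists nu => j x [ABx Ojx].
have local (C : set X) f : closed C -> loc_const (C `&` O j) f ->
    \forall y \near x, C y -> O j y -> C x /\ f y = f x.
  move=> cC fC; have [Cx|nCx] := pselect (C x).
    by apply: filterS (fC x (conj Cx Ojx)) => y h Cy Oy; split=> //; apply: h.
  by apply: filterS (closed_near x cC) => y h /h.
near=> y => -[ABy Ojy]; case: ABy => [Ay|By].
  have [Ax E] : A x /\ lam y (+) e j y = lam x (+) e j x.
    move: Ay Ojy; near: y; exact: local (lamP j).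
  by rewrite !nuA.
have [Bx E] : B x /\ mu y (+) e j y = mu x (+) e j x.
  move: By Ojy; near: y; exact: local (muP j).
by rewrite !nuB // ![_ (+) b]addbC -!addbA E.
Unshelve. all: by end_near. Qed.

Lemma trivialised_small (A : set X) j : A `<=` O j -> trivialised A.
Proof.
move=> AO; exists (e j) => k; apply: loc_constS (@e_cocycle j k).
by move=> x [/AO Oj Ok]; split.
Qed.

Lemma trivialisedS (A B : set X) : A `<=` B -> trivialised B -> trivialised A.
Proof.
move=> AB [lam lamP]; exists lam => j; apply: loc_constS (lamP j).
by apply: setSI.
Qed.

End Cocycles.

(** * Induction on boxes by bisection *)

Section Boxes.
Variable R : realType.
Implicit Types (lo hi : 'I_3 -> R) (x y z : 'rV[R]_3) (i j : 'I_3).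

Definition box lo hi : set 'rV[R]_3 := [set x | forall i, lo i <= x 0 i <= hi i].

Definition upd (f : 'I_3 -> R) i (m : R) j := if j == i then m else f j.

Lemma box_compact lo hi : compact (box lo hi).
Proof.
have -> : box lo hi = [set v : 'rV[R]_3 | forall i, `[lo i, hi i]%classic (v ord0 i)].
  by apply/seteqP; split=> x h i; have := h i; rewrite /= in_itv.
exact: (@rV_compact R 3 (fun i => `[lo i, hi i]%classic) (fun i => @segment_compact R (lo i) (hi i))).
Qed.

Lemma box_closed lo hi : closed (box lo hi).
Proof. exact: compact_closed (@norm_hausdorff _ _) (@box_compact lo hi). Qed.

Definition nonempty_box lo hi := forall i, lo i <= hi i.

(** A Lebesgue number argument: compactness gives a size [d] below which every box satisfies [P],
    and repeated halving brings the whole box down to that size. *)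
Lemma box_induction (P : ('I_3 -> R) -> ('I_3 -> R) -> Prop) lo0 hi0 :
  (forall lo hi i m, nonempty_box lo hi -> lo i <= m <= hi i ->
     box lo hi `<=` box lo0 hi0 ->
     P lo (upd hi i m) -> P (upd lo i m) hi -> P lo hi) ->
  nonempty_box lo0 hi0 ->
  (forall x, box lo0 hi0 x -> \forall y \near x & d \near 0^'+,
     forall lo hi, nonempty_box lo hi -> box lo hi `<=` box lo0 hi0 ->
     box lo hi `<=` ball (y : 'rV[R]_3) d -> P lo hi) ->
  P lo0 hi0.
Proof.
move=> halve ne0 loc.
have [d d0 dP] : exists2 d : R, 0 < d & forall lo hi, nonempty_box lo hi ->
    box lo hi `<=` box lo0 hi0 -> (forall i, hi i - lo i < d) -> P lo hi.
  have /compact_near_coveringP cov := @box_compact lo0 hi0.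
  pose Q (d : R) (y : 'rV[R]_3) := forall lo hi, nonempty_box lo hi ->
    box lo hi `<=` box lo0 hi0 -> box lo hi `<=` ball y d -> P lo hi.
  have /(_ _) nearQ := cov _ (0^'+) Q _ loc.
  near (0:R)^'+ => d; exists d => // lo hi ne sub small.
  have blo : box lo hi (\row_i lo i) by move=> i; rewrite mxE lexx ne.
  have : forall y, box lo0 hi0 y -> Q d y by near: d; exact: nearQ.
  apply; [exact: (sub _ blo)|exact: ne|exact: sub|].
  move=> y hy; split=> [//|a b]; rewrite !mxE /ball /=.
  have := hy b; have := small b; rewrite (ord1 a) ltr_norml.
  lra.
(* The admissible side length is doubled one coordinate at a time; [s] lists the coordinates already
   treated. *)
have step (s : seq 'I_3) (D : R) : 0 < D -> (forall lo hi, nonempty_box lo hi ->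
    box lo hi `<=` box lo0 hi0 -> (forall i, hi i - lo i < D) -> P lo hi) ->
  forall lo hi, nonempty_box lo hi -> box lo hi `<=` box lo0 hi0 ->
    (forall i, hi i - lo i < if i \in s then D *+ 2 else D) -> P lo hi.
  move=> D0 DP; elim: s => [|i s IH] lo hi ne sub small.
    by apply: DP => // i; have := small i; rewrite in_nil.
  have si := small i; rewrite mem_head in si; have nei := ne i.
  pose m := (lo i + hi i) / 2.
  have mm : lo i <= m <= hi i by rewrite /m; lra.
  have sub1 : box lo (upd hi i m) `<=` box lo hi.
    move=> x hx j; have := hx j; rewrite /upd; case: eqP => [->|//]; lra.
  have sub2 : box (upd lo i m) hi `<=` box lo hi.
    move=> x hx j; have := hx j; rewrite /upd; case: eqP => [->|//]; lra.
  apply: (halve lo hi i m) => //; apply: IH.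
  - by move=> j; rewrite /upd; case: eqP => [->|_]; [lra|exact: ne].
  - exact: subset_trans sub1 sub.
  - move=> j; rewrite /upd; have := small j; rewrite inE; case: eqP => [->|//] /= _.
    by case: ifP => _; rewrite /m; move: si; rewrite mulr2n; lra.
  - by move=> j; rewrite /upd; case: eqP => [->|_]; [lra|exact: ne].
  - exact: subset_trans sub2 sub.
  - move=> j; rewrite /upd; have := small j; rewrite inE; case: eqP => [->|//] /= _.
    by case: ifP => _; rewrite /m; move: si; rewrite mulr2n; lra.
have all N : forall lo hi, nonempty_box lo hi -> box lo hi `<=` box lo0 hi0 ->
    (forall i, hi i - lo i < d * 2 ^+ N) -> P lo hi.
  elim: N => [|N IH]; first by move=> lo hi ne sub h; apply: dP => // i; have := h i; rewrite mulr1.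
  move=> lo hi ne sub h; apply: (step (enum 'I_3) (d * 2 ^+ N)) => //.
    by rewrite mulr_gt0 // exprn_gt0.
  move=> i; rewrite mem_enum inE.
  have -> : (d * 2 ^+ N) *+ 2 = d * 2 ^+ N.+1 by rewrite exprS mulr2n; ring.
  exact: h.
pose S := \sum_i (hi0 i - lo0 i).
have Sb i : hi0 i - lo0 i <= S.
  rewrite /S (bigD1 i) //= lerDl sumr_ge0 // => j _; rewrite subr_ge0; exact: ne0.
have [N NS] : exists N, S < d * 2 ^+ N.
  have [N hN] : exists N : nat, S / d < N%:R.
    exists (Num.bound `|S / d|); apply: le_lt_trans (ler_norm _) (archi_boundP (normr_ge0 _)) .
  exists N; rewrite mulrC -ltr_pdivrMr //; apply: lt_le_trans hN _.
  by rewrite -natrX ler_nat ltnW // ltn_expl.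
by apply: (all N) => // i; apply: le_lt_trans (Sb i) NS.
Unshelve. all: by end_near. Qed.

End Boxes.

(** * Triviality of mod 2 cocycles on a cubical shell *)

Section Shell.
Variable R : realType.
Implicit Types (lo hi : 'I_3 -> R) (x y z : 'rV[R]_3) (i j : 'I_3).

Lemma box_induction_nbhs (P : ('I_3 -> R) -> ('I_3 -> R) -> Prop) lo0 hi0 :
  (forall lo hi i m, nonempty_box lo hi -> lo i <= m <= hi i ->
     box lo hi `<=` box lo0 hi0 ->
     P lo (upd hi i m) -> P (upd lo i m) hi -> P lo hi) ->
  nonempty_box lo0 hi0 ->
  (forall x, box lo0 hi0 x -> exists2 N, nbhs x N &
     forall lo hi, box lo hi `<=` box lo0 hi0 -> box lo hi `<=` N -> P lo hi) ->
  P lo0 hi0.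
Proof.
move=> halve ne loc; apply: box_induction halve ne _ => x /loc[N].
move/nbhs_ballP => [e /= e0 eN] NP.
have e20 : 0 < e / 2 by rewrite divr_gt0.
exists (ball x (e / 2), [set d | 0 < d < e / 2]).
  split=> /=; first exact: nbhsx_ballx.
  by near=> d; apply/andP; split; near: d; [exact: nbhs_right_gt|exact: nbhs_right_lt].
move=> [y d] /= [xy /andP[d0 de]] lo hi _ sub bd; apply: NP => // w /bd yw.
apply: eN; rewrite [e]splitr; apply: ball_triangle xy _.
by apply: le_ball yw; exact: ltW.
Unshelve. all: by end_near. Qed.

Lemma box_split lo hi i m : lo i <= m <= hi i ->
  box lo hi = box lo (upd hi i m) `|` box (upd lo i m) hi.
Proof.
move=> mi; apply/seteqP; split=> x /=; last first.
  case=> h j; have := h j; rewrite /upd; case: eqP => [->|//]; lra.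
move=> h; have [xm|mx] := lerP (x 0 i) m; [left|right] => j; have := h j;
  rewrite /upd; case: eqP => [->|//]; lra.
Qed.

Lemma boxI lo hi lo' hi' : box lo hi `&` box lo' hi' =
  box (fun i => Num.max (lo i) (lo' i)) (fun i => Num.min (hi i) (hi' i)).
Proof.
apply/seteqP; split=> x /=.
  by move=> [h h'] i; rewrite ge_max le_min; have := h i; have := h' i; lra.
by move=> h; split=> i; have := h i; rewrite ge_max le_min; lra.
Qed.

Lemma const_conn_box lo0 hi0 : const_conn (box lo0 hi0 : set 'rV[R]_3).
Proof.
move=> f fc a b ha hb.
have ne : nonempty_box lo0 hi0 by move=> i; have := ha i; lra.
pose P lo hi := forall x y, box lo hi x -> box lo hi y -> f x = f y.
suff : P lo0 hi0 by apply.
apply: box_induction_nbhs ne _ => [lo hi i m nel mi sub P1 P2 x y|x hx].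
  pose w : 'rV[R]_3 := \row_j upd lo i m j.
  have w1 : box lo (upd hi i m) w.
    by move=> j; rewrite mxE /upd; case: eqP => [->|_]; [lra|rewrite lexx nel].
  have w2 : box (upd lo i m) hi w.
    by move=> j; rewrite mxE /upd; case: eqP => [->|_]; [lra|rewrite lexx nel].
  have wE u : box lo hi u -> f u = f w.
    by rewrite (box_split mi) => -[]; [move/P1; apply|move/P2; apply].
  by move=> /wE-> /wE->.
exists [set y | box lo0 hi0 y -> f y = f x]; first exact: fc.
by move=> lo hi sub subN u v hu hv; rewrite (subN _ hu (sub _ hu)) (subN _ hv (sub _ hv)).
Qed.

Variables (J : Type) (O : J -> set 'rV[R]_3) (e : J -> 'rV[R]_3 -> bool).
Hypothesis O_open : forall a, open (O a).
Hypothesis e_cocycle : forall a b,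
  loc_const (O a `&` O b) (fun x => e a x (+) e b x).

Lemma trivialised_box lo0 hi0 :
  (forall x, box lo0 hi0 x -> exists a, O a x) -> trivialised O e (box lo0 hi0).
Proof.
move=> cov; have [[i hi]|ne] := pselect (exists i, hi0 i < lo0 i).
  exists (fun=> false) => j x [hx _]; have := hx i; lra.
have {}ne : nonempty_box lo0 hi0.
  by move=> i; rewrite leNgt; apply/negP => h; apply: ne; exists i.
apply: (box_induction_nbhs (P := fun lo hi => trivialised O e (box lo hi))) ne _.
  move=> lo hi i m nel mi sub t1 t2; rewrite (box_split mi).
  apply: trivialisedU t1 t2 => //; try exact: box_closed.
    by move=> x hx; apply: cov; apply: sub; rewrite (box_split mi); left.
  by rewrite boxI; apply: const_conn_box.
move=> x /cov[j Ojx]; exists (O j); first exact: open_nbhs_nbhs.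
by move=> lo hi _ sub; apply: trivialised_small sub.
Qed.

Variables (z : 'rV[R]_3) (r1 r2 : R).
Hypotheses (r10 : 0 < r1) (r12 : r1 <= r2).

(** The shell is taken in the maximum norm, which makes it a union of six boxes, one for each
    coordinate and sign. *)
Definition face i (s : bool) :=
  box (fun j => if (j == i) && s then z 0 j + r1 else z 0 j - r2)
      (fun j => if (j == i) && ~~ s then z 0 j - r1 else z 0 j + r2).

Definition shell : set 'rV[R]_3 := [set x |
  (forall i, `|x 0 i - z 0 i| <= r2) /\ exists i, r1 <= `|x 0 i - z 0 i| ].

Lemma face_corner (s : 'I_3 -> bool) i :
  face i (s i) (\row_j (if s j then z 0 j + r2 else z 0 j - r2)).
Proof.
move=> j; rewrite mxE; case: eqP => [->|_] /=; last by move: r10 r12; case: (s j); lra.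
by move: r10 r12; case: (s i) => /=; lra.
Qed.

Lemma face_opp i : face i true `&` face i false = set0.
Proof.
apply/seteqP; split=> x //= -[h1 h2]; have := h1 i; have := h2 i.
by rewrite eqxx /=; move: r10 r12; lra.
Qed.

Lemma face_closed i s : closed (face i s).
Proof. exact: box_closed. Qed.

Lemma const_conn_faceI i s j t : const_conn (face i s `&` face j t).
Proof. by rewrite /face boxI; apply: const_conn_box. Qed.

(** The order is chosen so that each face meets the union of the preceding ones in a connected set;
    for the last face this set is a ring of four boxes. *)
Lemma shell_faces : shell `<=` face 0 true `|` face 1 true `|` face 2%:R true
  `|` face 1 false `|` face 2%:R false `|` face 0 false.
Proof.
move=> x [hx [i hi]]; have r1_gt0 := r10; have r1_le := r12.
have [s xs] : exists s, face i s x.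
  have [p|q] := lerP 0 (x 0 i - z 0 i).
    exists true => j; have := hx j; rewrite andbT andbF ler_norml.
    by case: eqP => [->|_]; move: hi; rewrite ger0_norm //; lra.
  exists false => j; have := hx j; rewrite andbT andbF ler_norml.
  by case: eqP => [->|_]; move: hi; rewrite ltr0_norm //; lra.
have : [\/ i = 0, i = 1 | i = 2%:R].
  by case: i {xs hi} => [[|[|[|]]] //= p]; [apply: Or31|apply: Or32|apply: Or33]; apply: val_inj.
by case=> E; move: xs; rewrite E; case: s => xs; do ?[exact: xs|by right|left].
Qed.

Lemma trivialised_shell : (forall x, shell x -> exists a, O a x) ->
  trivialised O e shell.
Proof.
move=> cov; apply: trivialisedS shell_faces _; have r1_gt0 := r10; have r1_le := r12.
have fsh i s x : face i s x -> shell x.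
  move=> h; split=> [j|].
    by have := h j; case: (j == i); case: s {h} => /=; rewrite ler_norml; lra.
  exists i; have := h i; rewrite eqxx; case: s {h} => /= h.
    by rewrite ger0_norm; lra.
  by rewrite ltr0_norm; lra.
have tf i s : trivialised O e (face i s).
  by apply: trivialised_box => x /fsh/cov.
have cv i s x : face i s x -> exists a, O a x by move=> /fsh/cov.
have cl := face_closed.
have cI := const_conn_faceI.
pose sgn (a b c : bool) (j : 'I_3) := if j == 0 then a else if j == 1 then b else c.
pose corner (a b c : bool) : 'rV[R]_3 :=
  \row_j (if sgn a b c j then z 0 j + r2 else z 0 j - r2).
have c0 a b c : face 0 a (corner a b c) by exact: (face_corner (sgn a b c) 0).
have c1 a b c : face 1 b (corner a b c) by exact: (face_corner (sgn a b c) 1).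
have c2 a b c : face 2%:R c (corner a b c) by exact: (face_corner (sgn a b c) 2%:R).
(* The faces come off from last to first. Opposite faces are disjoint, and corners of the outer cube
   link the remaining intersections into a chain. *)
apply: trivialisedU => //.
- by do 4?apply: closedU.
- by move=> x; do ?case; exact: cv.
- rewrite !setIUl face_opp set0U.
  apply: const_connU => //;
    last by exists (corner false false false);
    exact: (conj (or_intror (conj (c1 _ _ _) (c0 _ _ _))) (conj (c2 _ _ _) (c0 _ _ _))).
  apply: const_connU => //;
    last by exists (corner false false true);
    exact: (conj (or_intror (conj (c2 _ _ _) (c0 _ _ _))) (conj (c1 _ _ _) (c0 _ _ _))).
  by apply: const_connU => //;
    exists (corner false true true); exact: (conj (conj (c1 _ _ _) (c0 _ _ _)) (conj (c2 _ _ _) (c0 _ _ _))).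
apply: trivialisedU => //.
- by do 3?apply: closedU.
- by move=> x; do ?case; exact: cv.
- rewrite !setIUl face_opp setU0.
  apply: const_connU => //;
    last by exists (corner true false false); exact: (conj (or_introl (conj (c0 _ _ _) (c2 _ _ _))) (conj (c1 _ _ _) (c2 _ _ _))).
  by apply: const_connU => //;
    exists (corner true true false); exact: (conj (conj (c0 _ _ _) (c2 _ _ _)) (conj (c1 _ _ _) (c2 _ _ _))).
apply: trivialisedU => //.
- by do 2?apply: closedU.
- by move=> x; do ?case; exact: cv.
- rewrite !setIUl face_opp setU0.
  by apply: const_connU => //;
    exists (corner true false true); exact: (conj (conj (c0 _ _ _) (c1 _ _ _)) (conj (c2 _ _ _) (c1 _ _ _))).
apply: trivialisedU => //.
- by apply: closedU.
- by move=> x; do ?case; exact: cv.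
- rewrite !setIUl.
  by apply: const_connU => //;
    exists (corner true true true); exact: (conj (conj (c0 _ _ _) (c2 _ _ _)) (conj (c1 _ _ _) (c2 _ _ _))).
by apply: trivialisedU => // x; exact: cv.
Qed.

End Shell.

(** * Links of vertices of a manifold *)

Lemma near_finite (I : finType) (T : Type) (F : set_system T) (P : I -> T -> Prop) :
  Filter F -> (forall i, \forall x \near F, P i x) ->
  \forall x \near F, forall i, P i x.
Proof.
move=> FF h; have {}h (s : seq I) : \forall x \near F, forall i, i \in s -> P i x.
  elim: s => [|j s IH]; first by apply: nearW => x i; rewrite in_nil.
  apply: filterS2 (h j) IH => x hj hs i; rewrite inE.
  by case/orP => [/eqP->//|]; exact: hs.
by apply: filterS (h (enum I)) => x hx i; apply: hx; rewrite mem_enum.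
Qed.

Lemma continuous_rV_at (R : realType) (Y : topologicalType) k (f : Y -> 'rV[R]_k) y :
  (forall i, {for y, continuous (fun y => f y 0 i)}) -> {for y, continuous f}.
Proof.
move=> fc A /nbhs_ballP[e /= e0 eA].
have : \forall y' \near y, forall i, ball (f y 0 i) e (f y' 0 i).
  apply: near_finite => i; have /= := fc i (ball (f y 0 i) e).
  by apply; exact: nbhsx_ballx.
by apply: filterS => y' h; apply: eA; split=> // a i; rewrite (ord1 a).
Qed.

Lemma continuous_rV (R : realType) (Y : topologicalType) k (f : Y -> 'rV[R]_k) :
  (forall i, continuous (fun y => f y 0 i)) -> continuous f.
Proof. by move=> fc y; apply: continuous_rV_at => i; exact: fc. Qed.

Lemma near_continuous (Y Z : topologicalType) (f : Y -> Z) y (A : set Z) :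
  {for y, continuous f} -> nbhs (f y) A -> \forall y' \near y, A (f y').
Proof. by move=> fc /fc. Qed.

(** * Tetrahedra and the quotient map *)

Section Tetrahedra.
Variables (R : realType) (n : nat).
Implicit Types (u v : 'I_n) (x : 'rV[R]_4) (p : tetspace R n).

Definition vertex_of p : 'I_n := projT1 (sval p).
Definition bary p : 'rV[R]_4 := projT2 (sval p).

Lemma bary_tetra p : tetra R (bary p).
Proof. exact: (set_mem (proj2_sig p)). Qed.

Definition tet_point u x (hx : tetra R x) : tetspace R n :=
  exist _ (existT (fun=> 'rV[R]_4) u x)
    (mem_set (hx : tetras R n (existT (fun=> 'rV[R]_4) u x))).

Lemma tet_pointE p : p = tet_point (vertex_of p) (bary_tetra p).
Proof. by apply: val_inj; case: p => -[]. Qed.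

Lemma eq_tet_point u v x y (hx : tetra R x) (hy : tetra R y) :
  u = v -> x = y -> tet_point u hx = tet_point v hy.
Proof. by move=> -> E; apply: val_inj; rewrite /= E. Qed.

Lemma open_tet (B : 'I_n -> set 'rV[R]_4) : (forall u, open (B u)) ->
  open [set p : tetspace R n | B (vertex_of p) (bary p)].
Proof.
move=> oB; exists [set s : {u : 'I_n & 'rV[R]_4} | B (projT1 s) (projT2 s)] => //.
by apply/sigT_openP => u; apply: oB.
Qed.

Lemma open_tetE (A : set (tetspace R n)) : open A ->
  exists B : 'I_n -> set 'rV[R]_4, (forall u, open (B u)) /\
    forall p, A p <-> B (vertex_of p) (bary p).
Proof.
case=> C /sigT_openP oC <-; exists (fun u => existT (fun=> 'rV[R]_4) u @^-1` C).
by split=> // -[[u x] h].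
Qed.

Lemma tet_point_continuous (Y : topologicalType) u (f : Y -> 'rV[R]_4)
  (hf : forall y, tetra R (f y)) : continuous f ->
  continuous (fun y => tet_point u (hf y)).
Proof.
move=> /continuousP fc; apply/continuousP => A /open_tetE[B [oB AB]].
have -> : (fun y => tet_point u (hf y)) @^-1` A = f @^-1` B u.
  by apply/seteqP; split=> y /=; rewrite AB.
exact: fc.
Qed.

Lemma continuous_tet (Z : topologicalType) (f : 'I_n -> 'rV[R]_4 -> Z) :
  (forall u, continuous (f u)) ->
  continuous (fun p => f (vertex_of p) (bary p)).
Proof.
move=> fc; apply/continuousP => A oA.
apply: (open_tet (B := fun u => f u @^-1` A)) => u.
by move/continuousP: (fc u); apply.
Qed.

End Tetrahedra.

Section Realisation.
Variables (R : realType) (n : nat) (G : colgraph n).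
Variables (M : topologicalType) (q : tetspace R n -> M).
Hypothesis real : is_realisation R n G M q.

Lemma glue_invariant (T : Type) (F : tetspace R n -> T) :
  (forall p p' d, vertex_of p != vertex_of p' -> G d (vertex_of p) = vertex_of p' ->
     bary p 0 d = 0 -> bary p = bary p' -> F p = F p') ->
  forall p p', q p = q p' -> F p = F p'.
Proof.
move=> FG p p' /(real.2.2 p p'); elim => //.
- by move=> {}p {}p' [d [h1 [h2 [h3 h4]]]]; apply: (FG p p' d).
- by move=> a b c _ -> _ ->.
Qed.

Lemma q_continuous : continuous q.
Proof. by apply/continuousP => A /(real.2.1 A). Qed.

Lemma q_bary p p' : q p = q p' -> bary p = bary p'.
Proof. by apply: glue_invariant. Qed.

Lemma glue_step p p' d : vertex_of p' = G d (vertex_of p) ->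
  vertex_of p' != vertex_of p -> bary p 0 d = 0 -> bary p = bary p' -> q p = q p'.
Proof.
move=> h1 h2 h3 h4; apply/(real.2.2 p p'); apply: rst_step.
by exists d; split; [rewrite eq_sym|split; [exact: esym|split]].
Qed.

Lemma exists_rep : exists rep : M -> tetspace R n, forall m, q (rep m) = m.
Proof. by have [rep h] := choice real.1; exists rep. Qed.

Lemma saturated_open (A : set (tetspace R n)) : open A ->
  (forall p p', q p = q p' -> A p -> A p') -> open (q @` A).
Proof.
move=> oA sA; apply/(real.2.1 _); rewrite (_ : _ @^-1` _ = A) //.
apply/seteqP; split=> p /=; last by move=> Ap; exists p.
by case=> p' Ap' /sA; apply.
Qed.

End Realisation.

Lemma sum_I4 (R : realType) (f : 'I_4 -> R) :
  \sum_(j < 4) f j = f 0 + f 1 + f 2%:R + f 3%:R.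
Proof.
rewrite !big_ord_recr big_ord0 /= add0r.
by congr (f _ + f _ + f _ + f _); apply: val_inj.
Qed.

Lemma I4P (d : 'I_4) : [\/ d = 0, d = 1, d = 2%:R | d = 3%:R].
Proof.
by case: d => [[|[|[|[|]]]] //= h]; [apply: Or41|apply: Or42|apply: Or43|apply: Or44]; apply: val_inj.
Qed.

Lemma all_I4 (P : 'I_4 -> Prop) : P 0 -> P 1 -> P 2%:R -> P 3%:R -> forall d, P d.
Proof. by move=> h0 h1 h2 h3 d; case: (I4P d) => ->. Qed.

Lemma exists_other2 (l d : 'I_4) : exists j : 'I_4, j != l /\ d != j.
Proof.
have : ~~ [forall j, (j == l) || (j == d)].
  apply/negP => /forallP h; have := h 0; have := h 1; have := h 2%:R.
  by elim/all_I4: l {h}; elim/all_I4: d.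
by rewrite negb_forall => /existsP[j]; rewrite negb_or [j == d]eq_sym => /andP[]; exists j.
Qed.

Section Real_functions.
Variables (R : realType) (Y : topologicalType).
Implicit Types f g : Y -> R.

Lemma cont_cst (a : R) : continuous (fun _ : Y => a).
Proof. by move=> y; exact: cvg_cst. Qed.

Lemma cont_add f g : continuous f -> continuous g -> continuous (fun y => f y + g y).
Proof. by move=> cf cg y; apply: cvgD; [exact: cf|exact: cg]. Qed.

Lemma cont_sub f g : continuous f -> continuous g -> continuous (fun y => f y - g y).
Proof. by move=> cf cg y; apply: cvgB; [exact: cf|exact: cg]. Qed.

Lemma cont_mul f g : continuous f -> continuous g -> continuous (fun y => f y * g y).
Proof. by move=> cf cg y; apply: cvgM; [exact: cf|exact: cg]. Qed.

Lemma cont_norm f : continuous f -> continuous (fun y => `|f y|).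
Proof. by move=> cf y; apply: cvg_norm; exact: cf. Qed.

Lemma cont_min f g : continuous f -> continuous g ->
  continuous (fun y => Num.min (f y) (g y)).
Proof. by move=> cf cg y; apply: continuous_min; [exact: cf|exact: cg]. Qed.

Lemma cont_coord k (h : Y -> 'rV[R]_k) i :
  continuous h -> continuous (fun y => h y 0 i).
Proof.
move=> ch y; apply: (@continuous_comp _ _ _ h (fun z : 'rV[R]_k => z 0 i)).
  exact: ch.
exact: coord_continuous.
Qed.

End Real_functions.

Section Link_path.
Variables (R : realType) (l d : 'I_4) (t : R).

(** A retraction of the line onto [0, 1], which makes [link_path] total and continuous. The
    parameter of a path is a point of R^3 read through its first coordinate, so that the facts on
    boxes apply to paths. *)
Definition clamp (a : R) := (1 + `|a| - `|a - 1|) / 2.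

Lemma clamp_bounds a : 0 <= clamp a <= 1.
Proof.
rewrite /clamp.
have [h|h] := lerP 0 a; have [h'|h'] := lerP 0 (a - 1);
  rewrite ?(ger0_norm h) ?(ltr0_norm h) ?(ger0_norm h') ?(ltr0_norm h'); lra.
Qed.

Lemma clamp0 : clamp 0 = 0.
Proof. by rewrite /clamp normr0 sub0r normrN normr1; lra. Qed.

Lemma clamp1 : clamp 1 = 1.
Proof. by rewrite /clamp subrr normr0 normr1; lra. Qed.

(* In the triangle at height [1 - t] below the corner [l]: from the
   barycentre to the midpoint of the edge where coordinate [d] vanishes. *)
Definition link_path (y : 'rV[R]_3) : 'rV[R]_4 := \row_k
  if k == l then 1 - t else if k == d then t * ((1 - clamp (y 0 0)) / 3)
  else t * ((1 - clamp (y 0 0)) / 3 + clamp (y 0 0) / 2).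

Lemma clamp_continuous : continuous clamp.
Proof.
apply: cont_mul; last exact: cont_cst.
have ci : continuous (fun a : R => a) by move=> a; exact: cvg_id.
apply: cont_sub; last by apply: cont_norm; apply: cont_sub => //; exact: cont_cst.
by apply: cont_add; [exact: cont_cst|exact: cont_norm].
Qed.

Lemma link_path_continuous : continuous link_path.
Proof.
apply: continuous_rV => k.
pose c (y : 'rV[R]_3) := clamp (y 0 0).
have cc : continuous c.
  move=> y; apply: (@continuous_comp _ _ _ (fun y : 'rV[R]_3 => y 0 0) clamp).
    exact: coord_continuous.
  exact: clamp_continuous.
have c1 : continuous (fun y => (1 - c y) / 3).
  by apply: cont_mul; [apply: cont_sub => //|]; exact: cont_cst.
have [kl|kl] := eqVneq k l.
  have -> : (fun y => link_path y 0 k) = (fun=> 1 - t).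
    by apply/funext => y; rewrite mxE kl eqxx.
  exact: cont_cst.
have [kd|kd] := eqVneq k d.
  rewrite [X in continuous X](_ : _ = fun y => t * ((1 - c y) / 3)).
    by apply: cont_mul => //; exact: cont_cst.
  by apply/funext => y; rewrite mxE (negbTE kl) kd eqxx.
rewrite [X in continuous X](_ : _ = fun y => t * ((1 - c y) / 3 + c y / 2)).
  apply: cont_mul; first exact: cont_cst.
  by apply: cont_add => //; apply: cont_mul => //; exact: cont_cst.
by apply/funext => y; rewrite mxE (negbTE kl) (negbTE kd).
Qed.

Lemma link_path_tetra : l != d -> 0 <= t <= 1 -> forall y, tetra R (link_path y).
Proof.
move=> ld t01 y; have := clamp_bounds (y 0 0); set a := clamp _ => ha; split.
  move=> j; rewrite mxE -/a.
  by case: ifP => _; [lra|case: ifP => _; apply: mulr_ge0; lra].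
rewrite sum_I4 !mxE -/a; move: ld.
by elim/all_I4: l; elim/all_I4: d => //= _; lra.
Qed.

End Link_path.

(** * Vanishing of H^1 on the links of a manifold *)

Section Links_of_manifolds.
Variables (R : realType) (n : nat) (G : colgraph n).
Hypotheses (GK : forall c, involutive (G c)) (G_neq : forall c u, G c u != u).
Variables (M : topologicalType) (q : tetspace R n -> M).
Hypotheses (real : is_realisation R n G M q) (charts : locally_R3 R M).
Implicit Types (u v : 'I_n) (d j k l : 'I_4) (x : 'rV[R]_4).

Lemma saturated (P : 'I_n -> 'rV[R]_4 -> Prop) :
  (forall d u x, x 0 d = 0 -> P u x -> P (G d u) x) ->
  forall p p', q p = q p' -> P (vertex_of p) (bary p) -> P (vertex_of p') (bary p').
Proof.
move=> PG p p' E.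
suff -> : P (vertex_of p) (bary p) = P (vertex_of p') (bary p') by [].
apply: (glue_invariant real (F := fun p => P (vertex_of p) (bary p))) E.
move=> {}p {}p' d _ e0 e1 e2; rewrite propeqE -e2 -e0; split; first exact: PG.
by move/(PG d _ _ e1); rewrite GK.
Qed.

Definition corner l : 'rV[R]_4 := \row_k (k == l)%:R.

Lemma corner_tetra l : tetra R (corner l).
Proof.
split=> [j|]; first by rewrite mxE ler0n.
by rewrite sum_I4 !mxE; elim/all_I4: l => /=; lra.
Qed.

Lemma corner_connected l u v : connect (adj_without G l) u v ->
  q (tet_point u (corner_tetra l)) = q (tet_point v (corner_tetra l)).
Proof.
case/connectP=> s; elim: s u => [|w s IH] u /= => [_ ->//|].
case/andP=> /existsP[d /andP[dl /eqP dw]] pw vE; rewrite -(IH w pw vE).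
by apply: (glue_step real (d := d)); rewrite /vertex_of /= ?dw // -?dw ?G_neq // /bary /= mxE (negbTE dl).
Qed.

(** The cells of one component are the triangles of a link, and [eps d u] is the change of a
    potential across the side of colour [d]. Around a link vertex of colour [j] such a potential is
    given by [s j], so [eps] is a cocycle; the claim is that it is a coboundary. Extended radially
    to the punctured star and carried over by the chart, the local potentials are patched on a shell
    around the image of the corner. *)
Lemma link_cocycle l (eps : 'I_4 -> 'I_n -> bool) (s : 'I_4 -> 'I_n -> bool) u0 :
  (forall j d u, j != l -> d != l -> d != j -> s j (G d u) = s j u (+) eps d u) ->
  exists F : 'I_n -> bool, forall u d, connect (adj_without G l) u0 u -> d != l ->
    F (G d u) = F u (+) eps d u.
Proof.
move=> sG; have [rep repK] := exists_rep real.
pose D u := connect (adj_without G l) u0 u.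
have DG u d : d != l -> D u -> D (G d u).
  by move=> dl /connect_trans; apply; apply: connect1; apply/existsP; exists d; rewrite dl eqxx.
pose st u (x : 'rV[R]_4) := D u /\ 0 < x 0 l.
have stG d u x : x 0 d = 0 -> st u x -> st (G d u) x.
  move=> xd [Du xl]; split=> //; apply: DG => //.
  by apply: contraTneq xl => <-; rewrite xd ltxx.
have coord_open k : open [set x : 'rV[R]_4 | 0 < x 0 k].
  rewrite (_ : mkset _ = (fun x : 'rV[R]_4 => x 0 k) @^-1` [set a | 0 < a]) //.
  by apply: open_comp => [x _|]; [exact: coord_continuous|exact: open_gt].
have setP_open (Q : Prop) (A : set 'rV[R]_4) : open A -> open [set x | Q /\ A x].
  move=> oA; have [HQ|nQ] := pselect Q.
    by rewrite (_ : mkset _ = A) //; apply/seteqP; split=> x /=; tauto.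
  rewrite (_ : mkset _ = set0); first exact: open0.
  by apply/seteqP; split=> x //= [].
pose m0 := q (tet_point u0 (corner_tetra l)).
have [U [V [f [g [[oU Um0 oV] fc gc fgV gfU]]]]] := charts m0.
have fcx m : U m -> {for m, continuous f}.
  by move=> Um; move: fc; rewrite (continuous_open_subspace f oU) => /(_ m (mem_set Um)).
have gcx z : V z -> {for z, continuous g}.
  by move=> Vz; move: gc; rewrite (continuous_open_subspace g oV) => /(_ z (mem_set Vz)).
pose z0 := f m0; have [Vz0 gz0] : V z0 /\ g z0 = m0 by exact: fgV.
have starM : open (q @` [set p | st (vertex_of p) (bary p)]).
  apply: (saturated_open real) => [|p p']; last exact: saturated.
  apply: (open_tet (B := st)) => u.
  exact: (setP_open (D u) _ (coord_open l)).
have nV : nbhs z0 (V `&` g @^-1` (q @` [set p | st (vertex_of p) (bary p)])).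
  apply: filterI; first exact: open_nbhs_nbhs.
  apply: gcx => //; rewrite gz0; apply: open_nbhs_nbhs; split=> //.
  exists (tet_point u0 (corner_tetra l)) => //; split; first exact: connect0.
  by rewrite /bary /= mxE eqxx ltr01.
have [r /= r0 rV] := (nbhs_ballP _ _).1 nV.
pose r2 := r / 2; have r20 : 0 < r2 by rewrite divr_gt0.
have repst z : ball z0 r z -> st (vertex_of (rep (g z))) (bary (rep (g z))).
  by case/rV=> _ [p stp qp]; apply: saturated stp => //; rewrite qp repK.
have nA : nbhs m0 (U `&` f @^-1` (ball z0 r2)).
  apply: filterI; first exact: open_nbhs_nbhs.
  by apply: fcx => //; exact: nbhsx_ballx.
(* There are finitely many cells, so one [t] serves for all: star points within [t] of the corner
   land in the smaller ball. *)
have [t /andP[t0 t1] tP] : exists2 t : R, 0 < t <= 1 & forall u x (hx : tetra R x), D u ->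
    ball (corner l) t x -> (U `&` f @^-1` (ball z0 r2)) (q (tet_point u hx)).
  move: nA; rewrite nbhsE => -[A [oA Am0] AS].
  have /open_tetE[B [oB AB]] : open (q @^-1` A) by apply/(real.2.1 A).
  near (0:R)^'+ => t; exists t.
    by apply/andP; split; near: t; [exact: nbhs_right_gt|exact: nbhs_right_le].
  move=> u x hx Du xt; apply: AS; apply/(AB _).
  rewrite /vertex_of /bary /=; move: xt; move: x {hx}; move: u Du; near: t.
  apply: near_finite => u; have /orP[Du|nDu] := orbN (D u); last first.
    by apply: nearW => ? Du; rewrite Du in nDu.
  have : B u (corner l).
    have := (AB (tet_point u (corner_tetra l))).1; rewrite /vertex_of /bary /=; apply.
    by rewrite /= -(corner_connected Du).
  move=> Bu; have /nbhs_ballP[e /= e0 eB] : nbhs (corner l) (B u) by exact: open_nbhs_nbhs.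
  apply: filterS (nbhs_right_le e0) => t te _ x xt; apply: eB.
  exact: le_ball xt.
pose t' := t / 2; have t'0 : 0 < t' by rewrite divr_gt0.
have t'1 : 0 <= t' <= 1 by rewrite /t'; lra.
pose hp d (dl : l != d) := link_path_tetra dl t'1.
have pathP u d (dl : l != d) y : D u ->
    (U `&` f @^-1` (ball z0 r2)) (q (tet_point u (hp d dl y))).
  move=> Du; apply: tP => //; split=> // a b; rewrite /ball /= !mxE.
  have := clamp_bounds (y 0 0); set c := clamp _ => hc.
  have ht : t = t' + t' by rewrite /t'; lra.
  have sc (w : R) : 0 <= w <= 1 -> 0 <= t' * w <= t'.
    move=> /andP[w0 w1]; rewrite mulr_ge0 ?(ltW t'0) //=.
    by rewrite -[leRHS]mulr1; apply: ler_wpM2l => //; exact: ltW.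
  have b1 : 0 <= t' * ((1 - c) / 3) <= t' by apply: sc; lra.
  have b2 : 0 <= t' * ((1 - c) / 3 + c / 2) <= t' by apply: sc; lra.
  by case: ifP => _; rewrite ltr_norml; [|case: ifP => _] => /=; lra.
(* The paths at height [1 - t'] as seen in the chart. They avoid [z0], hence by compactness stay at
   distance at least [r1] from it: the small link lies in the shell. *)
pose h u d dl y := f (q (tet_point u (hp d dl y))).
have hc u d dl : D u -> continuous (h u d dl).
  move=> Du y; apply: continuous_comp; last by apply: fcx; exact: (pathP u d dl y Du).1.
  apply: continuous_comp; last exact: q_continuous real _.
  by apply: tet_point_continuous; exact: link_path_continuous.
have gh u d dl y : D u -> g (h u d dl y) = q (tet_point u (hp d dl y)).
  by move=> Du; apply: (fgV _ _).2; exact: (pathP u d dl y Du).1.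
have hz0 u d dl y : D u -> h u d dl y <> z0.
  move=> Du E; have := gh u d dl y Du; rewrite E gz0 => /(q_bary real).
  move/rowP=> /(_ l); rewrite !mxE eqxx /= => E1.
  by have := t'0; rewrite -(subKr 1 t') -E1 subrr ltxx.
pose K : set 'rV[R]_3 := box (fun=> 0) (fun=> 1).
have [r1 r10 r1P] : exists2 r1 : R, 0 < r1 & forall u d (dl : l != d) y, D u -> K y ->
    exists i, r1 <= `|h u d dl y 0 i - z0 0 i|.
  near (0:R)^'+ => r1; exists r1 => // u d dl y Du Ky.
  move: y Ky; move: Du dl; move: d; move: u; near: r1.
  apply: near_finite => u; apply: near_finite => d.
  have /orP[Du|nDu] := orbN (D u); last by apply: nearW => ? Du; rewrite Du in nDu.
  have /orP[ld|nld] := orbN (l != d); last by apply: nearW => r1 _ h'; rewrite h' in nld.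
  have /compact_near_coveringP cov := @box_compact R (fun=> 0) (fun=> 1).
  pose Q (r1 : R) y := exists i, r1 <= `|h u d ld y 0 i - z0 0 i|.
  have : \forall r1 \near (0:R)^'+, K `<=` Q r1.
    apply: cov => y Ky.
    have [i hi] : exists i, h u d ld y 0 i != z0 0 i.
      apply: contrapT => nex; apply: (hz0 u d ld y Du); apply/rowP => i.
      by apply/eqP; apply: contrapT => /negP h'; apply: nex; exists i.
    pose w := `|h u d ld y 0 i - z0 0 i|.
    have w0 : 0 < w by rewrite normr_gt0 subr_eq0.
    have cw : continuous (fun y => `|h u d ld y 0 i - z0 0 i|).
      apply: cont_norm; apply: cont_sub; last exact: cont_cst.
      exact: (@cont_coord R _ _ (h u d ld) i (hc u d ld Du)).
    exists ([set y' | w / 2 < `|h u d ld y' 0 i - z0 0 i|], [set r1 | r1 <= w / 2]).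
      split=> /=; last by apply: nbhs_right_le; rewrite divr_gt0.
      apply: (cw y [set a | w / 2 < a]).
      by apply: open_nbhs_nbhs; split; [exact: open_gt|rewrite /= -/w; lra].
    by move=> [y' r1] /= [h1 h2]; exists i; apply: le_trans h2 (ltW h1).
  apply: filterS => r1 sub _ dl y Ky.
  by rewrite (bool_irrelevance dl ld); exact: sub.
(* The open stars of the link vertices, extended radially. At a boundary point [rep] picks one of
   several cells, so [e j] alone may jump; a sum of two does not, because crossing a face where both
   coordinates are positive changes both terms by the same [eps]. *)
pose O j := [set z | ball z0 r z /\ j != l /\ 0 < bary (rep (g z)) 0 j].
pose e j z := s j (vertex_of (rep (g z))).
have openM (P : 'I_n -> 'rV[R]_4 -> Prop) : (forall u, open [set x | P u x]) ->
    (forall d u x, x 0 d = 0 -> P u x -> P (G d u) x) ->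
    open [set z | ball z0 r z /\ P (vertex_of (rep (g z))) (bary (rep (g z)))].
  move=> oP PG.
  have oqP : open (q @` [set p | P (vertex_of p) (bary p)]).
    apply: (saturated_open real) => [|p p']; last exact: saturated.
    exact: (open_tet (B := P)).
  rewrite openE => z [bz Pz].
  have nb : nbhs z (ball z0 r).
    by apply: open_nbhs_nbhs; split=> //; exact: ball_open.
  have ng : nbhs z (g @^-1` (q @` [set p | P (vertex_of p) (bary p)])).
    apply: gcx; first exact: (rV _ bz).1.
    by apply: open_nbhs_nbhs; split=> //; exists (rep (g z)).
  apply: filterS2 nb ng => z' bz' [p Pp qp]; split=> //.
  by apply: saturated Pp => //; rewrite qp repK.
have oO j : open (O j).
  apply: (openM (fun u x => j != l /\ 0 < x 0 j)) => [u|d u x _ []//].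
  exact: (setP_open (j != l) _ (coord_open j)).
have pairG j k b d u x : x 0 d = 0 ->
   (st u x /\ [/\ j != l, k != l, 0 < x 0 j, 0 < x 0 k & s j u (+) s k u = b]) ->
   (st (G d u) x /\ [/\ j != l, k != l, 0 < x 0 j, 0 < x 0 k & s j (G d u) (+) s k (G d u) = b]).
  move=> xd [stu [jl kl xj xk <-]]; split; first exact: stG.
  have ne i : 0 < x 0 i -> d != i by move=> xi; apply: contraTneq xi => <-; rewrite xd ltxx.
  split=> //; rewrite !sG ?ne //; try exact: stu.2.
  by case: (s j u); case: (s k u); case: (eps d u).
have ecoc j k : loc_const (O j `&` O k) (fun z => e j z (+) e k z).
  move=> z [[bz [jl zj]] [_ [kl zk]]].
  pose P u x := st u x /\ [/\ j != l, k != l, 0 < x 0 j, 0 < x 0 k &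
     s j u (+) s k u = e j z (+) e k z].
  have oP u : open [set x | P u x].
    have -> : [set x | P u x] =
      [set x | (D u /\ [/\ j != l, k != l & s j u (+) s k u = e j z (+) e k z]) /\
      ([set x | 0 < x 0 l] `&` ([set x | 0 < x 0 j] `&` [set x | 0 < x 0 k])) x].
      apply/seteqP; split=> x /=; first by case=> [[? ?] []].
      by case=> [[? []]] ? ? ? [? []].
    by apply: setP_open; apply: openI; last apply: openI; exact: coord_open.
  have := openM P oP (pairG j k _); rewrite openE /interior => /(_ z) /= nz.
  apply: filterS (nz _) => [z' [_ [_ [_ _ _ _ E]]] _|] //.
  by split=> //; split; [exact: repst|split].
have r12 : r1 <= r2 \/ forall u, ~ D u.
  have [h'|h'] := lerP r1 r2; first by left.
  right=> u Du; have [d ld] : exists d, l != d.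
    by have [d [_ ld]] := exists_other2 l l; exists d.
  have K0 : K 0 by move=> i; rewrite mxE lexx ler01.
  have [i hi] := r1P u d ld 0 Du K0.
  have [_ [_ /(_ 0 i)]] := pathP u d ld 0 Du; rewrite /ball /= distrC => h3.
  by have := le_lt_trans hi h3; rewrite ltNge (ltW h').
case: r12 => [r12|nD]; last first.
  by exists (fun=> false) => u d Du; case: (nD u Du).
have shell_ball z : shell z0 r1 r2 z -> ball z0 r z.
  case=> hz _; split=> // a b; rewrite (ord1 a) /ball /= distrC.
  by apply: le_lt_trans (hz b) _; rewrite /r2; lra.
have pos_coord j z : ball z0 r z -> z <> z0 -> exists j, O j z.
  move=> bz zn; have [Dz lz] := repst z bz.
  apply: contrapT => nex.
  have x0 k : k != l -> bary (rep (g z)) 0 k = 0.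
    move=> kl; apply/eqP; rewrite eq_le (bary_tetra _).1 andbT leNgt.
    by apply/negP => h'; apply: nex; exists k.
  apply: zn; have [Vz gzU] := rV _ bz; have [Ugz <-] := gfU _ Vz.
  rewrite /z0; congr f; rewrite -(repK (g z)) (tet_pointE (rep (g z))).
  have -> : tet_point (vertex_of (rep (g z))) (bary_tetra (rep (g z))) =
            tet_point (vertex_of (rep (g z))) (corner_tetra l).
    apply: eq_tet_point => //; apply/rowP => k; rewrite mxE.
    have [->|kl] := eqVneq k l; last by rewrite x0.
    have := (bary_tetra (rep (g z))).2; rewrite (bigD1 l) //= big1 ?addr0 //.
  by rewrite -(corner_connected Dz).
have cov z : shell z0 r1 r2 z -> exists j, O j z.
  move=> sz; apply: (pos_coord l); first exact: shell_ball.
  case: sz => _ [i hi] E; move: hi; rewrite E subrr normr0 leNgt.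
  by rewrite r10.
have [lam lamP] := trivialised_shell oO ecoc r10 r12 cov.
have hshell u d dl y : D u -> K y -> shell z0 r1 r2 (h u d dl y).
  move=> Du Ky; split; last exact: r1P.
  move=> i; have [_ [_ /(_ 0 i)]] := pathP u d dl y Du.
  by rewrite /ball /= distrC => /ltW.
have hO u d dl y j : D u -> j != l -> 0 < link_path l d t' y 0 j -> O j (h u d dl y).
  move=> Du jl lj; split; last split=> //.
    have [_ hb] := pathP u d dl y Du; apply: le_ball hb.
    by rewrite /r2; lra.
  have := gh u d dl y Du; rewrite -{1}(repK (g _)) => /(q_bary real) ->.
  exact: lj.
have K0 : K 0 by move=> i; rewrite mxE lexx ler01.
pose y1 : 'rV[R]_3 := \row_i 1.
have K1 : K y1 by move=> i; rewrite mxE lexx ler01.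
have [d0 ld0] : exists d, l != d.
  by have [d [_ ld]] := exists_other2 l l; exists d.
(* All paths of a cell begin at the barycentre of its triangle, whatever [d] is. *)
have start d (dl : l != d) u : h u d dl 0 = h u d0 ld0 0.
  congr (f (q _)); apply: eq_tet_point => //; apply/rowP => k; rewrite !mxE clamp0.
  by case: ifP => _ //; case: ifP => _; case: ifP => _; rewrite // ?mul0r ?addr0.
have sE j k u : D u -> j != l -> k != l ->
    e j (h u d0 ld0 0) (+) e k (h u d0 ld0 0) = s j u (+) s k u.
  move=> Du jl kl.
  have pos i : 0 < link_path l d0 t' 0 0 i.
    rewrite mxE mxE clamp0; have := t'0; have := t1; rewrite /t' => h1 h2.
    by case: ifP => _; [|case: ifP => _]; lra.
  have E := gh u d0 ld0 0 Du; rewrite -{1}(repK (g _)) in E.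
  have := saturated (pairG j k (s j u (+) s k u)) (esym E).
  rewrite /vertex_of /bary /=; case; first by split; split.
  by move=> _ [].
have [j0 jl0] : exists j, j != l by exists d0; rewrite eq_sym.
(* Writing the potential with [e j0] and [s j0] avoids identifying the representative of the
   barycentre, and by [FE] the colour [j0] can be exchanged for any other one. *)
exists (fun u => lam (h u d0 ld0 0) (+) e j0 (h u d0 ld0 0) (+) s j0 u) => u d Du dl.
have Du' : D (G d u) by exact: DG.
(* The coordinate [j] stays positive from the triangle of [u] to that of [G d u], so the comparison
   takes place inside one set [O j]. *)
have [j [jl dj]] := exists_other2 l d.
have FE v : D v -> lam (h v d0 ld0 0) (+) e j0 (h v d0 ld0 0) (+) s j0 v =
    lam (h v d0 ld0 0) (+) e j (h v d0 ld0 0) (+) s j v.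
  move=> Dv; have := sE j0 j v Dv jl0 jl.
  by case: (lam _); case: (e j0 _); case: (e j _); case: (s j0 _); case: (s j _).
rewrite !FE //; have ld : l != d by rewrite eq_sym.
have along v : D v -> lam (h v d ld 0) (+) e j (h v d ld 0) = lam (h v d ld y1) (+) e j (h v d ld y1).
  move=> Dv; apply: (@const_conn_box R (fun=> 0) (fun=> 1) (fun y => lam (h v d ld y) (+) e j (h v d ld y))) => //.
  move=> y Ky.
  have pos y' : K y' -> 0 < link_path l d t' y' 0 j.
    move=> _; rewrite mxE (negbTE jl) eq_sym (negbTE dj).
    have := clamp_bounds (y' 0 0) => hb; apply: mulr_gt0 => //; lra.
  have := lamP j (h v d ld y) (conj (hshell v d ld y Dv Ky) (hO v d ld y j Dv jl (pos y Ky))).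
  move/(near_continuous (hc v d ld Dv y)); apply: filterS => y' h' Ky'.
  by apply: h'; split; [exact: hshell|apply: hO => //; exact: pos].
rewrite -!(start d ld) !along //.
(* The two paths meet at the midpoint of the common side, where the coordinate [d] vanishes. *)
have -> : h (G d u) d ld y1 = h u d ld y1.
  congr f; apply/esym; apply: (glue_step real (d := d)) => //; first exact: G_neq.
  by rewrite /bary /= mxE (negbTE dl) eqxx mxE clamp1 subrr mul0r mulr0.
by rewrite sG // addbA.
Unshelve. all: by end_near. Qed.

End Links_of_manifolds.

Lemma exists_fourth_colour (i j k : 'I_4) : i != j -> i != k -> j != k ->
  exists l, [/\ i != l, j != l, k != l & all_colours i j k l].
Proof.
move=> ij ik jk.
have [l lP] : exists l, l \notin [:: i; j; k].
  apply/existsP; rewrite -negb_forall; apply/negP => /forallP h.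
  have : (#|{: 'I_4}| <= #|[:: i; j; k]|)%N by apply/subset_leq_card/fintype.subsetP => d _; exact: h.
  by rewrite card_ord; apply/negP; rewrite -ltnNge ltnS card_size.
have := lP; rewrite !inE !negb_or => /and3P[li lj lk].
exists l; split; try by rewrite eq_sym.
apply/forallP => d; apply: contraT => dP.
have u5 : uniq [:: d; i; j; k; l].
  rewrite /= dP !inE !negb_or ij ik jk /=.
  by rewrite ![_ == l]eq_sym li lj lk.
have := max_card (mem [:: d; i; j; k; l]).
by rewrite card_ord (card_uniqP u5).
Qed.

(** The wanted [F] must change by [E u] across colour [k] and by [E (rho u)] on a step of [rho];
    [eps] records these changes. Around link vertices of colour [k] the given [S] supplies a
    potential, around those of colours [i] and [j] the bipartition supplies one. *)
Lemma manifold_planar_colourful (R : realType) n (G : colgraph n) :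
  colourful n G -> X_is_3manifold R n G -> planar_colourful G.
Proof.
move=> /andP[/forallP Ginv /existsP[side /forallP sideP]] [M [q [real [_ charts]]]].
have GK c : involutive (G c) by move=> u; have /forallP/(_ u)/andP[/eqP] := Ginv c.
have Gn c u : G c u != u by have /forallP/(_ u)/andP[_] := Ginv c.
have Gside c u : side (G c u) = ~~ side u.
  by have /forallP/(_ u) := sideP c; case: (side _); case: (side _).
exists side; split=> // i j k ij ik jk E Ek [S SE].
have [l [il jl kl allc]] := exists_fourth_colour ij ik jk.
pose rho := rotation_fun G side i j.
pose eps d u := if d == i then (if side u then E (G i u) else E u)
  else if d == j then (if side u then E u else E (G j u)) else E u.
pose s c u := if c == i then side u && E u
  else if c == j then ~~ side u && E u else S (rho u).
have sG c d u : c != l -> d != l -> d != c -> s c (G d u) = s c u (+) eps d u.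
  have kE : (k == i) = false /\ (k == j) = false.
    by rewrite ![k == _]eq_sym (negbTE ik) (negbTE jk).
  have jE : (j == i) = false by rewrite eq_sym (negbTE ij).
  have Sr v : S (rho v) = S v (+) E v by exact: SE.
  move=> cl dl; case: (colour_cases allc cl) => ->;
    case: (colour_cases allc dl) => -> //; rewrite ?eqxx // => _;
    rewrite /s /eps ?eqxx ?(negbTE ij) ?jE ?kE.1 ?kE.2 ?Gside ?Ek.
  - by case su: (side u) => //=; case: (E u); case: (E _).
  - by case: (side u) => //=; case: (E u).
  - by case su: (side u) => //=; case: (E u); case: (E _).
  - by case: (side u) => //=; case: (E u).
  - rewrite !Sr /rho /rotation_fun; case su: (side u).
      by have := Sr u; rewrite /rho /rotation_fun su => ->.
    have := Sr (G i u); rewrite /rho /rotation_fun Gside su /= GK => ->.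
    by case: (S _); case: (E _); case: (E _).
  - rewrite !Sr; case su: (side u).
      have := Sr (G j u); rewrite /rho /rotation_fun Gside su /= GK => ->.
      by case: (S _); case: (E _); case: (E _).
    by have := Sr u; rewrite /rho /rotation_fun su => ->.
have es := adj_without_sym GK l.
have [FF FFP] := choice (fun u0 => link_cocycle GK Gn real charts u0 sG).
pose rt := fingraph.root (adj_without G l).
have FP u d : d != l -> FF (rt (G d u)) (G d u) = FF (rt u) u (+) eps d u.
  move=> dl; have -> : rt (G d u) = rt u.
    by apply/esym/(fingraph.rootP es); exact: connect_colour.
  by apply: FFP => //; rewrite es connect_root.
exists (fun u => FF (rt u) u) => u; split; last first.
  by rewrite FP // /eps ![k == _]eq_sym (negbTE ik) (negbTE jk).
rewrite /rotation_fun; case su: (side u); rewrite FP // /eps ?eqxx su //.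
by rewrite eq_sym (negbTE ij).
Qed.

(** * Charts around vertices *)

(** The arithmetic core of [piece_inj], with [a] for [x_i] and [m] for [min x_j x_k]: the images of
    the three pieces overlap only along common walls. *)
Lemma piece_inj_reals (R : realType) (t t' : option bool) (a m a' m' : R) :
  0 <= a -> 0 <= m -> 0 <= a' -> 0 <= m' ->
  match t' with None => a' + m' | Some false => a' / 2 + m' | Some true => a' / 2 end =
  match t with None => a + m | Some false => a / 2 + m | Some true => a / 2 end ->
  (if t' is None then m' else m' + a') = (if t is None then m else m + a) ->
  a = a' /\ match t, t' with
  | None, None | Some false, Some false | Some true, Some true => True
  | None, Some false | Some false, None => a = 0
  | Some true, Some false | Some false, Some true => m = 0
  | _, _ => a = 0 /\ m = 0
  end.
Proof.
by case: t => [[]|]; case: t' => [[]|] a0 m0 a0' m0' h1 h2; split=> //;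
  try split; lra.
Qed.

(** * Subdivision of a cone into three cones *)

Section Pieces.
Variables (R : realType) (i j k l : 'I_4).
Hypotheses (ij : i != j) (ik : i != k) (jk : j != k) (il : i != l) (jl : j != l)
  (kl : k != l) (allc : all_colours i j k l).
Implicit Types (x y : 'rV[R]_4) (d : 'I_4).

(** Dividing by the coordinate [l] turns a tetrahedron, without the face opposite to its corner of
    colour [l], into this unbounded cone. *)
Definition orthant x := x 0 l = 1 /\ forall d, 0 <= x 0 d.

Lemma colourP d : [\/ d = i, d = j, d = k | d = l].
Proof.
by have /forallP/(_ d) := allc; rewrite !inE => /or4P[] /eqP->;
  [apply: Or41|apply: Or42|apply: Or43|apply: Or44].
Qed.

Lemma row4P x y : x 0 i = y 0 i -> x 0 j = y 0 j -> x 0 k = y 0 k ->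
  x 0 l = y 0 l -> x = y.
Proof. by move=> ei ej ek el; apply/rowP => d; case: (colourP d) => ->. Qed.

(* The images of the three pieces subdivide the orthant along
   [x_i = min x_j x_k] and [2 x_i = min x_j x_k]. *)
Definition piece (t : option bool) x : 'rV[R]_4 := \row_d
  match t with
  | None => if d == i then x 0 i + Num.min (x 0 j) (x 0 k) else x 0 d
  | Some false => if d == i then x 0 i / 2 + Num.min (x 0 j) (x 0 k)
                  else if d == l then x 0 d else x 0 d + x 0 i
  | Some true => if d == i then x 0 i / 2
                 else if d == l then x 0 d else x 0 d + x 0 i
  end.

Lemma pieceE t x :
  [/\ piece t x 0 i = match t with
      | None => x 0 i + Num.min (x 0 j) (x 0 k)
      | Some false => x 0 i / 2 + Num.min (x 0 j) (x 0 k)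
      | Some true => x 0 i / 2 end,
      piece t x 0 j = (if t is None then x 0 j else x 0 j + x 0 i),
      piece t x 0 k = (if t is None then x 0 k else x 0 k + x 0 i) &
      piece t x 0 l = x 0 l].
Proof.
rewrite !mxE eqxx ![_ == i]eq_sym (negbTE ij) (negbTE ik) (negbTE il).
by rewrite (negbTE jl) (negbTE kl) eqxx; case: t => [[]|].
Qed.

Lemma piece_orthant t x : orthant x -> orthant (piece t x).
Proof.
move=> [xl x0]; have [ei ej ek el] := pieceE t x; split; first by rewrite el.
have := x0 i; have := x0 j; have := x0 k => hk hj hi.
have hm : 0 <= Num.min (x 0 j) (x 0 k) by rewrite le_min hj.
move=> d; case: (colourP d) => ->; rewrite ?ei ?ej ?ek ?el ?xl //.
- by case: t {ei ej ek el} => [[]|]; lra.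
- by case: t {ei ej ek el} => [[]|]; lra.
- by case: t {ei ej ek el} => [[]|]; lra.
Qed.

(** Points of the outer faces do not move, so the subdivision leaves the neighbouring cones
    undisturbed. *)
Lemma piece_zero t x d : orthant x -> d != l -> piece t x 0 d = 0 ->
  piece t x = x.
Proof.
move=> [xl x0] dl; have [ei ej ek el] := pieceE t x.
have := x0 i; have := x0 j; have := x0 k => hk hj hi h.
have hm : 0 <= Num.min (x 0 j) (x 0 k) by rewrite le_min hj.
have mj : Num.min (x 0 j) (x 0 k) <= x 0 j by rewrite ge_min lexx.
have mk : Num.min (x 0 j) (x 0 k) <= x 0 k by rewrite ge_min lexx orbT.
apply: row4P; rewrite ?ei ?ej ?ek ?el //.
all: move: h; case: (colourP d) dl => ->; rewrite ?eqxx ?ei ?ej ?ek // => _.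
all: by case: t {ei ej ek el} => [[]|]; lra.
Qed.

(** P, A and B stand for the pieces [None], [Some false] and [Some true]. P keeps the outer faces of
    colours [j] and [k], B keeps that of colour [i]; P and A share a face of colour [i], A and B
    share faces of colours [j] and [k], as the cells of an inserted dipole must. *)
Lemma piece_fixP x d : orthant x -> (d == j) || (d == k) -> x 0 d = 0 ->
  piece None x = x.
Proof.
move=> [xl x0] dE xd; have [ei ej ek el] := pieceE None x.
apply: row4P; rewrite ?ei ?ej ?ek ?el //.
have := x0 j; have := x0 k.
by case/orP: dE xd => /eqP->; case: (leP (x 0 j) (x 0 k)); lra.
Qed.

Lemma piece_fixB x : x 0 i = 0 -> piece (Some true) x = x.
Proof.
move=> xi; have [ei ej ek el] := pieceE (Some true) x.
by apply: row4P; rewrite ?ei ?ej ?ek ?el // xi; lra.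
Qed.

Lemma piece_PA x : x 0 i = 0 -> piece None x = piece (Some false) x.
Proof.
move=> xi; have [ei ej ek el] := pieceE None x.
have [ei' ej' ek' el'] := pieceE (Some false) x.
by apply: row4P; rewrite ?ei ?ej ?ek ?el ?ei' ?ej' ?ek' ?el' // xi; lra.
Qed.

Lemma piece_AB x d : orthant x -> (d == j) || (d == k) -> x 0 d = 0 ->
  piece (Some false) x = piece (Some true) x.
Proof.
move=> [xl x0] dE xd; have [ei ej ek el] := pieceE (Some false) x.
have [ei' ej' ek' el'] := pieceE (Some true) x.
apply: row4P; rewrite ?ei ?ej ?ek ?el ?ei' ?ej' ?ek' ?el' //.
have := x0 j; have := x0 k.
by case/orP: dE xd => /eqP->; case: (leP (x 0 j) (x 0 k)); lra.
Qed.

Definition piece_link (t t' : option bool) x : Prop :=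
  match t, t' with
  | None, None | Some false, Some false | Some true, Some true => True
  | None, Some false | Some false, None => x 0 i = 0
  | Some true, Some false | Some false, Some true => x 0 j = 0 \/ x 0 k = 0
  | _, _ => x 0 i = 0 /\ (x 0 j = 0 \/ x 0 k = 0)
  end.

Lemma piece_inj t t' x x' : orthant x -> orthant x' ->
  piece t x = piece t' x' -> x = x' /\ piece_link t t' x.
Proof.
move=> [xl x0] [xl' x0'] E.
have [ei ej ek el] := pieceE t x; have [ei' ej' ek' el'] := pieceE t' x'.
rewrite E ei' in ei; rewrite E ej' in ej; rewrite E ek' in ek; rewrite E el' in el.
have em : (if t' is None then Num.min (x' 0 j) (x' 0 k) else Num.min (x' 0 j) (x' 0 k) + x' 0 i)
  = if t is None then Num.min (x 0 j) (x 0 k) else Num.min (x 0 j) (x 0 k) + x 0 i.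
  case: t t' ej ek {ei el ei' ej' ek' el' E} => [t|] [t'|];
  by rewrite ?addr_minl => -> ->.
have hm : 0 <= Num.min (x 0 j) (x 0 k) by rewrite le_min !x0.
have hm' : 0 <= Num.min (x' 0 j) (x' 0 k) by rewrite le_min !x0'.
have m0 : Num.min (x 0 j) (x 0 k) = 0 -> x 0 j = 0 \/ x 0 k = 0.
  by case: (leP (x 0 j) (x 0 k)); [left|right].
have [ea lk] := piece_inj_reals (x0 i) hm (x0' i) hm' ei em.
rewrite -ea in ej ek.
split; last by case: t t' lk {ei ej ek el ei' ej' ek' el' E em} => [[]|] [[]|] //=; intuition.
apply: row4P => //;
  case: t t' ej ek lk {ei el ei' ej' ek' el' E em} => [[]|] [[]|] ej ek lk;
  move: lk ej ek => /=; try (move=> _ /addIr e1 /addIr e2; done); intuition; lra.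
Qed.

Lemma piece_surj y : orthant y -> exists t x, orthant x /\ piece t x = y.
Proof.
move=> [yl y0].
pose mk (a b c : R) : 'rV[R]_4 := \row_d
  if d == i then a else if d == j then b else if d == k then c else 1.
have mkE a b c : [/\ mk a b c 0 i = a, mk a b c 0 j = b, mk a b c 0 k = c & mk a b c 0 l = 1].
  rewrite !mxE !eqxx ![_ == i]eq_sym (negbTE ij) (negbTE ik) (negbTE il).
  by rewrite ![_ == j]eq_sym (negbTE jk) (negbTE jl) ![_ == k]eq_sym (negbTE kl).
have mko a b c : 0 <= a -> 0 <= b -> 0 <= c -> orthant (mk a b c).
  move=> a0 b0 c0; have [e1 e2 e3 e4] := mkE a b c; split=> // d.
  by case: (colourP d) => ->; rewrite ?e1 ?e2 ?e3 ?e4 ?ler01.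
have := y0 i; have := y0 j; have := y0 k => hk hj hi.
pose m := Num.min (y 0 j) (y 0 k).
have mj : m <= y 0 j by rewrite ge_min lexx.
have mk' : m <= y 0 k by rewrite ge_min lexx orbT.
have mE : m = y 0 j \/ m = y 0 k by rewrite /m; case: (leP (y 0 j) (y 0 k)); [left|right].
have E t a b c : match t with
      | None => a + Num.min b c
      | Some false => a / 2 + Num.min b c
      | Some true => a / 2 end = y 0 i ->
   (if t is None then b else b + a) = y 0 j ->
   (if t is None then c else c + a) = y 0 k -> piece t (mk a b c) = y.
  move=> h1 h2 h3; have [e1 e2 e3 e4] := mkE a b c.
  have [ei ej ek el] := pieceE t (mk a b c).
  by apply: row4P; rewrite ?ei ?ej ?ek ?el ?e1 ?e2 ?e3 ?e4.
have [h1|h1] := lerP m (y 0 i).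
  exists None, (mk (y 0 i - m) (y 0 j) (y 0 k)); split; first by apply: mko; lra.
  by apply: E => //; rewrite -/m; lra.
have [h2|h2] := lerP m (2 * y 0 i).
  (* In this piece [y_i = x_i / 2 + min x_j x_k] and [m = min x_j x_k + x_i], whence
     [x_i = 2 (m - y_i)]. *)
  exists (Some false), (mk (2 * (m - y 0 i)) (y 0 j - 2 * (m - y 0 i)) (y 0 k - 2 * (m - y 0 i))).
  split; first by apply: mko; lra.
  apply: E => //; last lra; last lra.
  by rewrite -addr_minl -/m; lra.
exists (Some true), (mk (2 * y 0 i) (y 0 j - 2 * y 0 i) (y 0 k - 2 * y 0 i)).
by split; [apply: mko; lra|apply: E; lra].
Qed.

Lemma piece_bound t x (B : R) : orthant x ->
  (forall d, d != l -> piece t x 0 d <= B) -> forall d, d != l -> x 0 d <= B.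
Proof.
move=> [xl x0] h d; have := h i il; have := h j jl; have := h k kl.
have [ei ej ek el] := pieceE t x; rewrite ei ej ek.
have := x0 i; have := x0 j; have := x0 k => hk hj hi.
have hm : 0 <= Num.min (x 0 j) (x 0 k) by rewrite le_min hj.
by case: (colourP d) => ->; rewrite ?eqxx //; case: t {h ei ej ek el} => [[]|]; lra.
Qed.

Lemma piece_continuous t : continuous (piece t).
Proof.
have cc d : continuous (fun x : 'rV[R]_4 => x 0 d) by move=> x; exact: coord_continuous.
have cm : continuous (fun x : 'rV[R]_4 => Num.min (x 0 j) (x 0 k)) by exact: cont_min.
have ch : continuous (fun x : 'rV[R]_4 => x 0 i / 2).
  by apply: cont_mul => //; exact: cont_cst.
apply: continuous_rV => d; rewrite [X in continuous X](_ : _ = fun x =>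
  match t with
  | None => if d == i then x 0 i + Num.min (x 0 j) (x 0 k) else x 0 d
  | Some false => if d == i then x 0 i / 2 + Num.min (x 0 j) (x 0 k)
                  else if d == l then x 0 d else x 0 d + x 0 i
  | Some true => if d == i then x 0 i / 2
                 else if d == l then x 0 d else x 0 d + x 0 i
  end); last by apply/funext => x; rewrite mxE.
by case: t => [[]|]; case: (d == i) => //; try (case: (d == l) => //); apply: cont_add.
Qed.

End Pieces.

(** * Charts of glued cones and insertion of a dipole *)

Section Charts.
Variables (R : realType) (l : 'I_4).
Implicit Types (x y : 'rV[R]_4) (d : 'I_4).

Inductive reach (V : Type) (g : 'I_4 -> V -> V) (x : 'rV[R]_4) : V -> V -> Prop :=
| reach0 v : reach g x v v
| reachS v w d : d != l -> x 0 d = 0 -> reach g x (g d v) w -> reach g x v w.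

Lemma reach_trans V (g : 'I_4 -> V -> V) x u v w :
  reach g x u v -> reach g x v w -> reach g x u w.
Proof. by elim=> // {}u {}v d dl xd _ IH /IH; apply: reachS. Qed.

Lemma reach1 V (g : 'I_4 -> V -> V) x d v : d != l -> x 0 d = 0 ->
  reach g x v (g d v).
Proof. by move=> dl xd; apply: (reachS dl xd); apply: reach0. Qed.

(* [phi u] maps the cone over the triangle of [u] to R^3; together these maps
   are a homeomorphism from the glued cones onto R^3. *)
Record chart (V : eqType) (g : 'I_4 -> V -> V) (D : pred V)
    (phi : V -> 'rV[R]_4 -> 'rV[R]_3) : Prop := Chart {
  chart_stable : forall u d, D u -> d != l -> D (g d u);
  chart_invol : forall u d, D u -> d != l -> g d (g d u) = u;
  chart_continuous : forall u, D u -> continuous (phi u);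
  chart_compat : forall u d x, D u -> d != l -> orthant l x -> x 0 d = 0 ->
    phi (g d u) x = phi u x;
  chart_inj : forall u u' x x', D u -> D u' -> orthant l x -> orthant l x' ->
    phi u x = phi u' x' -> x = x' /\ reach g x u u';
  chart_surj : forall z, exists u x, [/\ D u, orthant l x & phi u x = z];
  chart_bound : forall u x B, D u -> orthant l x ->
    (forall c, `|phi u x 0 c| <= B) -> forall d, d != l -> x 0 d <= 3 * B }.

Lemma chart_eq (V : eqType) (g g' : 'I_4 -> V -> V) (D D' : pred V) phi :
  D =1 D' -> (forall u d, D u -> d != l -> g' d u = g d u) ->
  chart g D phi -> chart g' D' phi.
Proof.
move=> DD gg [st inv con com inj sur bou].
have rg x u v : D u -> reach g x u v -> reach g' x u v.
  move=> Du h; elim: h Du => [w _|{}u w d dl xd _ IH Du]; first exact: reach0.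
  by apply: (reachS dl xd); rewrite gg //; apply: IH; exact: st.
split.
- by move=> u d; rewrite -!DD => Du dl; rewrite gg // st.
- by move=> u d; rewrite -DD => Du dl; rewrite !gg ?inv // st.
- by move=> u; rewrite -DD; exact: con.
- by move=> u d x; rewrite -DD => Du dl; rewrite gg //; exact: com.
- move=> u u' x x'; rewrite -!DD => Du Du' ox ox' /(inj _ _ _ _ Du Du' ox ox')[-> h].
  by split=> //; exact: rg.
- by move=> z; have [u [x [Du ox <-]]] := sur z; exists u, x; rewrite -DD.
- by move=> u x B; rewrite -DD; exact: bou.
Qed.

Lemma chart_transport (V W : eqType) (g : 'I_4 -> V -> V) (h : 'I_4 -> W -> W)
    (D : pred V) phi (f : V -> W) (f' : W -> V) (E : pred W) :
  {in D, cancel f f'} -> (forall w, E w -> D (f' w) /\ f (f' w) = w) ->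
  (forall v, D v -> E (f v)) ->
  (forall u d, D u -> d != l -> h d (f u) = f (g d u)) ->
  chart g D phi -> chart h E (fun w => phi (f' w)).
Proof.
move=> fK EP Ef hf [st inv con com inj sur bou].
have hE w d : E w -> d != l -> h d w = f (g d (f' w)).
  by move=> /EP[Dw fw] dl; rewrite -hf // fw.
have rg x u v : D u -> reach g x u v -> reach h x (f u) (f v).
  move=> Du r; elim: r Du => [w _|{}u w d dl xd _ IH Du]; first exact: reach0.
  by apply: (reachS dl xd); rewrite hf //; apply: IH; exact: st.
split.
- by move=> w d Ew dl; rewrite hE //; apply: Ef; apply: st => //; case: (EP w Ew).
- move=> w d Ew dl; have [Dw fw] := EP w Ew.
  by rewrite (hE w) // hf ?inv ?fw //; exact: st.
- by move=> w /EP[Dw _]; exact: con.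
- move=> w d x Ew dl ox xd; have [Dw fw] := EP w Ew.
  by rewrite hE // fK ?com //; exact: st.
- move=> w w' x x' Ew Ew' ox ox'; have [Dw fw] := EP w Ew; have [Dw' fw'] := EP w' Ew'.
  by case/inj => // -> /(rg _ _ _ Dw); rewrite fw fw'.
- move=> z; have [u [x [Du ox <-]]] := sur z; exists (f u), x; split=> //.
    exact: Ef.
  by rewrite fK.
- by move=> w x B /EP[Dw _]; exact: bou.
Qed.

Section Insertion.
Variables (V : eqType) (g g' : 'I_4 -> V -> V) (D : pred V).
Variables (phi : V -> 'rV[R]_4 -> 'rV[R]_3) (p q a b : V) (i : 'I_4).
Hypotheses (il : i != l) (Dp : D p) (Dq : D q) (Da : ~~ D a) (Db : ~~ D b)
  (ab : a != b) (pq : p != q) (gp : g i p = q) (gq : g i q = p).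
Hypothesis g'E : forall u d, D u -> d != l -> ~~ ((d == i) && ((u == p) || (u == q))) ->
  g' d u = g d u.
Hypotheses (g'p : g' i p = a) (g'a : g' i a = p) (g'b : g' i b = q) (g'q : g' i q = b).
Hypothesis g'ab : forall d, d != l -> d != i -> g' d a = b /\ g' d b = a.

(* Subdividing the cone of [p] makes room for the dipole [a], [b] on its
   edge of colour [i]. *)
Theorem chart_insert : chart g D phi ->
  exists phi', chart g' (fun u => D u || (u == a) || (u == b)) phi'.
Proof.
move=> [st inv con com inj sur bou].
have [j [k [ij ik jk jl [kl allc]]]] : exists j k, [/\ i != j, i != k, j != k, j != l & k != l /\ all_colours i j k l].
  have [j [ji lj]] := exists_other2 i l; have jl : j != l by rewrite eq_sym.
  have [k [jk ik lk /forallP h]] := exists_fourth_colour ji jl il.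
  exists j, k; split=> //; first by rewrite eq_sym.
  split; first by rewrite eq_sym.
  apply/forallP => d; have := h d; rewrite !inE.
  by case: (d == i); case: (d == j); case: (d == k); case: (d == l).
have pa : p != a by apply: contraNneq Da => <-.
have pb : p != b by apply: contraNneq Db => <-.
have DDa v : D v -> (v == a) = false by move=> Dv; apply: contraNF Da => /eqP <-.
have DDb v : D v -> (v == b) = false by move=> Dv; apply: contraNF Db => /eqP <-.
pose D' u := D u || (u == a) || (u == b).
pose pc := piece (R := R) i j k l.
(* The new cells [a] and [b] take over parts of the cone of [p]; [ap] maps the cone of each cell
   into that of its [base]. *)
pose base u := if (u == a) || (u == b) then p else u.
pose ap u x := if u == p then pc None x else if u == a then pc (Some false) x
  else if u == b then pc (Some true) x else x.
have bp : base p = p by rewrite /base DDa ?DDb.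
have ba : base a = p by rewrite /base eqxx.
have bb : base b = p by rewrite /base eqxx orbT.
have bD v : D v -> base v = v by move=> Dv; rewrite /base DDa ?DDb.
have app x : ap p x = pc None x by rewrite /ap eqxx.
have apa x : ap a x = pc (Some false) x by rewrite /ap eq_sym (negbTE pa) eqxx.
have apb x : ap b x = pc (Some true) x.
  by rewrite /ap eq_sym (negbTE pb) eq_sym (negbTE ab) eqxx.
have apD v x : D v -> v != p -> ap v x = x.
  by move=> Dv /negbTE vp; rewrite /ap vp DDa ?DDb.
have D'P u : D' u -> [\/ u = a, u = b, u = p | D u /\ u != p].
  rewrite /D'; have [->|un] := eqVneq u p; first by move=> _; apply: Or43.
  by case/orP => [/orP[Du|/eqP->]|/eqP->]; [apply: Or44|apply: Or41|apply: Or42].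
have Dbase u : D' u -> D (base u).
  by case/D'P => [->|->|->|[Du _]]; rewrite ?ba ?bb ?bp ?bD.
have oap u x : orthant l x -> orthant l (ap u x).
  by move=> ox; rewrite /ap; do ?[case: ifP => _]; rewrite // /pc; apply: piece_orthant.
have apz u x d : orthant l x -> d != l -> ap u x 0 d = 0 -> ap u x = x.
  move=> ox dl; rewrite /ap.
  by do ?[case: ifP => _]; rewrite // /pc; apply: piece_zero.
have jkd d : d != l -> d != i -> (d == j) || (d == k).
  by move=> dl di; case: (colourP allc d) => E; rewrite E ?eqxx ?orbT // in dl di *.
have fixP x d : orthant l x -> d != l -> d != i -> x 0 d = 0 -> pc None x = x.
  by move=> ox dl di xd; have jd := jkd d dl di; eapply piece_fixP; eassumption.
have AB x d : orthant l x -> d != l -> d != i -> x 0 d = 0 ->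
    pc (Some false) x = pc (Some true) x.
  by move=> ox dl di xd; have jd := jkd d dl di; eapply piece_AB; eassumption.
have fixB x : x 0 i = 0 -> pc (Some true) x = x by move=> xi; apply: piece_fixB.
have PA x : x 0 i = 0 -> pc None x = pc (Some false) x by move=> xi; apply: piece_PA.
have local u u' x x' : D' u -> D' u' -> base u = base u' -> orthant l x ->
    orthant l x' -> ap u x = ap u' x' -> x = x' /\ reach g' x u u'.
  move=> Du Du' be ox ox' E.
  have [bup|bup] := eqVneq (base u) p; last first.
    have nob v : D' v -> base v != p -> D v /\ v != p.
      by case/D'P => [->|->|->|[]]; rewrite ?ba ?bb ?bp ?eqxx.
    have [D1 n1] := nob u Du bup.
    have [D2 n2] : D u' /\ u' != p by apply: nob => //; rewrite -be.
    have uu : u = u' by rewrite -(bD u D1) be bD.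
    by move: E; rewrite !apD // uu; split=> //; apply: reach0.
  have pa_ : x 0 i = 0 -> reach g' x p a by move=> xi; have := reach1 g' p il xi; rewrite g'p.
  have ap_ : x 0 i = 0 -> reach g' x a p by move=> xi; have := reach1 g' a il xi; rewrite g'a.
  have ab_ : x 0 j = 0 \/ x 0 k = 0 -> reach g' x a b /\ reach g' x b a.
    have ji : j != i by rewrite eq_sym.
    have ki : k != i by rewrite eq_sym.
    have [ja jb] := g'ab jl ji; have [ka kb] := g'ab kl ki.
    case=> xd; split.
    - by have := reach1 g' a jl xd; rewrite ja.
    - by have := reach1 g' b jl xd; rewrite jb.
    - by have := reach1 g' a kl xd; rewrite ka.
    - by have := reach1 g' b kl xd; rewrite kb.
  have key v : D' v -> base v = p -> [\/ v = p, v = a | v = b].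
    case/D'P => [->|->|->|[Dv]] _; [exact: Or32|exact: Or33|exact: Or31|].
    by rewrite bD // => ->; exact: Or31.
  have inj' t t' y y' (oy : orthant l y) (oy' : orthant l y') (E' : pc t y = pc t' y') := piece_inj ij ik il jl kl allc oy oy' E'.
  have bup' : base u' = p by rewrite -be.
  case: (key u Du bup) E => ->; case: (key u' Du' bup') => ->;
    rewrite ?app ?apa ?apb => E1;
    have /= [xx lk] := inj' _ _ x x' ox ox' E1; split=> //;
    try exact: reach0; try exact: pa_; try exact: ap_; try by case: (ab_ lk).
  - by case: lk => /pa_ h /ab_[h' _]; apply: reach_trans h h'.
  - by case: lk => /ap_ h /ab_[_ h']; apply: reach_trans h' h.
(* The new cell [u] covers the old cell [v] and keeps [y] fixed. A [reach] path is lifted step by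
   step; between steps, [local] moves among the cells over the same [v]. *)
pose lift y v u := [/\ D' u, base u = v & ap u y = y].
have liftD y v : D v -> (v = p -> pc None y = y) -> lift y v v.
  move=> Dv h; split; [by rewrite /D' Dv|exact: bD|].
  by have [E|n] := eqVneq v p; [rewrite E app h|rewrite apD].
have step y v d : D v -> d != l -> orthant l y -> y 0 d = 0 ->
    exists2 u0, lift y v u0 & lift y (g d v) (g' d u0).
  move=> Dv dl oy yd.
  have liftb : y 0 i = 0 -> lift y p b.
    by move=> yi; split; [rewrite /D' eqxx orbT|exact: bb|rewrite apb fixB].
  have [di|di] := eqVneq d i.
    rewrite di in yd *; have [vp|vp] := eqVneq v p.
      exists b; first by rewrite vp; exact: liftb.
      by rewrite vp gp g'b; apply: liftD => // E; move: pq; rewrite E eqxx.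
    have [vq|vq] := eqVneq v q.
      exists q; first by rewrite vq; apply: liftD => // E; move: pq; rewrite E eqxx.
      by rewrite vq gq g'q; exact: liftb.
    exists v; first by apply: liftD => // E; rewrite E eqxx in vp.
    rewrite g'E // ?(negbTE vp) ?(negbTE vq) ?andbF //.
    apply: liftD => [|E]; first exact: st.
    by have := inv v i Dv il; rewrite E gp => E'; rewrite E' eqxx in vq.
  exists v; first by apply: liftD => // _; apply: fixP yd.
  rewrite g'E // ?(negbTE di) //; apply: liftD => [|_]; first exact: st.
  exact: fixP yd.
have path y v v' : orthant l y -> D v -> reach g y v v' -> forall u u',
    lift y v u -> lift y v' u' -> reach g' y u u'.
  move=> oy Dv r; elim: r Dv => [w Dw|{}v w d dl yd _ IH Dv] u u' lu lu'.
    have [Du bu au] := lu; have [Du' bu' au'] := lu'.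
    have [] := local u u' y y Du Du' _ oy oy _; rewrite ?bu ?bu' ?au ?au' //.
  have [u0 [Du0 bu0 au0] l1] := step y v d Dv dl oy yd.
  have [Du bu au] := lu.
  have [_ r0] : y = y /\ reach g' y u u0 by apply: local; rewrite ?bu ?bu0 ?au ?au0.
  apply: reach_trans r0 _; apply: (reachS dl yd); apply: IH l1 lu'.
  exact: st.
exists (fun u x => phi (base u) (ap u x)); split.
- move=> u d Du dl; have [di|di] := eqVneq d i.
    rewrite di; case/D'P: Du => [->|->|->|[Du up]].
    + by rewrite g'a /D' Dp.
    + by rewrite g'b /D' Dq.
    + by rewrite g'p /D' eqxx orbT.
    have [->|uq] := eqVneq u q; first by rewrite g'q /D' eqxx orbT.
    by rewrite g'E // ?(negbTE up) ?(negbTE uq) ?andbF // st.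
  have [ga gb] := g'ab dl di.
  case/D'P: Du => [->|->|->|[Du up]].
  + by rewrite ga eqxx orbT.
  + by rewrite gb eqxx orbT.
  + by rewrite g'E ?(negbTE di) // st.
  + by rewrite g'E ?(negbTE di) // st.
- move=> u d Du dl; have [di|di] := eqVneq d i.
    rewrite di; case/D'P: Du => [->|->|->|[Du up]]; rewrite ?g'a ?g'b ?g'p ?g'q //.
    have [->|uq] := eqVneq u q; first by rewrite g'q.
    have -> : g' i u = g i u by rewrite g'E // (negbTE up) (negbTE uq) andbF.
    have ivu := inv u i Du il; have Dgu := st u i Du il.
    rewrite g'E // eqxx /=; apply/norP; split; apply/eqP => E; rewrite E in ivu.
      by move: uq; rewrite -ivu gp eqxx.
    by move: up; rewrite -ivu gq eqxx.
  have [ga gb] := g'ab dl di.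
  case/D'P: Du => [->|->|->|[Du up]]; rewrite ?ga ?gb //.
  + by rewrite !g'E ?(negbTE di) ?inv // st.
  + by rewrite !g'E ?(negbTE di) ?inv // st.
- move=> u Du x; apply: (@continuous_comp _ _ _ (ap u) (phi (base u))).
    have c : continuous (ap u).
      have pcc t : continuous (pc t) by exact: piece_continuous.
      have cid : continuous (id : 'rV[R]_4 -> 'rV[R]_4) by move=> y; exact: cvg_id.
      have -> : ap u = if u == p then pc None else if u == a then pc (Some false)
          else if u == b then pc (Some true) else id.
        by apply/funext => y; rewrite /ap; do ?[case: ifP => _].
      by do ?[case: ifP => _].
    exact: c.
  by apply: con; exact: Dbase.
- move=> u d x Du dl ox xd.
  have apg v : D v -> d != i -> ap v x = x.
    move=> Dv di; have [->|vp] := eqVneq v p; last exact: apD.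
    by rewrite app (fixP x d).
  have [di|di] := eqVneq d i.
    rewrite di in xd *; case/D'P: Du => [->|->|->|[Du up]].
    + by rewrite g'a ba bp app apa PA.
    + rewrite g'b bb bD // apb fixB // apD //; last by rewrite eq_sym.
      by rewrite -gp com.
    + by rewrite g'p ba bp app apa PA.
    have [->|uq] := eqVneq u q.
      rewrite g'q bb bD // apb fixB // apD //; last by rewrite eq_sym.
      by rewrite -gp com.
    rewrite g'E // ?(negbTE up) ?(negbTE uq) ?andbF // !bD ?st // !apD ?st ?com //.
    by apply: contraNneq uq => E; rewrite -(inv u i Du il) E gp.
  have [ga gb] := g'ab dl di.
  case/D'P: Du => [->|->|->|[Du up]].
  + by rewrite ga ba bb apa apb (AB x d).
  + by rewrite gb ba bb apa apb (AB x d).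
  + by rewrite g'E ?(negbTE di) // !bD ?st // !apg ?st ?com.
  + by rewrite g'E ?(negbTE di) // !bD ?st // !apg ?st ?com.
- move=> u u' x x' Du Du' ox ox' /(inj _ _ _ _ (Dbase _ Du) (Dbase _ Du') (oap _ _ ox) (oap _ _ ox')).
  (* Cones with different bases meet only on their boundaries, where all pieces are the identity. *)
  move=> [E r]; have [be|be] := eqVneq (base u) (base u'); first exact: local.
  have [d dl yd] : exists2 d, d != l & ap u x 0 d = 0.
    by case: r be => [v|v w d dl xd _ _]; [rewrite eqxx|exists d].
  have ax := apz u x d ox dl yd.
  have ax' : ap u' x' = x' by apply: (apz u' x' d ox' dl); rewrite -E.
  have xx : x = x' by rewrite -ax E ax'.
  split=> //; rewrite ax in r.
  apply: (path x _ _ ox (Dbase u Du) r); first by split.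
  by split; rewrite // xx.
- move=> z; have [v [y [Dv oy <-]]] := sur z; have [vp|vp] := eqVneq v p.
    have [t [x [ox xy]]] := piece_surj ij ik jk il jl kl allc oy.
    case: t xy => [[]|] xy.
    + by exists b, x; split; rewrite // ?eqxx ?orbT // bb apb vp /pc xy.
    + by exists a, x; split; rewrite // ?eqxx ?orbT // ba apa vp /pc xy.
    + by exists p, x; split; rewrite // ?Dp // bp app vp /pc xy.
  by exists v, y; split; rewrite // ?Dv // bD // apD.
- move=> u x B Du ox h; have := bou (base u) (ap u x) B (Dbase u Du) (oap u x ox) h.
  rewrite /ap; do ?[case: ifP => _]; rewrite ?/pc => hb;
    first [exact: hb|exact: (piece_bound ij ik il jl kl allc ox hb)].
Qed.

End Insertion.
End Charts.

(** * Base case and growth of the ring charts *)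

Lemma theta_reals (R : realType) (x1 x2 x3 y1 y2 y3 : R) :
  x1 - x3 = y1 - y3 -> x2 - x3 = y2 - y3 ->
  Num.min x1 (Num.min x2 x3) = Num.min y1 (Num.min y2 y3) ->
  [/\ x1 = y1, x2 = y2 & x3 = y3].
Proof.
move=> h1 h2.
have [t [-> -> ->]] : exists t, [/\ x1 = y1 + t, x2 = y2 + t & x3 = y3 + t].
  by exists (x3 - y3); split; lra.
rewrite -!addr_minl => h; have -> : t = 0 by lra.
by rewrite !addr0.
Qed.

Section Theta.
Variables (R : realType) (l : 'I_4) (V : eqType) (g : 'I_4 -> V -> V) (a b : V).
Hypotheses (ab : a != b) (gab : forall d, d != l -> g d a = b /\ g d b = a).

(** The differences of the three free coordinates are constant along (1, 1, 1) and give a point of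
    the plane; the least coordinate gives a height. One cone fills the upper half-space and the
    other the lower one, and they meet where the minimum is 0. *)
Lemma chart_theta : exists phi : V -> 'rV[R]_4 -> 'rV[R]_3, chart l g (pred2 a b) phi.
Proof.
have [i [li _]] := exists_other2 l l; have il : i != l by [].
have [j [jl ij]] := exists_other2 l i.
have [k [ik jk lk allk]] := exists_fourth_colour ij il jl.
have kl : k != l by rewrite eq_sym.
have cP d : [\/ d = i, d = j, d = k | d = l].
  have /forallP/(_ d) := allk; rewrite !inE => /or4P[] /eqP->;
  [exact: Or41|exact: Or42|exact: Or44|exact: Or43].
pose m (x : 'rV[R]_4) := Num.min (x 0 i) (Num.min (x 0 j) (x 0 k)).
pose phi (u : V) (x : 'rV[R]_4) : 'rV[R]_3 := \row_c
  if c == 0 then x 0 i - x 0 k else if c == 1 then x 0 j - x 0 k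
  else if u == a then m x else - m x.
have phi0 u x : phi u x 0 0 = x 0 i - x 0 k by rewrite mxE.
have phi1 u x : phi u x 0 1 = x 0 j - x 0 k by rewrite mxE.
have phi2 u x : phi u x 0 2%:R = if u == a then m x else - m x by rewrite mxE.
have rowE (y z : 'rV[R]_3) : y 0 0 = z 0 0 -> y 0 1 = z 0 1 -> y 0 2%:R = z 0 2%:R -> y = z.
  move=> h0 h1 h2; apply/rowP => -[[|[|[|c]]] // hc];
  [move: h0|move: h1|move: h2]; congr (y 0 _ = z 0 _); exact: val_inj.
have m_ge0 x : orthant l x -> 0 <= m x by move=> [_ x0]; rewrite !le_min !x0.
have m0z x : m x = 0 -> exists2 d, d != l & x 0 d = 0.
  by rewrite /m; case: (leP (x 0 j) (x 0 k)) => _; case: leP => _ h;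
    [exists i|exists j|exists i|exists k].
have zm0 x d : orthant l x -> d != l -> x 0 d = 0 -> m x = 0.
  move=> ox dl xd; apply/eqP; rewrite eq_le m_ge0 // andbT -xd /m !ge_min.
  by case: (cP d) dl => ->; rewrite ?lexx ?orbT ?eqxx.
have Dab u : pred2 a b u -> u = a \/ u = b by case/pred2P; [left|right].
have rab (x : 'rV[R]_4) d : d != l -> x 0 d = 0 -> reach l g x a b /\ reach l g x b a.
  move=> dl xd; have [ga gb] := gab dl.
  by split; [have := reach1 g a dl xd; rewrite ga|have := reach1 g b dl xd; rewrite gb].
exists phi; split.
- by move=> u d /Dab[]-> dl; have [ga gb] := gab dl; rewrite /= ?ga ?gb eqxx ?orbT.
- by move=> u d /Dab[]-> dl; have [ga gb] := gab dl; rewrite ?ga ?gb ?ga.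
- move=> u _; have cc d : continuous (fun x : 'rV[R]_4 => x 0 d) by move=> x; exact: coord_continuous.
  have cm : continuous m by apply: cont_min => //; exact: cont_min.
  apply: continuous_rV => c; rewrite [X in continuous X](_ : _ = fun x : 'rV[R]_4 =>
    if c == 0 then x 0 i - x 0 k else if c == 1 then x 0 j - x 0 k
    else if u == a then m x else 0 - m x); last first.
    by apply/funext => x; rewrite mxE sub0r.
  case: (c == 0); first exact: cont_sub.
  case: (c == 1); first exact: cont_sub.
  by case: (u == a) => //; apply: cont_sub => //; exact: cont_cst.
- move=> u d x _ dl ox xd; apply: rowE; rewrite ?phi0 ?phi1 // !phi2 (zm0 x d) // oppr0.
  by do 2!case: ifP.
- move=> u u' x x' Du Du' ox ox' E.
  have e0 := congr1 (fun z : 'rV_3 => z 0 0) E; rewrite !phi0 in e0.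
  have e1 := congr1 (fun z : 'rV_3 => z 0 1) E; rewrite !phi1 in e1.
  have e2 := congr1 (fun z : 'rV_3 => z 0 2%:R) E; rewrite !phi2 in e2.
  have em : m x = m x'.
    have := m_ge0 x ox; have := m_ge0 x' ox'; move: e2.
    by case: ifP => _; case: ifP => _; lra.
  have [h1 h2 h3] := theta_reals e0 e1 em.
  have xx : x = x'.
    apply/rowP => d; case: (cP d) => -> //.
    by case: ox => -> _; case: ox' => ->.
  split=> //; have [->|uu] := eqVneq u u'; first exact: reach0.
  have m0 : m x = 0.
    move: e2 uu; case/Dab: Du => ->; case/Dab: Du' => ->; rewrite ?eqxx // ?[b == a]eq_sym ?(negbTE ab) => e2 _;
    by move: em e2; lra.
  have [d dl xd] := m0z x m0; have [r1 r2] := rab x d dl xd.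
  by move: uu; case/Dab: Du => ->; case/Dab: Du' => ->; rewrite ?eqxx.
- move=> z; pose mn := Num.min (z 0 0) (Num.min (z 0 1) 0).
  (* The shift along (1, 1, 1) that makes the least coordinate equal to the required height. *)
  pose t := `|z 0 2%:R| - mn.
  pose x : 'rV[R]_4 := \row_d if d == i then z 0 0 + t else if d == j then z 0 1 + t
     else if d == k then t else 1.
  have xi : x 0 i = z 0 0 + t by rewrite mxE eqxx.
  have xj : x 0 j = z 0 1 + t by rewrite mxE eqxx eq_sym (negbTE ij).
  have xk : x 0 k = t by rewrite mxE ![k == _]eq_sym (negbTE ik) (negbTE jk) eqxx.
  have xl : x 0 l = 1 by rewrite mxE ![l == _]eq_sym (negbTE il) (negbTE jl) (negbTE kl).
  have mx : m x = `|z 0 2%:R|.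
    have -> : m x = mn + t by rewrite /m xi xj xk /mn !addr_minl add0r.
    by rewrite /t addrC subrK.
  have ox : orthant l x.
    split=> // d; have := normr_ge0 (z 0 2%:R); rewrite -mx /m !le_min => /and3P[h1 h2 h3].
    by case: (cP d) => -> //; rewrite xl ler01.
  exists (if 0 <= z 0 2%:R then a else b), x; split=> //.
    by case: ifP => _ /=; rewrite eqxx ?orbT.
  apply: rowE; rewrite ?phi0 ?phi1 ?phi2 ?xi ?xj ?xk ?addrK // mx.
  have [h|h] := lerP 0 (z 0 2%:R); first by rewrite eqxx ger0_norm.
  by rewrite eq_sym (negbTE ab) ltr0_norm // opprK.
(* The factor 3 in [chart_bound]: the least coordinate is at most [B], and two bounded differences
   lead from it to any other one. *)
- move=> u x B _ ox hB d dl; have := hB 0; have := hB 1; have := hB 2%:R.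
  rewrite phi0 phi1 phi2 !ler_norml => b2 b1 b0.
  have {}b2 : m x <= B by move: b2; case: ifP => _; lra.
  have mE : [\/ m x = x 0 i, m x = x 0 j | m x = x 0 k].
    by rewrite /m; case: (leP (x 0 j) (x 0 k)) => _; case: leP => _;
      [apply: Or31|apply: Or32|apply: Or31|apply: Or33].
  have B0 : 0 <= B by apply: le_trans b2; exact: m_ge0.
  by case: mE b2 => ->; case: (cP d) dl => ->; rewrite ?eqxx //; lra.
Qed.

End Theta.

Definition cell := (nat * nat * bool)%type.

(* A cell [(x, y, b)] is the [b]-end of the dipole at position [x] of layer
   [y]; colour [r] runs around the ring of layer 0, [s] joins layers 0 and 1,
   and [t] joins layers 1 and 2. *)
Definition ring_step (r s t : 'I_4) (m0 m1 m2 : nat) (d : 'I_4) (w : cell) : cell :=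
  let: (x, y, b) := w in
  if (d == r) && (y == 0)%N then
    if b then ((if x.+1 == m0 then 0 else x.+1)%N, 0%N, false)
    else ((if x == 0 then m0.-1 else x.-1)%N, 0%N, true)
  else if [&& d == s, x < m1 & y < 2]%N then (x, (1 - y)%N, ~~ b)
  else if [&& d == t, x < m2 & 0 < y]%N then (x, (3 - y)%N, ~~ b)
  else (x, y, ~~ b).

Definition ring_cell (m0 m1 m2 : nat) (w : cell) : bool :=
  let: (x, y, b) := w in
  [|| (y == 0) && (x < m0), (y == 1) && (x < m1) | (y == 2) && (x < m2)]%N.

(** Each dipole is added by one [chart_insert]: on the closing edge of the ring, then on the
    [s]-edge of a dipole of layer 0, then on the [t]-edge of a dipole of layer 1. *)
Lemma chart_ring (R : realType) (l r s t : 'I_4) (m0 m1 m2 : nat) :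
  r != l -> s != l -> t != l -> r != s -> r != t -> s != t ->
  (0 < m0)%N -> (m2 <= m1 <= m0)%N ->
  exists phi : cell -> 'rV[R]_4 -> 'rV[R]_3,
    chart l (ring_step r s t m0 m1 m2) (ring_cell m0 m1 m2) phi.
Proof.
move=> rl sl tl rs rt st m0_gt0 /andP[m21 m10].
have sr : (s == r) = false by rewrite eq_sym (negbTE rs).
have tr : (t == r) = false by rewrite eq_sym (negbTE rt).
have ts : (t == s) = false by rewrite eq_sym (negbTE st).
have ring0 : forall m, (0 < m)%N -> exists phi : cell -> 'rV[R]_4 -> 'rV[R]_3,
    chart l (ring_step r s t m 0 0) (ring_cell m 0 0) phi.
  case=> // m _; elim: m => [|m [phi IH]].
    have [|d dl|phi ch] := @chart_theta R l cell (ring_step r s t 1 0 0) (0, 0, false)%N (0, 0, true)%N.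
    - by [].
    - by rewrite /ring_step /= !andbF; case: (d == r).
    exists phi; apply: chart_eq ch => // -[[x y] b] /=.
    rewrite /ring_cell !ltn0 !andbF !orbF ltnS leqn0 !xpair_eqE.
    by case: b; rewrite ?andbT ?andbF ?orbF //= andbC.
  have [] := @chart_insert R l cell (ring_step r s t m.+1 0 0) (ring_step r s t m.+2 0 0)
    (ring_cell m.+1 0 0) phi (m, 0, true)%N (0, 0, false)%N (m.+1, 0, false)%N (m.+1, 0, true)%N r.
  - by [].
  - by rewrite /= ltnSn.
  - by [].
  - by rewrite /= ltnn.
  - by rewrite /= ltnn.
  - by rewrite !xpair_eqE andbF.
  - by rewrite !xpair_eqE andbF.
  - by rewrite /= eqxx /= eqxx.
  - by rewrite /= eqxx.
  - move=> [[x y] b] d /=; rewrite !andbF !orbF => /andP[/eqP-> xm] dl.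
    case: (d == r) => //=; rewrite !xpair_eqE /= !andbT => /norP[h1 h2].
    case: b h1 h2 => h1 h2 /=.
      rewrite !eqSS ltn_eqF //.
      by move: h1; rewrite andbT => /negbTE ->.
    by move: h2; rewrite andbT => /negbTE ->.
  - by rewrite /= eqxx /= eqSS ltn_eqF.
  - by rewrite /= eqxx.
  - by rewrite /= eqxx /= eqxx.
  - by rewrite /= eqxx.
  - by move=> d dl dr /=; rewrite (negbTE dr) !andbF.
  - exact: IH.
  move=> phi' ch; exists phi'; apply: chart_eq ch => // -[[x y] b] /=.
  rewrite !andbF !orbF !xpair_eqE [(x < m.+2)%N]ltnS [(x <= m.+1)%N]leq_eqVlt.
  by case: b; case: (y == 0)%N; rewrite /= ?andbT ?andbF ?orbF // orbC.
have ring1 : forall m, (m <= m0)%N -> exists phi : cell -> 'rV[R]_4 -> 'rV[R]_3,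
    chart l (ring_step r s t m0 m 0) (ring_cell m0 m 0) phi.
  elim=> [_|m IH mm]; first exact: ring0.
  have [phi {}IH] := IH (ltnW mm).
  have [] := @chart_insert R l cell (ring_step r s t m0 m 0) (ring_step r s t m0 m.+1 0)
    (ring_cell m0 m 0) phi (m, 0, false)%N (m, 0, true)%N (m, 1, true)%N (m, 1, false)%N s.
  - by [].
  - by rewrite /= mm.
  - by rewrite /= mm.
  - by rewrite /= ltnn.
  - by rewrite /= ltnn.
  - by rewrite !xpair_eqE andbF.
  - by rewrite !xpair_eqE andbF.
  - by rewrite /= sr eqxx ltnn /= !andbF.
  - by rewrite /= sr eqxx ltnn /= !andbF.
  - move=> [[x y] b] d /=; rewrite !andbF !orbF => Du dl h.
    case: ifP => // _; case: (d =P s) h => [_|] //=; rewrite !xpair_eqE.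
    case: b => /=; rewrite !andbT !andbF ?orbF /= => h; rewrite ltnS leq_eqVlt.
      have -> : (x == m) = false by apply/negP => /eqP xm; move: Du h; rewrite xm ltnn !eqxx; case: (y) => [|[|y']].
      by [].
    have -> : (x == m) = false by apply/negP => /eqP xm; move: Du h; rewrite xm ltnn !eqxx; case: (y) => [|[|y']].
    by [].
  - by rewrite /= sr !eqxx ?ltnSn ?leqnn.
  - by rewrite /= sr !eqxx ?ltnSn ?leqnn.
  - by rewrite /= sr !eqxx ?ltnSn ?leqnn.
  - by rewrite /= sr !eqxx ?ltnSn ?leqnn.
  - by move=> d dl ds /=; rewrite (negbTE ds) !andbF.
  - exact: IH.
  move=> phi' ch; exists phi'; apply: chart_eq ch => // -[[x y] b] /=.
  rewrite !andbF !orbF !xpair_eqE [(x < m.+1)%N]ltnS [(x <= m)%N]leq_eqVlt.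
  by case: b; case: (y == 1)%N; rewrite /= ?andbT ?andbF ?orbF // -?orbA ?[(x == m) || _]orbC.
have ring2 : forall m, (m <= m1)%N -> exists phi : cell -> 'rV[R]_4 -> 'rV[R]_3,
    chart l (ring_step r s t m0 m1 m) (ring_cell m0 m1 m) phi.
  elim=> [_|m IH mm]; first exact: ring1.
  have [phi {}IH] := IH (ltnW mm).
  have [] := @chart_insert R l cell (ring_step r s t m0 m1 m) (ring_step r s t m0 m1 m.+1)
    (ring_cell m0 m1 m) phi (m, 1, false)%N (m, 1, true)%N (m, 2, true)%N (m, 2, false)%N t.
  - by [].
  - by rewrite /= mm.
  - by rewrite /= mm.
  - by rewrite /= ltnn.
  - by rewrite /= ltnn.
  - by rewrite !xpair_eqE andbF.
  - by rewrite !xpair_eqE andbF.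
  - by rewrite /= tr ts eqxx ltnn.
  - by rewrite /= tr ts eqxx ltnn.
  - move=> [[x y] b] d /= Du dl h.
    case: ifP => // _; case: ifP => // _; case: (d =P t) h => [_|] //=; rewrite !xpair_eqE.
    have [y0|y0] := posnP y; first by rewrite !andbF.
    case: b => /=; rewrite !andbT !andbF ?orbF /= => h; rewrite ltnS leq_eqVlt.
      have -> : (x == m) = false.
        by apply/negP => /eqP xm; move: Du h y0; rewrite xm ltnn !eqxx; case: (y) => [|[|[|y']]].
      by [].
    have -> : (x == m) = false.
      by apply/negP => /eqP xm; move: Du h y0; rewrite xm ltnn !eqxx; case: (y) => [|[|[|y']]].
    by [].
  - by rewrite /= tr ts !eqxx ?ltnSn ?leqnn.
  - by rewrite /= tr ts !eqxx ?ltnSn ?leqnn.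
  - by rewrite /= tr ts !eqxx ?ltnSn ?leqnn.
  - by rewrite /= tr ts !eqxx ?ltnSn ?leqnn.
  - by move=> d dl dt /=; rewrite (negbTE dt) !andbF.
  - exact: IH.
  move=> phi' ch; exists phi'; apply: chart_eq ch => // -[[x y] b] /=.
  rewrite !xpair_eqE [(x < m.+1)%N]ltnS [(x <= m)%N]leq_eqVlt.
  by case: b; case: (y == 2)%N; rewrite /= ?andbT ?andbF ?orbF // -?orbA ?[(x == m) || _]orbC.
exact: ring2.
Qed.

Lemma cont_max (R : realType) (Y : topologicalType) (f g : Y -> R) :
  continuous f -> continuous g -> continuous (fun y => Num.max (f y) (g y)).
Proof. by move=> cf cg y; apply: continuous_max; [exact: cf|exact: cg]. Qed.

Lemma cont_div_at (R : realType) (Y : topologicalType) (f g : Y -> R) y :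
  {for y, continuous f} -> {for y, continuous g} -> g y != 0 ->
  {for y, continuous (fun z => f z / g z)}.
Proof.
move=> cf cg g0; apply: cvgM; first exact: cf.
by apply: cvgV; [exact: g0|exact: cg].
Qed.

(** * From charts of all stars to a 3-manifold *)

Section Manifold_from_charts.
Variables (R : realType) (n : nat) (G : colgraph n).
Hypotheses (GK : forall c, involutive (G c)) (G_neq : forall c u, G c u != u).
Implicit Types (u v : 'I_n) (d l : 'I_4) (x y : 'rV[R]_4).
Local Notation tchart l := (chart (R := R) l (fun d (u : 'I_n) => G d u)).
Hypothesis charts : forall l u, exists (D : pred 'I_n) phi, D u /\ tchart l D phi.

Definition glue_rel : rel (tetspace R n) := fun p p' => `[< glue_equiv R n G p p' >].

Lemma glue_rel_equiv : equiv_class_of glue_rel.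
Proof.
split=> [p|p p'|p' p p''].
- by apply/asboolP; exact: rst_refl.
- by apply/asboolP/asboolP; exact: rst_sym.
- by move=> /asboolP h1 /asboolP h2; apply/asboolP; exact: rst_trans h1 h2.
Qed.

Canonical glue_equiv_rel := EquivRelPack glue_rel_equiv.

Definition realisation_space : topologicalType :=
  quotient_topology {eq_quot glue_equiv_rel}%qT.

Definition realisation_map (p : tetspace R n) : realisation_space :=
  (\pi_({eq_quot glue_equiv_rel}) p)%qT.

Local Notation M := realisation_space.
Local Notation q := realisation_map.

Lemma realisation_spaceP : is_realisation R n G M q.
Proof.
split=> [m|]; first by exists (repr m); rewrite /q reprK.
split=> [U //|p p']; split=> [E|h].
  by have /eqmodP/asboolP := E.
by apply/eqmodP/asboolP.
Qed.

Let real := realisation_spaceP.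

Lemma descend (T : Type) (F : 'I_n -> 'rV[R]_4 -> T) :
  (forall d u x, tetra R x -> x 0 d = 0 -> F (G d u) x = F u x) ->
  forall p p', q p = q p' -> F (vertex_of p) (bary p) = F (vertex_of p') (bary p').
Proof.
move=> FG p p' E; apply: (glue_invariant real (F := fun p => F (vertex_of p) (bary p))) E.
by move=> {}p {}p' d _ <- e1 <-; rewrite FG //; exact: bary_tetra.
Qed.

Lemma stable_iff l D phi d u : tchart l D phi -> d != l -> D (G d u) = D u.
Proof.
move=> ch dl; apply/idP/idP => h; last exact: (chart_stable ch).
by rewrite -(GK d u); apply: (chart_stable ch).
Qed.

Lemma reach_glue l x y (hx : tetra R x) u v : (forall d, d != l -> y 0 d = 0 -> x 0 d = 0) ->
  reach l (fun d u => G d u) y u v -> q (tet_point u hx) = q (tet_point v hx).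
Proof.
move=> yx; elim=> // {}u {}v d dl yd _ <-.
apply: (glue_step real (d := d)) => //; first by rewrite /vertex_of /= G_neq.
exact: yx.
Qed.

(** Hausdorffness through real functions: coordinates and charts, made compatible with the gluing,
    already tell distinct points apart. *)
Lemma separated (p p' : tetspace R n) :
  (forall F : 'I_n -> 'rV[R]_4 -> R, (forall u, continuous (F u)) ->
    (forall d u x, tetra R x -> x 0 d = 0 -> F (G d u) x = F u x) ->
    F (vertex_of p) (bary p) = F (vertex_of p') (bary p')) -> q p = q p'.
Proof.
move=> sep; have cc d : continuous (fun x : 'rV[R]_4 => x 0 d) by move=> x; exact: coord_continuous.
have xx : bary p = bary p' by apply/rowP => d; apply: (sep (fun u x => x 0 d)).
have [x0 xs] := bary_tetra p; set u := vertex_of p; set u' := vertex_of p'.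
have [l xl] : exists l, 0 < bary p 0 l.
  apply: contrapT => nex; have : \sum_(j < 4) bary p 0 j = 0.
    apply: big1 => j _; apply/eqP; rewrite eq_le x0 andbT leNgt.
    by apply/negP => h; apply: nex; exists j.
  by rewrite xs => /eqP; rewrite oner_eq0.
have [D [phi [Du ch]]] := charts l u.
have Du' : D u'.
  have := sep (fun u x => if D u then x 0 l else 0) => /=; rewrite -/u -/u' Du -xx.
  case: (D u') => // h; move: xl; rewrite h ?ltxx // => [v|d v x _ xd].
    by case: (D v) => //; exact: cont_cst.
  have [E|dl] := eqVneq d l; first by rewrite -E xd; do 2!case: (D _).
  by rewrite (stable_iff _ ch).
(* Setting the coordinate [l] to 1 instead of dividing by it keeps [w] continuous where that
   coordinate vanishes. *)
pose w x : 'rV[R]_4 := \row_d if d == l then 1 else x 0 d.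
have ow x : tetra R x -> orthant l (w x).
  move=> [h0 _]; split=> [|d]; first by rewrite mxE eqxx.
  by rewrite mxE; case: ifP.
have cw : continuous w.
  apply: continuous_rV => d; rewrite [X in continuous X](_ : _ = fun x : 'rV[R]_4 => if d == l then 1 else x 0 d).
    by case: (d == l) => //; exact: cont_cst.
  by apply/funext => x; rewrite mxE.
have Ephi : phi u (w (bary p)) = phi u' (w (bary p)).
  apply/rowP => c.
  (* The factor [x 0 l] vanishes on the face opposite to the corner, where the star ends, so the
     function extends by 0. *)
  have := sep (fun u x => if D u then x 0 l * phi u (w x) 0 c else 0) => /=.
  rewrite -/u -/u' Du Du' -xx => h; apply: (mulfI (lt0r_neq0 xl)); apply: h => [v|d v x tx xd].
    case Dv: (D v); last exact: cont_cst.
    apply: cont_mul => //; apply: cont_coord => y.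
    by apply: (@continuous_comp _ _ _ w (phi v)); [exact: cw|exact: (chart_continuous ch)].
  have [E|dl] := eqVneq d l; first by rewrite -E xd !mul0r; do 2!case: (D _).
  rewrite (stable_iff _ ch) //; case Dv: (D v) => //.
  by rewrite (chart_compat ch) //; [exact: ow|rewrite mxE (negbTE dl)].
have [_ r] := chart_inj ch Du Du' (ow _ (bary_tetra p)) (ow _ (bary_tetra p)) Ephi.
rewrite (tet_pointE p) (tet_pointE p').
rewrite -/u -/u' (eq_tet_point (v := u') (y := bary p) (bary_tetra p') (bary_tetra p)) //.
by apply: reach_glue r => d dl; rewrite mxE (negbTE dl).
Qed.

Lemma realisation_hausdorff : hausdorff_space M.
Proof.
have [rep repK] := exists_rep real.
move=> m m' cl; rewrite -(repK m) -(repK m'); apply: separated => F Fc FG.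
pose f m := F (vertex_of (rep m)) (bary (rep m)).
have fq p : f (q p) = F (vertex_of p) (bary p).
  by apply: (descend FG); rewrite repK.
have fc : continuous f.
  apply/continuousP => A oA; apply/(real.2.1 _).
  rewrite (_ : _ @^-1` _ = (fun p => F (vertex_of p) (bary p)) @^-1` A); last first.
    by apply/seteqP; split=> p /=; rewrite fq.
  by move/continuousP: (continuous_tet Fc); apply.
apply: (@norm_hausdorff _ R); rewrite -/(f m) -/(f m') => A B nA nB.
have [z [Az Bz]] := cl _ _ (fc m A nA) (fc m' B nB).
by exists (f z).
Qed.

Lemma realisation_locally_R3 : locally_R3 R M.
Proof.
have [rep repK] := exists_rep real.
move=> m; have [x0 xs] := bary_tetra (rep m).
have [l xl] : exists l, 0 < bary (rep m) 0 l.
  apply: contrapT => nex; have : \sum_(j < 4) bary (rep m) 0 j = 0.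
    apply: big1 => j _; apply/eqP; rewrite eq_le x0 andbT leNgt.
    by apply/negP => h; apply: nex; exists j.
  by rewrite xs => /eqP; rewrite oner_eq0.
have [D [phi [Du ch]]] := charts l (vertex_of (rep m)).
pose s x : 'rV[R]_4 := \row_d (x 0 d / x 0 l).
have os x : tetra R x -> 0 < x 0 l -> orthant l (s x).
  move=> [h0 _] hl; split=> [|d]; first by rewrite mxE divff // gt_eqF.
  by rewrite mxE divr_ge0.
have sc x : 0 < x 0 l -> {for x, continuous s}.
  move=> hl; apply: continuous_rV_at => d.
  rewrite (_ : (fun y => s y 0 d) = fun y : 'rV[R]_4 => y 0 d / y 0 l); last first.
    by apply/funext => y; rewrite mxE.
  have cc k : continuous (fun x : 'rV[R]_4 => x 0 k) by move=> ?; exact: coord_continuous.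
  by apply: cont_div_at; [exact: cc|exact: cc|rewrite gt_eqF].
pose st u x := D u /\ 0 < x 0 l.
have st_inv d u x : tetra R x -> x 0 d = 0 -> st (G d u) x = st u x.
  move=> _ xd; rewrite /st; have [E|dl] := eqVneq d l; last by rewrite (stable_iff _ ch).
  by rewrite -E xd ltxx propeqE; split=> -[].
pose fu u x := if `[< st u x >] then phi u (s x) else 0.
have fu_inv d u x : tetra R x -> x 0 d = 0 -> fu (G d u) x = fu u x.
  move=> tx xd; rewrite /fu (st_inv d u x) //; case: asboolP => // -[Dv hl].
  have dl : d != l by apply: contraTneq hl => <-; rewrite xd ltxx.
  by rewrite (chart_compat ch) //; [exact: os|rewrite mxE xd mul0r].
pose f m := fu (vertex_of (rep m)) (bary (rep m)).
pose U : set M := [set m | st (vertex_of (rep m)) (bary (rep m))].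
have fq p : f (q p) = fu (vertex_of p) (bary p) by apply: (descend fu_inv); rewrite repK.
have Uq p : U (q p) = st (vertex_of p) (bary p) by apply: (descend st_inv); rewrite repK.
have coord_open k : open [set x : 'rV[R]_4 | 0 < x 0 k].
  rewrite (_ : mkset _ = (fun x : 'rV[R]_4 => x 0 k) @^-1` [set a | 0 < a]) //.
  by apply: open_comp => [x _|]; [exact: coord_continuous|exact: open_gt].
have UfA A : open A -> open (U `&` f @^-1` A).
  move=> oA; apply/(real.2.1 _).
  pose W u : set 'rV[R]_4 := [set x : 'rV[R]_4 | 0 < x 0 l] `&` (phi u \o s) @^-1` A.
  pose B u : set 'rV[R]_4 := [set x : 'rV[R]_4 | D u /\ W u x].
  rewrite (_ : _ @^-1` _ = [set p | B (vertex_of p) (bary p)]).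
    apply: (open_tet (B := B)) => u.
    have [Du'|nD] := pselect (D u); last first.
      by rewrite (_ : B u = set0); [exact: open0|apply/seteqP; split=> x // []].
    rewrite (_ : B u = W u); last by apply/seteqP; split=> x; [case|split].
    apply: (continuous_inP _ (coord_open l)).1 => // x /set_mem hl.
    apply: continuous_comp; first exact: sc.
    exact: (chart_continuous ch).
  apply/seteqP; split=> p /=; rewrite Uq fq /fu.
    by case=> stp; rewrite asboolT //; case: stp.
  by move=> [Dp [hl hA]]; split=> //; rewrite asboolT.
have oU : open U.
  by have := UfA setT openT; rewrite preimage_setT setIT.
pose S x := \sum_(j < 4) x 0 j.
(* The inverse of [s]: division by the sum of the coordinates. On the orthant this sum is at least
   1; the maximum keeps [t] continuous everywhere. *)
pose t x : 'rV[R]_4 := \row_d (x 0 d / Num.max 1 (S x)).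
have S1 x : orthant l x -> 1 <= S x.
  move=> [hl h0]; rewrite /S (bigD1 l) //= hl lerDl; apply: sumr_ge0 => *; exact: h0.
have tE x : orthant l x -> forall d, t x 0 d = x 0 d / S x.
  by move=> /S1 h d; rewrite mxE max_r.
have tt x : orthant l x -> tetra R (t x).
  move=> ox; have h1 := S1 x ox; split=> [d|].
    by rewrite tE // divr_ge0 //; [case: ox|apply: le_trans h1].
  under eq_bigr => d _ do rewrite (tE x ox).
  by rewrite -mulr_suml divff // gt_eqF // (lt_le_trans _ h1).
have tc : continuous t.
  move=> x; apply: continuous_rV_at => d.
  rewrite (_ : (fun y => t y 0 d) = fun y : 'rV[R]_4 => y 0 d / Num.max 1 (S y)); last first.
    by apply/funext => y; rewrite mxE.
  have cc k : continuous (fun x : 'rV[R]_4 => x 0 k) by move=> ?; exact: coord_continuous.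
  have cS : continuous S.
    rewrite (_ : S = fun x : 'rV[R]_4 => x 0 0 + x 0 1 + x 0 2%:R + x 0 3%:R); last first.
      by apply/funext => y; rewrite /S sum_I4.
    by apply: cont_add => //; apply: cont_add => //; apply: cont_add.
  have cm : continuous (fun y => Num.max 1 (S y)).
    by apply: cont_max => //; exact: cont_cst.
  by apply: cont_div_at; [exact: cc|exact: cm|rewrite gt_eqF // lt_max ltr01].
have stx x : orthant l x -> s (t x) = x /\ 0 < t x 0 l.
  move=> ox; have h1 := S1 x ox; have S0 : 0 < S x by apply: lt_le_trans h1.
  have xl1 : x 0 l = 1 by case: ox.
  split; last by rewrite tE // xl1 divr_gt0.
  apply/rowP => d; rewrite mxE !tE // xl1 mul1r invrK mulfVK //.
  by rewrite gt_eqF.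
have ts x : tetra R x -> 0 < x 0 l -> t (s x) = x.
  move=> tx hl; have ox := os x tx hl; apply/rowP => d; rewrite tE // mxE.
  have -> : S (s x) = (x 0 l)^-1.
    rewrite /S; under eq_bigr => j _ do rewrite mxE.
    by rewrite -mulr_suml tx.2 mul1r.
  by rewrite invrK mulfVK // gt_eqF.
have [ux uxP] := choice (fun z => let: ex_intro u (ex_intro x h) := chart_surj ch z in
  ex_intro (fun ux : 'I_n * 'rV[R]_4 => [/\ D ux.1, orthant l ux.2 & phi ux.1 ux.2 = z]) (u, x) h).
have uxo z : orthant l (ux z).2 by case: (uxP z).
pose g z := q (tet_point (ux z).1 (tt _ (uxo z))).
have f_tet u x (ox : orthant l x) : D u -> f (q (tet_point u (tt x ox))) = phi u x.
  move=> Dv; have [h1 h2] := stx x ox.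
  by rewrite fq /fu asboolT ?h1 // /st.
have gE u x (ox : orthant l x) : D u -> g (phi u x) = q (tet_point u (tt x ox)).
  move=> Dv; rewrite /g; have [Dz oz Ez] := uxP (phi u x).
  have [xx r] := chart_inj ch Dz Dv oz ox Ez.
  rewrite (eq_tet_point (v := (ux (phi u x)).1) (y := t x) _ (tt x ox)) ?xx //.
  by apply: reach_glue r => d dl; rewrite xx tE // => ->; rewrite mul0r.
(* Continuity of the inverse rests on properness: by [chart_bound] all preimages of points near [z]
   lie in the compact set [K], and there a preimage away from those of [z] cannot map close to
   [z]. *)
have gc (z : 'rV[R]_3) A : nbhs (g z) A -> nbhs z (g @^-1` A).
  rewrite nbhsE => -[A' [oA' A'gz] A'A].
  have /open_tetE[B [oB AB]] : open (q @^-1` A') by apply/(real.2.1 A').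
  suff : nbhs z (g @^-1` A') by apply: filterS => z'; exact: A'A.
  pose b := \sum_(c < 3) `|z 0 c| + 1.
  have bz c : `|z 0 c| < b.
    rewrite /b (bigD1 c) //= -addrA ltrDl ltr_wpDl // sumr_ge0 //.
  pose I d := if d == l then `[(1:R), 1]%classic else `[(0:R), 3 * b]%classic.
  pose K : set 'rV[R]_4 := [set x | forall d, I d (x ord0 d)].
  have cK : compact K.
    by apply: (@rV_compact R 4 I) => d; rewrite /I; case: (d == l); exact: segment_compact.
  have KP x : orthant l x -> (forall d, d != l -> x 0 d <= 3 * b) -> K x.
    move=> [hl h0] hb d; rewrite /I; have [->|dl] := eqVneq d l.
      by rewrite /= in_itv /= hl lexx.
    by rewrite /= in_itv /= h0 hb.
  have Ko x : K x -> orthant l x.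
    move=> Kx; have xl1 : x 0 l = 1.
      have := Kx l; rewrite /I eqxx /= in_itv /= => /andP[h1 h2].
      by apply/eqP; rewrite eq_le h1 h2.
    split=> // d; have [->|dl] := eqVneq d l; first by rewrite xl1.
    by have := Kx d; rewrite /I (negbTE dl) /= in_itv /= => /andP[].
  have key u : \forall z' \near z, D u -> forall x, K x -> phi u x = z' -> B u (t x).
    have [Dv|nD] := pselect (D u); last first.
      have nT : nbhs z [set: 'rV[R]_3] by exact: filterT.
      by apply: filterS nT => z' _ /nD.
    have /compact_near_coveringP cov := cK.
    pose Q (z' : 'rV[R]_3) x := K x -> phi u x = z' -> B u (t x).
    have loc x : K x -> \forall x' \near x & z' \near z, Q z' x'.
      move=> Kx; have ox := Ko x Kx.
      have [E|nE] := pselect (phi u x = z).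
        have Bx : B u (t x).
          have := (AB (tet_point u (tt x ox))).1; rewrite /vertex_of /bary /=; apply.
          by rewrite /= -(gE u x ox Dv) E.
        exists (t @^-1` B u, setT); last by move=> [x' z'] [/= h _] _ _.
        by split; [apply: tc; exact: open_nbhs_nbhs|exact: filterT].
      have /eqP := nE; have := @norm_hausdorff _ 'rV[R]_3.
      rewrite open_hausdorff => /[apply] -[[A1 A2] /= [/set_mem xA1 /set_mem zA2] [oA1 oA2 dis]].
      exists (phi u @^-1` A1, A2).
        split=> /=; last exact: open_nbhs_nbhs.
        by apply: (chart_continuous ch Dv); exact: open_nbhs_nbhs.
      move=> [x' z'] /= [h1 h2] _ E; exfalso.
      have : (A1 `&` A2) z' by split; rewrite // -E.
      by move/eqP: dis => ->.
    have Qz : \forall z' \near z, K `<=` Q z' by exact: (cov _ (nbhs z) Q _ loc).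
    by apply: filterS Qz => z' h _ x Kx; exact: h.
  have near_b : \forall z' \near z, forall c : 'I_3, `|(z' : 'rV[R]_3) 0 c| <= b.
    apply: (@near_finite _ _ (nbhs z) (fun c (z' : 'rV[R]_3) => `|z' 0 c| <= b)) => c.
    have cn : continuous (fun z' : 'rV[R]_3 => `|z' 0 c|).
      by apply: cont_norm => ?; exact: coord_continuous.
    have : nbhs z ((fun z' : 'rV[R]_3 => `|z' 0 c|) @^-1` [set r | r < b]).
      by apply: cn; apply: open_nbhs_nbhs; split; [exact: open_lt|exact: bz].
    by apply: filterS => z' /= /ltW.
  have keyA : \forall z' \near z, forall u, D u -> forall x, K x -> phi u x = z' -> B u (t x).
    exact: (@near_finite _ _ (nbhs z) (fun u z' => D u -> forall x, K x -> phi u x = z' -> B u (t x)) _ key).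
  apply: filterS2 keyA near_b => z' h hb.
  have [Dz oz Ez] := uxP z'.
  apply/(AB (tet_point (ux z').1 (tt _ (uxo z')))); rewrite /vertex_of /bary /=.
  apply: h => //; apply: KP => // d dl.
  by apply: (chart_bound ch Dz oz) dl => c; rewrite Ez.
exists U, setT, f, g; split=> [||||y _].
- by split=> //; exact: openT.
- by rewrite (continuous_open_subspace f oU); apply/(continuous_inP f oU).
- by apply: continuous_subspaceT => z A; exact: gc.
- move=> x Ux; split=> //; have [p px] := real.1 x.
  move: Ux; rewrite -px Uq => stp; have [Dp hl] := stp.
  have tp := bary_tetra p; have op := os _ tp hl.
  rewrite fq /fu asboolT // (gE _ _ op Dp) [in RHS](tet_pointE p).
  by congr q; apply: eq_tet_point => //; exact: ts.
- have [Dz oz Ez] := uxP y; rewrite /g f_tet // Ez; split=> //.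
  rewrite Uq /st /vertex_of /bary /=; split=> //.
  by have [] := stx _ (uxo y).
Qed.

Theorem X_is_3manifold_from_charts : X_is_3manifold R n G.
Proof.
exists M, q; split; first exact: real.
by split; [exact: realisation_hausdorff|exact: realisation_locally_R3].
Qed.

End Manifold_from_charts.

(** * Ring manifolds *)

Section Ring_manifolds.
Variables (R : realType) (n' m r : nat).
Hypotheses (n_eq : n'.+1 = (6 * m + 2 * r)%N) (r_le : (r <= 2)%N).
Local Notation n := n'.+1.
Local Notation c0 := (0 : 'I_4).
Local Notation c1 := (1 : 'I_4).
Local Notation c2 := (2%:R : 'I_4).
Local Notation c3 := (3%:R : 'I_4).

(** There are [m] columns of three dipoles, and [r] spare dipoles in column [m], so that every even
    order is reached. *)
Definition valid_cell (w : cell) : bool :=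
  let: (x, y, b) := w in ((x < m) && (y < 3) || (x == m) && (y < r))%N.

Definition cell_code (w : cell) : nat := let: (x, y, b) := w in (6 * x + 2 * y + b)%N.

Definition cell_decode (v : nat) : cell := ((v %/ 6)%N, (v %% 6 %/ 2)%N, odd v).

Lemma cell_codeK w : valid_cell w -> cell_decode (cell_code w) = w.
Proof.
case: w => [[x y] b] /= h; have y3 : (y < 3)%N by move: h r_le; lia.
rewrite /cell_decode; congr (_, _, _).
- by case: b; lia.
- by case: b; lia.
- by rewrite !ssrnat.oddD; case: (odd x); case: (odd y); case: b.
Qed.

Lemma cell_decodeK v : cell_code (cell_decode v) = v.
Proof.
clear n_eq r_le; rewrite /cell_code /cell_decode.
have := odd_double_half v; rewrite -muln2; lia.
Qed.

Lemma cell_code_lt w : valid_cell w -> (cell_code w < n)%N.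
Proof. by case: w => [[x y] b] /=; rewrite n_eq; case: b; lia. Qed.

Lemma cell_decode_valid v : (v < n)%N -> valid_cell (cell_decode v).
Proof. rewrite n_eq /valid_cell /cell_decode => h; lia. Qed.

Variables (pi : {perm 'I_n}) (sigma : {perm 'I_m}).

Definition sg (s : {perm 'I_m}) (x : nat) : nat := if insub x is Some i then s i else x.

Lemma sgK (s : {perm 'I_m}) x : sg s^-1%g (sg s x) = x.
Proof.
have [xm|mx] := boolP (x < m)%N; last by rewrite /sg !insubN.
by rewrite /sg (insubT (fun y => y < m)%N xm) valK permK.
Qed.

Lemma sg_lt (s : {perm 'I_m}) x : (sg s x < m)%N = (x < m)%N.
Proof.
by rewrite /sg; case: insubP => [i -> _|/negbTE->] //; rewrite ltn_ord.
Qed.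

(** Exchanges layers 0 and 2 and permutes the columns. Seen through it the family has the same shape
    with colours 3, 2, 1 in place of 0, 1, 2. *)
Definition twist (s : {perm 'I_m}) (w : cell) : cell :=
  let: (x, y, b) := w in (sg s x, (2 - y)%N, b).

Lemma twistK (s : {perm 'I_m}) x y b : (y <= 2)%N ->
  twist s^-1%g (twist s (x, y, b)) = (x, y, b).
Proof. by move=> y2; rewrite /twist sgK subKn. Qed.

(** Only colour 3 sees [sigma]: it runs around layer 2 in the order given by [sigma]. In column [m]
    every colour joins the two ends of a dipole. *)
Definition family_step (c : 'I_4) (w : cell) : cell :=
  if (m <= w.1.1)%N then (w.1, ~~ w.2)
  else if c == c3 then twist sigma (ring_step c3 c2 c1 m m m c3 (twist sigma^-1%g w))
  else ring_step c0 c1 c2 m m m c w.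

Definition place (w : cell) : 'I_n := pi (inord (cell_code w)).
Definition unplace (u : 'I_n) : cell := cell_decode (pi^-1%g u).

Lemma placeK w : valid_cell w -> unplace (place w) = w.
Proof.
by move=> vw; rewrite /unplace /place permK inordK ?cell_codeK // cell_code_lt.
Qed.

Lemma unplaceK u : place (unplace u) = u.
Proof. by rewrite /place /unplace cell_decodeK inord_val permKV. Qed.

Lemma unplace_valid u : valid_cell (unplace u).
Proof. exact: cell_decode_valid. Qed.

Lemma ring_step_twist d x y b : (x < m)%N -> (y <= 2)%N -> d != c0 ->
  family_step d (twist sigma (x, y, b)) = twist sigma (ring_step c3 c2 c1 m m m d (x, y, b)).
Proof.
move=> xm y2 d0; rewrite /family_step twistK // leqNgt sg_lt xm /=.
case: eqP => [->//|/eqP d3]; have sx := sg_lt sigma x.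
have := I4P d; case=> E; rewrite E ?eqxx // in d0 d3 *.
- by rewrite /ring_step /twist /= sx xm; case: y y2 => [|[|[|y]]].
- by rewrite /ring_step /twist /= sx xm; case: y y2 => [|[|[|y]]].
Qed.

Lemma ring_step_straight d x y b : (x < m)%N -> d != c3 ->
  family_step d (x, y, b) = ring_step c0 c1 c2 m m m d (x, y, b).
Proof. by move=> xm d3; rewrite /family_step leqNgt xm (negbTE d3). Qed.

Lemma family_step_flip x y b : (x < m)%N -> (y < 2)%N ->
  family_step c3 (x, y, b) = (x, y, ~~ b).
Proof.
move=> xm y2; have xy : (x, y, b) = twist sigma (twist sigma^-1%g (x, y, b)).
  by rewrite -{1}[sigma]invgK twistK // ltnW.
rewrite {1}xy ring_step_twist ?leq_subr // ?sg_lt //.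
rewrite /ring_step /= subn_eq0 leqNgt y2 /= -[X in sg X]invgK sgK subKn //.
exact: ltnW.
Qed.

Lemma straight_chart : (0 < m)%N -> exists phi : cell -> 'rV[R]_4 -> 'rV[R]_3,
  chart c3 (ring_step c0 c1 c2 m m m) (ring_cell m m m) phi.
Proof. by move=> m0; apply: chart_ring; rewrite // leqnn. Qed.

Lemma twisted_chart : (0 < m)%N -> exists phi : cell -> 'rV[R]_4 -> 'rV[R]_3,
  chart c0 (ring_step c3 c2 c1 m m m) (ring_cell m m m) phi.
Proof. by move=> m0; apply: chart_ring; rewrite // leqnn. Qed.

Lemma ring_cellE w : ring_cell m m m w = ((w.1.1 < m) && (w.1.2 < 3))%N.
Proof. by case: w => [[x [|[|[|y]]]] b] /=; rewrite ?andbT ?andbF ?orbF. Qed.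

Lemma valid_cases w : valid_cell w -> (exists x y b, [/\ w = (x, y, b), (x < m)%N & (y <= 2)%N]) \/
  (exists y b, w = (m, y, b) /\ (y < r)%N).
Proof.
case: w => [[x y] b] /orP[/andP[xm y3]|/andP[/eqP-> yr]]; [left|right].
  by exists x, y, b.
by exists y, b.
Qed.

Lemma cell_twist x y b : (y <= 2)%N -> (x, y, b) = twist sigma (twist sigma^-1%g (x, y, b)).
Proof. by move=> y2; rewrite -{1}[sigma]invgK twistK. Qed.

Lemma family_step_valid c w : valid_cell w ->
  valid_cell (family_step c w) /\ family_step c (family_step c w) = w.
Proof.
case/valid_cases => [[x [y [b [-> xm y2]]]]|[y [b [-> yr]]]]; last first.
  by rewrite /family_step /= leqnn /= leqnn eqxx yr orbT negbK.
have m0 : (0 < m)%N by apply: leq_ltn_trans xm.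
have vr v : ring_cell m m m v -> valid_cell v.
  by rewrite ring_cellE; case: v => [[? ?] ?] /= ->.
have [->|cn] := eqVneq c c3; last first.
  have [phi ch] := straight_chart m0.
  have D : ring_cell m m m (x, y, b) by rewrite ring_cellE /= xm.
  have D' := chart_stable ch D cn.
  rewrite ring_step_straight //; split; first exact: vr.
  case E : (ring_step c0 c1 c2 m m m c (x, y, b)) => [[x' y'] b'].
  rewrite ring_step_straight // -?E ?(chart_invol ch D cn) //.
  by rewrite ring_cellE E in D'; case/andP: D'.
have [phi ch] := twisted_chart m0.
rewrite (cell_twist x b y2); case E0 : (twist _ (x, y, b)) => [[x0 y0] b0].
have [xm0 y02] : (x0 < m)%N /\ (y0 <= 2)%N.
  by case: E0 => <- <- _; rewrite sg_lt leq_subr.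
have D : ring_cell m m m (x0, y0, b0) by rewrite ring_cellE /= xm0.
have c30 : c3 != c0 by [].
have D' := chart_stable ch D c30; rewrite ring_step_twist //.
case E : (ring_step c3 c2 c1 m m m c3 (x0, y0, b0)) => [[x' y'] b'].
rewrite E ring_cellE /= in D'; case/andP: D' => xm' y2'.
split; last by rewrite ring_step_twist // -E (chart_invol ch D c30).
by apply: vr; rewrite ring_cellE /= sg_lt xm' /= ltnS leq_subr.
Qed.

Definition family_fun (c : 'I_4) (u : 'I_n) : 'I_n := place (family_step c (unplace u)).

Lemma family_funK c : involutive (family_fun c).
Proof.
move=> u; have [v1 v2] := family_step_valid c (unplace_valid u).
by rewrite /family_fun placeK // v2 unplaceK.
Qed.

Definition family_graph : colgraph n := [ffun c => perm (inv_inj (family_funK c))].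

Lemma family_graphE c w : valid_cell w -> family_graph c (place w) = place (family_step c w).
Proof. by move=> vw; rewrite ffunE permE /family_fun placeK. Qed.

Lemma family_step_side c w : (family_step c w).2 = ~~ w.2.
Proof.
rewrite /family_step; case: ifP => // _.
have rs a b e d v : (ring_step a b e m m m d v).2 = ~~ v.2.
  case: v => [[x y] [|]]; rewrite /ring_step;
  by do ![case: ifP => _].
have tw s v : (twist s v).2 = v.2 by case: v => [[x y] b].
by case: ifP => _; rewrite ?tw rs ?tw.
Qed.

Lemma family_graphK c : involutive (family_graph c).
Proof. by move=> u; rewrite ffunE !permE family_funK. Qed.

Lemma family_graph_side c u : (unplace (family_graph c u)).2 = ~~ (unplace u).2.
Proof.
rewrite -{1}[u]unplaceK family_graphE ?unplace_valid // placeK ?family_step_side //.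
by case: (family_step_valid c (unplace_valid u)).
Qed.

Lemma family_graph_neq c u : family_graph c u != u.
Proof. by apply/eqP => E; have := family_graph_side c u; rewrite E; case: (_.2). Qed.

Lemma family_colourful : colourful n family_graph.
Proof.
apply/andP; split.
  by apply/forallP => c; apply/forallP => u; rewrite family_graphK eqxx family_graph_neq.
pose side : {ffun 'I_n -> bool} := [ffun u => (unplace u).2].
have sideE u : side u = (unplace u).2 by rewrite ffunE.
apply/existsP; exists side; apply/forallP => c; apply/forallP => u.
by rewrite !sideE family_graph_side; case: (_.2).
Qed.

Lemma link_chart l (F Fi : cell -> cell) (D : pred cell) (step : 'I_4 -> cell -> cell)
  (phi : cell -> 'rV[R]_4 -> 'rV[R]_3) :
  {in D, cancel F Fi} -> (forall v, D v -> valid_cell (F v)) ->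
  (forall v d, D v -> d != l -> family_step d (F v) = F (step d v)) ->
  chart l step D phi -> forall v, D v ->
  exists (E : pred 'I_n) psi, E (place (F v)) /\ chart (R := R) l (fun d u => family_graph d u) E psi.
Proof.
move=> FK Fv Fs ch v Dv.
pose f w := place (F w); pose f' u := Fi (unplace u).
have fK : {in D, cancel f f'} by move=> w Dw; rewrite /f /f' placeK ?FK //; exact: Fv.
pose E u := D (f' u) && (f (f' u) == u).
have Ef w : D w -> E (f w) by move=> Dw; rewrite /E fK // eqxx andbT.
exists E, (fun u => phi (f' u)); split; first exact: Ef.
apply: chart_transport fK _ Ef _ ch => [u /andP[Du /eqP]|w d Dw dl] //.
by rewrite family_graphE ?Fs //; exact: Fv.
Qed.

(** Without colour 3 or colour 0 all columns form one full ring, straight or twisted. Without colour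
    1, layer 0 is cut off from the others; without colour 2, layer 2 is. Each part is a ring with
    fewer layers, and a spare dipole is a pair of cones. *)
Lemma family_charts l u : exists (E : pred 'I_n) psi,
  E u /\ chart (R := R) l (fun d u => family_graph d u) E psi.
Proof.
rewrite -[u]unplaceK; move: (unplace_valid u).
case/valid_cases => [[x [y [b [-> xm y2]]]]|[y [b [-> yr]]]]; last first.
  have [] := @chart_theta R l cell (fun d w => (w.1, ~~ w.2)) (m, y, false) (m, y, true).
  - by rewrite xpair_eqE andbF.
  - by [].
  move=> phi ch.
  apply: (link_chart (F := id) (Fi := id)) ch _ _ => [//|v /pred2P[]->|v d /pred2P[]-> _|].
  - by rewrite /= eqxx yr orbT.
  - by rewrite /= eqxx yr orbT.
  - by rewrite /family_step leqnn.
  - by rewrite /family_step leqnn.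
  by case: b; rewrite /= eqxx ?orbT.
have m0 : (0 < m)%N by apply: leq_ltn_trans xm.
have straight l' (s t : 'I_4) m1 m2 : c0 != l' -> s != l' -> t != l' -> c0 != s ->
    c0 != t -> s != t -> (m2 <= m1 <= m)%N ->
    (forall v d, ring_cell m m1 m2 v -> d != l' ->
      family_step d v = ring_step c0 s t m m1 m2 d v) ->
    ring_cell m m1 m2 (x, y, b) ->
    exists (E : pred 'I_n) psi, E (place (x, y, b)) /\
      chart (R := R) l' (fun d u => family_graph d u) E psi.
  move=> h1 h2 h3 h4 h5 h6 h7 hs Dv.
  have [phi ch] := chart_ring R h1 h2 h3 h4 h5 h6 m0 h7.
  apply: (link_chart (F := id) (Fi := id)) ch _ Dv => // -[[x' y'] b'] /=.
  move/andP: h7 => [h8 h9]; case: (y') => [|[|[|?]]] //=; rewrite ?orbF ?andbT => h; lia.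
have twisted l' (s t : 'I_4) m1 m2 : c3 != l' -> s != l' -> t != l' -> c3 != s ->
    c3 != t -> s != t -> (m2 <= m1 <= m)%N ->
    (forall v d, ring_cell m m1 m2 v -> d != l' ->
      family_step d (twist sigma v) = twist sigma (ring_step c3 s t m m1 m2 d v)) ->
    ring_cell m m1 m2 (twist sigma^-1%g (x, y, b)) ->
    exists (E : pred 'I_n) psi, E (place (x, y, b)) /\
      chart (R := R) l' (fun d u => family_graph d u) E psi.
  move=> h1 h2 h3 h4 h5 h6 h7 hs Dv.
  have [phi ch] := chart_ring R h1 h2 h3 h4 h5 h6 m0 h7.
  rewrite (cell_twist x b y2).
  have Dx v : ring_cell m m1 m2 v -> ring_cell m m m v.
    case: v => [[x' y'] b'] /=; move/andP: h7 => [h8 h9].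
    by case: (y') => [|[|[|?]]] //=; rewrite ?orbF ?andbT => h; lia.
  apply: (link_chart (F := twist sigma) (Fi := twist sigma^-1%g)) ch _ Dv => // -[[x' y'] b'].
    by move=> /Dx; rewrite ring_cellE /= => /andP[_ h]; rewrite sgK subKn.
  by move=> /Dx; rewrite ring_cellE /= sg_lt => /andP[-> _]; rewrite ltnS leq_subr.
have sm := sg_lt sigma^-1%g x.
case: (I4P l) => ->.
- apply: (twisted c0 c2 c1 m m); rewrite // ?leqnn //.
    move=> [[x' y'] b'] d; rewrite ring_cellE /= => /andP[h1 h2] dl.
    by rewrite -ring_step_twist.
  by rewrite ring_cellE /= sm xm ltnS leq_subr.
- have [y0|y0] := posnP y.
    apply: (straight c1 c2 c3 0%N 0%N) => //; last by rewrite /= y0 xm.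
    move=> [[x' y'] b'] d; rewrite /= ?ltn0 ?andbF ?orbF => /andP[/eqP-> h1] dl.
    have [->|d3] := eqVneq d c3; first by rewrite family_step_flip.
    by rewrite ring_step_straight //; case: (I4P d) dl d3 => -> //; rewrite /ring_step /= ?ltn0 ?andbF.
  apply: (twisted c1 c2 c0 m 0%N); rewrite // ?leqnn //; last first.
    by rewrite /= sm xm; move: y0 y2; case: (y) => [|[|[|z]]].
  move=> [[x' y'] b'] d /= h dl; have [xm' y'1] : (x' < m)%N /\ (y' <= 1)%N.
    by case: y' h => [|[|[|y']]] //=; rewrite ?ltn0 ?orbF ?andbT.
  have [->|d0] := eqVneq d c0.
    rewrite ring_step_straight ?sg_lt // /ring_step /twist /= ?ltn0 /=.
    by case: y' y'1 {h} => [|[|y']].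
  rewrite ring_step_twist ?(leq_trans y'1) //; congr twist; rewrite /ring_step.
  by case: (I4P d) dl d0 => -> //= _ _; rewrite ?ltn0 ?andbF.
- have [y2'|y2'] := leqP y 1.
    apply: (straight c2 c1 c3 m 0%N); rewrite // ?leqnn //; last first.
      by rewrite /= xm; move: y2 y2'; case: (y) => [|[|[|z]]].
    move=> [[x' y'] b'] d /= h dl; have [xm' y'1] : (x' < m)%N /\ (y' <= 1)%N.
      by case: y' h => [|[|[|y']]] //=; rewrite ?ltn0 ?orbF ?andbT.
    have [->|d3] := eqVneq d c3; first by rewrite family_step_flip // /ring_step /= ?ltn0.
    by rewrite ring_step_straight // /ring_step; case: (I4P d) dl d3 => -> //= _ _; rewrite ?ltn0 ?andbF.
  have yE : y = 2%N by apply/eqP; rewrite eqn_leq y2 y2'.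
  apply: (twisted c2 c0 c1 0%N 0%N) => //; last by rewrite /= yE sm xm.
  move=> [[x' y'] b'] d; rewrite /= ?ltn0 ?andbF ?orbF => /andP[/eqP-> h1] dl.
  have [->|d0] := eqVneq d c0.
    by rewrite ring_step_straight ?sg_lt // /ring_step /= ?ltn0 ?andbF.
  rewrite ring_step_twist //; congr twist; rewrite /ring_step.
  by case: (I4P d) dl d0 => -> //= _ _; rewrite ?ltn0 ?andbF.
- apply: (straight c3 c1 c2 m m); rewrite // ?leqnn //; last by rewrite ring_cellE /= xm.
  move=> [[x' y'] b'] d; rewrite ring_cellE /= => /andP[h1 h2] dl.
  by rewrite ring_step_straight.
Qed.

Lemma family_manifold : family_graph \in manifold_graphs R n.
Proof.
rewrite inE family_colourful /=; apply/asboolP.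
apply: X_is_3manifold_from_charts; [exact: family_graphK|exact: family_graph_neq|].
exact: family_charts.
Qed.

End Ring_manifolds.

(** * Counting *)

Lemma sg_val (m : nat) (s : {perm 'I_m}) (i : 'I_m) : sg s i = s i.
Proof. by rewrite /sg valK. Qed.

(** The graph and four marked vertices determine [pi] and [sigma], whence the factor [n'.+1 ^ 4].
    Following colours from the first three marks recovers [pi] on the ring and on the spare dipoles;
    following colour 3 around layer 2 from the fourth recovers [sigma]. *)
Lemma count_manifold_graphs (R : realType) (n' m r : nat) :
  n'.+1 = (6 * m + 2 * r)%N -> (r <= 2)%N ->
  (n'.+1`! * m`! <= #|manifold_graphs R n'.+1| * n'.+1 ^ 4)%N.
Proof.
move=> n_eq r_le; set n := n'.+1.
pose marks (ps : {perm 'I_n} * {perm 'I_m}) :=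
  (place ps.1 (0, 0, false)%N, place ps.1 (m, 0, false)%N, place ps.1 (m, 1, false)%N,
   place ps.1 (sg ps.2 0, 2, false)%N).
pose f ps := (family_graph R n_eq r_le ps.1 ps.2, marks ps).
have f_inj : injective f.
  move=> [pi sigma] [pi' sigma'] [/= EG E1 E2 E3 E4].
  pose P w := place pi w = place pi' w.
  have next c w w' : valid_cell m r w -> P w -> family_step sigma c w = w' ->
      family_step sigma' c w = w' -> P w'.
    move=> vw Pw e e'; have h := family_graphE R n_eq r_le pi sigma c vw.
    have h' := family_graphE R n_eq r_le pi' sigma' c vw.
    by rewrite e in h; rewrite e' in h'; rewrite /P -h -h' EG Pw.
  have flip0 x b : (x < m)%N -> P (x, 0, b)%N -> P (x, 0, ~~ b)%N.
    move=> xm Px; apply: (next 2%:R (x, 0, b)%N); rewrite /= ?xm //;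
    by rewrite ring_step_straight //= /ring_step /= andbF.
  have layer0 x b : (x < m)%N -> P (x, 0, b)%N.
    have base x0 : (x0 < m)%N -> P (x0, 0, false)%N.
      elim: x0 => [|x0 IH] xm //.
      apply: (next 0 (x0, 0, true)%N); rewrite /= ?(ltnW xm) //.
      - exact: (flip0 x0 false (ltnW xm) (IH (ltnW xm))).
      - by rewrite ring_step_straight ?(ltnW xm) //= ltn_eqF.
      - by rewrite ring_step_straight ?(ltnW xm) //= ltn_eqF.
    by move=> xm; case: b; [apply: (flip0 x false xm)|]; exact: base.
  have layer1 x b : (x < m)%N -> P (x, 1, b)%N.
    move=> xm; apply: (next 1 (x, 0, ~~ b)%N); rewrite /= ?xm //; first exact: layer0.
    - by rewrite ring_step_straight //= /ring_step /= xm negbK.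
    - by rewrite ring_step_straight //= /ring_step /= xm negbK.
  have layer2 x b : (x < m)%N -> P (x, 2, b)%N.
    move=> xm; apply: (next 2%:R (x, 1, ~~ b)%N); rewrite /= ?xm //; first exact: layer1.
    - by rewrite ring_step_straight //= /ring_step /= xm negbK.
    - by rewrite ring_step_straight //= /ring_step /= xm negbK.
  have extra y b : (y < r)%N -> P (m, y, b).
    have base y0 : (y0 < r)%N -> P (m, y0, false) by case: y0 => [|[|y0]] // h; lia.
    move=> yr; case: b; last exact: base.
    apply: (next 0 (m, y, false)); rewrite /= ?eqxx ?yr ?orbT //; first exact: base.
    - by rewrite /family_step /= leqnn.
    - by rewrite /family_step /= leqnn.
  have Pall w : valid_cell m r w -> P w.
    case/valid_cases => [[x [y [b [-> xm]]]]|[y [b [-> yr]]]]; last exact: extra.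
    by case: y => [|[|[|y]]] // _; [exact: layer0|exact: layer1|exact: layer2].
  have pE : pi = pi'.
    apply/permP => u; have vu : valid_cell m r (cell_decode u).
      exact: (cell_decode_valid n_eq r_le).
    by have := Pall _ vu; rewrite /P /place cell_decodeK inord_val.
  subst pi'; congr (_, _).
  have ring_next (s : {perm 'I_m}) x : (x.+1 < m)%N -> family_step s 3%:R (sg s x, 2, true)%N = (sg s x.+1, 2, false)%N.
    move=> xm; have := @ring_step_twist m s 3%:R x 0 true (ltnW xm) isT isT.
    by rewrite /= ltn_eqF.
  have sE x : (x < m)%N -> sg sigma x = sg sigma' x.
    have unpl w w' : valid_cell m r w -> valid_cell m r w' -> place pi w = place pi w' -> w = w'.
      by move=> v v' E; rewrite -(placeK n_eq r_le pi v) E (placeK n_eq r_le pi v').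
    have vs (s : {perm 'I_m}) y b : (y < m)%N -> valid_cell m r (sg s y, 2, b)%N by move=> h; rewrite /valid_cell sg_lt h.
    elim: x => [|x IH] xm.
      by have [] := unpl _ _ (vs sigma _ _ xm) (vs sigma' _ _ xm) E4.
    have h := family_graphE R n_eq r_le pi sigma 3%:R (vs sigma x true (ltnW xm)).
    have h' := family_graphE R n_eq r_le pi sigma' 3%:R (vs sigma' x true (ltnW xm)).
    rewrite EG (IH (ltnW xm)) h' ring_next // -(IH (ltnW xm)) ring_next // in h.
    by have [] := unpl _ _ (vs sigma' _ _ xm) (vs sigma _ _ xm) h.
  by apply/permP => i; apply: val_inj; rewrite /= -!sg_val sE.
have -> : (n`! * m`!)%N = #|{: {perm 'I_n} * {perm 'I_m}}| by rewrite card_prod !card_Sn.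
have -> : (#|manifold_graphs R n| * n ^ 4)%N =
    #|finset.setX (manifold_graphs R n) [set: 'I_n * 'I_n * 'I_n * 'I_n]%SET|.
  by rewrite cardsX cardsT !card_prod card_ord !expnS expn0 muln1 !mulnA.
rewrite -(card_imset _ f_inj); apply: subset_leq_card; apply/fintype.subsetP => _ /imsetP[ps _ ->].
by rewrite finset.in_setX finset.in_setT andbT; exact: family_manifold.
Qed.

(** * Asymptotic comparison of the two counts *)

Section Asymptotics.
Variable R : realType.

Lemma expR1_ge2 : 2 <= expR 1 :> R.
Proof. by have := expR_ge1Dx (1 : R); rewrite -natr1 => /le_trans; apply. Qed.

Lemma nat_le_expR (n : nat) : n%:R <= expR n%:R :> R.
Proof. by apply: le_trans (expR_ge1Dx _); rewrite lerDr. Qed.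

Lemma factorial_lower_bound (n : nat) : n%:R ^+ n <= expR n%:R * (n`!)%:R :> R.
Proof.
elim: n => [|n IH]; first by rewrite expr0 expR0 mul1r.
have [->|n0] := posnP n; first by rewrite expr1 mulr1; exact: nat_le_expR.
(* This is [1 + 1/n <= e^(1/n)] raised to the power [n]. *)
have step : (n.+1%:R : R) ^+ n <= expR 1 * n%:R ^+ n.
  have nR : (0 : R) < n%:R by rewrite ltr0n.
  have -> : (n.+1%:R : R) = n%:R * (1 + n%:R^-1) by rewrite mulrDr mulr1 divff ?gt_eqF // natr1.
  rewrite exprMn mulrC ler_pM2r ?exprn_gt0 //.
  have -> : expR 1 = expR (n%:R^-1) ^+ n :> R by rewrite -expRM_natl divff ?gt_eqF.
  by apply: lerXn2r; rewrite ?nnegrE ?expR_ge0 ?addr_ge0 ?invr_ge0 ?expR_ge1Dx.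
have -> : expR n.+1%:R * (n.+1)`!%:R = n.+1%:R * (expR 1 * (expR n%:R * n`!%:R)) :> R.
  by rewrite factS natrM -natr1 expRD; ring.
rewrite exprS ler_pM2l ?ltr0n //.
by apply: le_trans step _; rewrite ler_pM2l ?expR_gt0.
Qed.

Lemma expR_le_pow2 (n : nat) : (2 ^ n)%:R <= expR n%:R :> R.
Proof.
rewrite natrX -[n%:R]mulr1 expRM_natl; apply: lerXn2r; rewrite ?nnegrE ?expR_ge0 //.
exact: expR1_ge2.
Qed.

(* With [n = 6 m + O(1)] this is [n^(7n/6) <= C^n n! m!]. *)
Lemma factorials_lower_bound (n m r : nat) : n = (6 * m + 2 * r)%N -> (r <= 2)%N ->
  (0 < m)%N ->
  expR (7 / 6 * n%:R * ln n%:R) <= expR (7 * n%:R) * ((n`! * m`!)%:R : R).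
Proof.
move=> nE r2 m0; have n0 : (0 < n)%N by lia.
have nR : (0 : R) < n%:R by rewrite ltr0n.
have L0 : 0 <= ln (n%:R : R) by rewrite ln_ge0 // ler1n.
have nX k : (n%:R : R) ^+ k = expR (k%:R * ln n%:R) by rewrite expRM_natl lnK // posrE.
(* Since [n <= 6 (m + 1)], rounding [n/6] down costs one factor [n]. *)
have h1 : expR (7 / 6 * n%:R * ln n%:R) <= n%:R ^+ n * (n%:R ^+ m * n%:R) :> R.
  rewrite -exprSr !nX -expRD ler_expR -mulrDl ler_wpM2r //.
  have : (n%:R : R) <= 6 * m.+1%:R by rewrite -natrM ler_nat; lia.
  by lra.
apply: le_trans h1 _.
have h2 : (n%:R : R) ^+ m <= expR (5 * n%:R) * (m`!)%:R.
  (* Here [n <= 6 m + 4 <= 16 m], and [16 = 2 ^ 4]. *)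
  have : (n%:R : R) ^+ m <= (2 ^ (4 * m))%:R * m%:R ^+ m.
    rewrite expnM natrX -exprMn; apply: lerXn2r; rewrite ?nnegrE ?mulr_ge0 //.
    by rewrite -natrM ler_nat; lia.
  move/le_trans; apply.
  have := ler_pM _ _ (expR_le_pow2 (4 * m)) (factorial_lower_bound m).
  rewrite ler0n exprn_ge0 ?ler0n // => /(_ isT isT)/le_trans; apply.
  rewrite mulrA -expRD ler_wpM2r ?ler0n // ler_expR natrM.
  have : (m%:R : R) <= n%:R by rewrite ler_nat; lia.
  by lra.
rewrite natrM.
have -> : expR (7 * n%:R) * (n`!%:R * m`!%:R) =
    (expR n%:R * n`!%:R) * ((expR (5 * n%:R) * m`!%:R) * expR n%:R) :> R.
  have -> : 7 * n%:R = n%:R + (5 * n%:R + n%:R) :> R by lra.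
  by rewrite !expRD; ring.
apply: ler_pM; rewrite ?exprn_ge0 ?mulr_ge0 ?exprn_ge0 ?ler0n //.
  exact: factorial_lower_bound.
by apply: ler_pM; rewrite ?exprn_ge0 ?ler0n ?nat_le_expR.
Qed.

Lemma nverts_le n (G : colgraph n) : (nverts G <= 4 * n)%N.
Proof.
rewrite /nverts (_ : (4 * n)%N = \sum_(c < 4) n)%N; last by rewrite sum_nat_const card_ord.
apply: leq_sum => c _; apply: leq_trans (max_card _) _; by rewrite card_ord.
Qed.

Lemma manifold_graphs_gt0 n : (2 <= n)%N -> ~~ odd n -> (0 < #|manifold_graphs R n|)%N.
Proof.
case: n => // n' n2 ev.
have n_eq : n'.+1 = (6 * (n'.+1 %/ 6) + 2 * (n'.+1 %% 6 %/ 2))%N by move: ev; lia.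
have r_le : (n'.+1 %% 6 %/ 2 <= 2)%N by lia.
have := count_manifold_graphs R n_eq r_le.
by case: #|_| => //; rewrite mul0n leqn0 muln_eq0 !eqn0Ngt !fact_gt0.
Qed.

(** The constant 28: the codes give [2 ^ (8 + 9 n)], the factorials [e^(7n)] and the marks
    [n^4 <= e^(4n)], together at most [8 + 20 n <= 28 n] in the exponent. The bound [v <= 3 * n]
    keeps [7 * n - 2 * v] from being truncated. *)
Lemma few_bad_graphs (n v : nat) (A : {set colgraph n}) : ~~ odd n ->
  (6 < n)%N -> A \subset manifold_graphs R n ->
  (forall G, G \in A -> (v <= nverts G)%N) -> (v <= 3 * n)%N ->
  #|A|%:R <= expR (28 * n%:R - v%:R / 3 * ln n%:R) * #|manifold_graphs R n|%:R :> R.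
Proof.
case: n A => // n' A ev n6 AM Av v3; set n := n'.+1.
have n_eq : n = (6 * (n %/ 6) + 2 * (n %% 6 %/ 2))%N by move: ev; rewrite /n; lia.
have r_le : (n %% 6 %/ 2 <= 2)%N by lia.
have m0 : (0 < n %/ 6)%N by move: n6; rewrite /n; lia.
have cM := count_manifold_graphs R n_eq r_le.
have cF := factorials_lower_bound n_eq r_le m0.
have cA : (#|A| <= 256 * 2 ^ n * (4 ^ n) ^ 4 * n ^ ((7 * n - 2 * v) %/ 6))%N.
  apply: card_planar_colourful => // G GA; split; last exact: Av.
  have := fintype.subsetP AM G GA; rewrite inE => /andP[cG /asboolP mG].
  exact: manifold_planar_colourful cG mG.
set E := ((7 * n - 2 * v) %/ 6)%N in cA.
set M := #|manifold_graphs R n| in cM *; set L := ln (n%:R : R).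
have nR : (0 : R) < n%:R by rewrite ltr0n.
have n1 : (1 : R) <= n%:R by rewrite ler1n.
have L0 : 0 <= L by rewrite ln_ge0.
have Ln : L <= n%:R by exact: ltW (ln_sublinear nR).
have nX k : (n%:R : R) ^+ k = expR (k%:R * L) by rewrite expRM_natl lnK // posrE.
have hA : #|A|%:R <= expR ((8 + 9 * n)%:R) * expR (E%:R * L) :> R.
  rewrite -nX; apply: le_trans (ler_wpM2r _ (expR_le_pow2 _)); last by rewrite exprn_ge0.
  rewrite -natrX -natrM ler_nat; apply: leq_trans cA _.
  rewrite leq_mul2r; apply/orP; right.
  by rewrite -[256%N]/(2 ^ 8)%N -[4%N]/(2 ^ 2)%N -!expnM -!expnD leq_exp2l //; lia.
have hM : (n`! * (n %/ 6)`!)%:R <= M%:R * expR (4 * L) :> R.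
  by rewrite -nX -natrX -natrM ler_nat.
have hE : E%:R * L <= (7 / 6 * n%:R - v%:R / 3) * L.
  apply: ler_wpM2r => //.
  have : (6 * E + 2 * v <= 7 * n)%N by rewrite /E; lia.
  by rewrite -(ler_nat R) natrD !natrM; lra.
apply: le_trans hA _.
have h1 : expR ((8 + 9 * n)%:R) * expR (E%:R * L) <=
    expR (8 + 9 * n%:R - v%:R / 3 * L) * expR (7 / 6 * n%:R * L).
  by rewrite -!expRD ler_expR natrD natrM; move: hE; rewrite mulrBl; lra.
apply: le_trans h1 _.
have h2 : expR (7 / 6 * n%:R * L) <= expR (7 * n%:R) * (M%:R * expR (4 * L)).
  by apply: le_trans cF _; rewrite ler_pM2l ?expR_gt0.
apply: le_trans (ler_wpM2l (expR_ge0 _) h2) _.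
rewrite [M%:R * _]mulrC !mulrA -!expRD ler_wpM2r ?ler0n // ler_expR.
lra.
Qed.

End Asymptotics.

Theorem theorem2 (R : realType) (c : R) (hc : 0 < c) :
  exists K : R, 0 < K /\
    forall n : nat, (2 <= n)%N -> ~~ odd n ->
      1 - expR (- (c * n%:R)) <= prob_few_vertices R n K.
Proof.
(* Below, [v L / 3] is at least [(29 + c) n - L / 3], and 29 exceeds 28 by the unit that absorbs
   [L / 3]. The factor 4 matches [nverts_le]: if [ln n <= K / 4], then [K n / ln n] is at least
   [4 n] and no graph is bad. *)
pose K := 4 * (29 + c); exists K; have K0 : 0 < K by rewrite /K; lra.
split=> // n n2 ev.
have M0 := manifold_graphs_gt0 R n2 ev.
have nR : (0 : R) < n%:R by rewrite ltr0n; lia.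
set L := ln (n%:R : R).
have L0 : 0 < L by rewrite ln_gt0 // ltr1n.
have Ln : L < n%:R by exact: ln_sublinear.
rewrite /prob_few_vertices; set S := [set G in _ | _]%SET; set M := manifold_graphs R n.
have MR : (0 : R) < #|M|%:R by rewrite ltr0n.
rewrite ler_pdivlMr //.
have SM : S \subset M by apply/fintype.subsetP => G; rewrite finset.in_set => /andP[].
pose bad := (M :\: S)%SET.
have cS : #|S|%:R = #|M|%:R - #|bad|%:R :> R.
  by rewrite /bad cardsDS // natrB ?subset_leq_card // subKr.
suff : #|bad|%:R <= expR (- (c * n%:R)) * #|M|%:R :> R by rewrite cS mulrBl mul1r; lra.
have badP G : G \in bad -> K * n%:R / L < (nverts G)%:R.
  by rewrite !inE => /andP[nS GM]; move: nS; rewrite GM /= -ltNge.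
have [small|large] := lerP L (K / 4).
  have -> : bad = finset.set0; last by rewrite cards0 mulr_ge0 ?expR_ge0 ?ler0n.
  apply/setP => G; rewrite finset.in_set0; apply/negP => /badP.
  rewrite ltNge => /negP; apply; rewrite ler_pdivlMr //.
  have h : ((nverts G)%:R : R) <= 4 * n%:R by rewrite -natrM ler_nat nverts_le.
  apply: le_trans (ler_wpM2r (ltW L0) h) _.
  have h' := ler_wpM2l (ltW nR) small; lra.
have n6 : (6 < n)%N.
  by rewrite -(ltr_nat R); apply: lt_trans Ln; move: large; rewrite /K; lra.
(* The cap [3 n] is the one of [few_bad_graphs]; since [L > K / 4], it still leaves
   [x L >= (3/4) K n]. *)
pose x := Num.min (K * n%:R / L) (3 * n%:R); pose v := Num.truncn x.
have x0 : 0 <= x.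
  rewrite le_min; apply/andP; split; last by lra.
  by apply: divr_ge0; [apply: mulr_ge0; exact: ltW|exact: ltW].
have /andP[vx xv] := truncn_itv x0.
have v3 : (v <= 3 * n)%N.
  by rewrite -(ler_nat R) natrM; apply: le_trans vx _; rewrite ge_min lexx orbT.
have badv G : G \in bad -> (v <= nverts G)%N.
  move/badP => h; rewrite -(ler_nat R); apply: le_trans vx _.
  by rewrite ge_min (ltW h).
have bM : bad \subset M by exact: finset.subsetDl.
apply: le_trans (few_bad_graphs ev n6 bM badv v3) _.
rewrite ler_wpM2r ?ler0n // ler_expR -/L.
have xL : 3 / 4 * K * n%:R <= x * L.
  rewrite /x; case: (leP (K * n%:R / L) (3 * n%:R)) => _.
    by rewrite divfK ?gt_eqF //; have := mulr_gt0 K0 nR; lra.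
  by have := ler_wpM2l (ltW nR) (ltW large); lra.
have vL : x * L <= v%:R * L + L.
  have := ler_wpM2r (ltW L0) (ltW xv); rewrite -natr1 mulrDl mul1r.
  exact.
move: xL; rewrite /K => xL; lra.
Qed.
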